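(* Let $X=X(\mathbb R)$ be a Banach lattice satisfying Assumption A, and let $r,s\in\mathbb N$ with $2r\ge s$. Let $(\mathcal G_\sigma)_{\sigma\ge1}$ be linear sampling operators with $\mathcal G_\sigma:X_\sigma\to\mathcal B_X^\sigma$, for which there are constants $K_1,K_3,K_4>0$ such that for all $\sigma\ge1$ $$\|\mathcal G_\sigma f\|_X\le K_1\|f\|_{X_\sigma}\ \ (f\in X_\sigma),\qquad K_4\sigma^{-s}\|g^{(s)}\|_X\le\|g-\mathcal G_\sigma g\|_X\le K_3\sigma^{-s}\|g^{(s)}\|_X\ \ (g\in\mathcal B_X^\sigma).$$ Then for all $\sigma\ge1$ and $f\in X_\sigma$ $$\|f-\mathcal G_\sigma f\|_X+\|f-\mathcal G_\sigma f\|_{X_\sigma}\asymp\|(I-\dot A_{\gamma/\sigma})^sf\|_X+\|(I-A_{\gamma/\sigma})^rf\|_{X_\sigma},$$ where $\asymp$ denotes a two-sided inequality with positive constants independent of $f$ and $\sigma$.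
   Context: $\mu$ is Lebesgue measure on $\mathbb R$. A Banach lattice $X=X(\mathbb R)$ is a Banach space of measurable functions on $\mathbb R$ such that: 1) if $f$ is measurable, $g\in X$ and $|f|\le|g|$, then $f\in X$ and $\|f\|_X\le\|g\|_X$; 2) if $f_n\in X$, $\sup_n\|f_n\|_X<\infty$ and $0\le f_n\uparrow f$, then $f\in X$ and $\|f_n\|_X\to\|f\|_X$; 3) for every measurable $E$ with $\mu(E)<\infty$, $\chi_E\in X$ and there is $c_E>0$ with $\int_E|f|\,d\mu\le c_E\|f\|_X$. Functions in $X$ are regarded as finite-valued and defined at every point, not as equivalence classes. Standing assumptions (used to ensure convergence of the sampling series when the functions $\varphi_{k,\sigma}$ are not compactly supported): $X$ has an order continuous norm ($f_n\downarrow0$ a.e. implies $\|f_n\|_X\to0$) and the Schwartz space $\mathcal S$ is dense in $X$. Steklov averages: $A_hf(x)=\frac1h\int_{x-h/2}^{x+h/2}f(t)\,dt$ and $\dot A_hf(x)=A_hf(x+\tfrac h2)$ for $h>0$; $I$ is the identity. Assumption A: $A_hf\in X$ for all $f\in X$, $h>0$, and $\sup_{h>0,\,\|f\|_X\le1}\|A_hf\|_X<\infty$. $\mathcal B_X^\sigma=\{g\in X\cap\mathcal S'(\mathbb R):\operatorname{supp}\widehat g\subset[-\sigma,\sigma]\}$ (Fourier transform in the sense of tempered distributions; such band-limited functions are understood as their continuous representatives). $(\Phi_\sigma)_{\sigma>0}$ are nested linear subspaces of $X$ ($\Phi_{\sigma'}\subset\Phi_\sigma$ for $\sigma'\le\sigma$,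 $\Phi_0=\{0\}$) satisfying $\|\varphi^{(q)}\|_X\le(B\sigma)^q\|\varphi\|_X$ for all $q\in\mathbb N$, $\varphi\in\Phi_\sigma$, with a constant $B=B_X>0$. (If $X$ is translation-invariant, spline spaces of smoothness $s$ are also admitted, with this inequality required only for $q\le s$.) Sampling operators: $\mathcal G_\sigma f(x)=\sum_{k\in\mathbb Z}f(x_{k,\sigma})\varphi_{k,\sigma}(x)$, where $\varphi_{k,\sigma}\in\Phi_\sigma$ and $x_k=x_{k,\sigma}\in\mathbb R$ are distinct nodes such that for some fixed $\gamma,\gamma'>0$, $\frac\gamma\sigma\le x_{k+1,\sigma}-x_{k,\sigma}\le\frac{\gamma'}\sigma$ for all $k\in\mathbb Z$; $\gamma$ in the claim is this constant. Put $\|f\|_{X_\sigma}=\big\|\sum_{k\in\mathbb Z}|f(x_k)|\chi_{[x_k,x_{k+1})}\big\|_X$; $f\in X_\sigma$ means $f\in X$ and $\|f\|_{X_\sigma}<\infty$. It is assumed that for all $f\in X_\sigma$ the series defining $\mathcal G_\sigma f$ converges in the norm of $X$. *)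

(* Defs.v *)
From HB Require Import structures.
From mathcomp Require Import all_boot all_order all_algebra.
From mathcomp Require Import complex.
From mathcomp Require Import all_classical all_reals all_analysis.
Set Implicit Arguments.
Unset Strict Implicit.
Unset Printing Implicit Defensive.
Import Order.TTheory GRing.Theory Num.Theory.
Import ComplexField.Normc.
Import numFieldNormedType.Exports.
Local Open Scope classical_set_scope.
Local Open Scope complex_scope.
Local Open Scope ring_scope.

(* [completed_lebesgue_measure] lives on a copy of [R] that carries the
   sigma-algebra of Lebesgue (not only Borel) measurable sets. *)
Notation lebT R := (caratheodory_type (wlength (@idfun R))^*%mu).
Notation leb R := (@completed_lebesgue_measure R).

Section complex_functions.
Context {R : realType}.
Implicit Types (f g : R -> R[i]) (D : set R).

Definition re f : R -> R := fun x => complex.Re (f x).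
Definition im f : R -> R := fun x => complex.Im (f x).

Definition cmeasurable f :=
  measurable_fun (setT : set (lebT R)) (re f) /\
  measurable_fun (setT : set (lebT R)) (im f).

Definition cintegral D f : R[i] :=
  Rintegral (leb R) D (re f) +i* Rintegral (leb R) D (im f).

Definition ccontinuous f := continuous (re f) /\ continuous (im f).

Definition csmooth f := forall n x,
  derivable (derive1n n (re f)) x 1 /\ derivable (derive1n n (im f)) x 1.

Definition cderiv (n : nat) f : R -> R[i] :=
  fun x => derive1n n (re f) x +i* derive1n n (im f) x.

Definition steklov (h : R) f : R -> R[i] :=
  fun x => (h^-1)%:C * cintegral `[x - h / 2, x + h / 2] f.

Definition dsteklov (h : R) f : R -> R[i] := fun x => steklov h f (x + h / 2).

(* (I - A)^m f *)
Definition defect (A : (R -> R[i]) -> (R -> R[i])) (m : nat) f : R -> R[i] :=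
  iter m (fun u => u \- A u) f.

End complex_functions.

Section distributions.
Context {R : realType}.
Implicit Types (phi psi : R -> R[i]) (T : (R -> R[i]) -> R[i]).

Definition schwartz_le phi (j k : nat) (M : R) :=
  forall x, `|x| ^+ j * normc (cderiv k phi x) <= M.

Definition schwartz phi :=
  csmooth phi /\ forall j k, exists M, schwartz_le phi j k M.

Definition test_function (U : set R) phi :=
  csmooth phi /\
  exists K, [/\ compact K, K `<=` U & forall x, ~ K x -> phi x = 0].

(* Functionals are total; only their values on Schwartz functions matter.
   Continuity is boundedness by one of the norms
   max_(j, k <= N) sup_x |x|^j |phi^(k)(x)|. *)
Definition tempered T :=
  [/\ forall phi psi, schwartz phi -> schwartz psi ->
        T (phi \+ psi) = T phi + T psi,
      forall (a : R[i]) phi, schwartz phi ->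
        T (fun x => a * phi x) = a * T phi
    & exists (N : nat) (C : R), forall phi M, schwartz phi ->
        (forall j k, (j <= N)%N -> (k <= N)%N -> schwartz_le phi j k M) ->
        normc (T phi) <= C * M].

Definition represented_by T (g : R -> R[i]) :=
  forall phi, test_function setT phi ->
    T phi = cintegral setT (fun x => g x * phi x).

Definition fourier phi : R -> R[i] :=
  fun xi => cintegral setT (fun x => (cos (xi * x) -i* sin (xi * x)) * phi x).

Definition dist_fourier T : (R -> R[i]) -> R[i] := fun phi => T (fourier phi).

Definition vanishes_on T (U : set R) :=
  forall phi, test_function U phi -> T phi = 0.

Definition dist_supp T : set R :=
  [set x | forall U : set R, open U -> U x -> ~ vanishes_on T U].

End distributions.

(* Elements are genuine functions, defined everywhere; the norm only sees
   their classes modulo equality almost everywhere. *)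
Record banach_lattice (R : realType) := BanachLattice {
  bl_car : set (R -> R[i]) ;
  bl_norm : (R -> R[i]) -> R ;
  bl_measurable : forall f, bl_car f -> cmeasurable f ;
  bl_car0 : bl_car (fun=> 0) ;
  bl_carD : forall f g, bl_car f -> bl_car g -> bl_car (f \+ g) ;
  bl_carZ : forall (a : R[i]) f, bl_car f -> bl_car (fun x => a * f x) ;
  bl_norm_ge0 : forall f, bl_car f -> 0 <= bl_norm f ;
  bl_norm_eq0 : forall f, bl_car f ->
    (bl_norm f = 0 <-> {ae leb R, forall x, f x = 0}) ;
  bl_normD : forall f g, bl_car f -> bl_car g ->
    bl_norm (f \+ g) <= bl_norm f + bl_norm g ;
  bl_normZ : forall (a : R[i]) f, bl_car f ->
    bl_norm (fun x => a * f x) = normc a * bl_norm f ;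
  bl_complete : forall F : nat -> R -> R[i], (forall n, bl_car (F n)) ->
    (forall e : R, 0 < e -> exists N, forall m n, (N <= m)%N -> (N <= n)%N ->
       bl_norm (F m \- F n) < e) ->
    exists2 f, bl_car f & (fun n => bl_norm (F n \- f)) @ \oo --> (0 : R) ;
  bl_ideal : forall f g, cmeasurable f -> bl_car g ->
    {ae leb R, forall x, normc (f x) <= normc (g x)} ->
    bl_car f /\ bl_norm f <= bl_norm g ;
  bl_fatou : forall (u : nat -> R -> R) (v : R -> R),
    (forall n, bl_car (fun x => (u n x)%:C)) ->
    (exists M, forall n, bl_norm (fun x => (u n x)%:C) <= M) ->
    {ae leb R, forall x, (forall n, 0 <= u n x <= u n.+1 x) /\
                         (fun n => u n x) @ \oo --> v x} ->
    bl_car (fun x => (v x)%:C) /\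
    (fun n => bl_norm (fun x => (u n x)%:C)) @ \oo -->
      bl_norm (fun x => (v x)%:C) ;
  bl_finite : forall E : set (lebT R), measurable E -> (leb R E < +oo)%E ->
    bl_car (fun x => (\1_E x)%:C) /\
    exists2 c : R, 0 < c & forall f, bl_car f ->
      (\int[leb R]_(x in E) (normc (f x))%:E <= (c * bl_norm f)%:E)%E }.

Section lattice_notions.
Context {R : realType} (X : banach_lattice R).
Implicit Types (f g : R -> R[i]) (sigma : R).

Definition bl_enorm f : \bar R :=
  if `[< bl_car X f >] then (bl_norm X f)%:E else +oo%E.

Definition order_continuous_norm := forall u : nat -> R -> R,
  (forall n, bl_car X (fun x => (u n x)%:C)) ->
  {ae leb R, forall x, (forall n, u n.+1 x <= u n x) /\
                       (fun n => u n x) @ \oo --> (0 : R)} ->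
  (fun n => bl_norm X (fun x => (u n x)%:C)) @ \oo --> (0 : R).

Definition schwartz_dense :=
  (forall phi, schwartz phi -> bl_car X phi) /\
  forall f (e : R), bl_car X f -> 0 < e ->
    exists2 phi, schwartz phi & bl_norm X (f \- phi) < e.

Definition assumptionA :=
  (forall h f, 0 < h -> bl_car X f -> bl_car X (steklov h f)) /\
  exists C : R, forall h f, 0 < h -> bl_car X f -> bl_norm X f <= 1 ->
    bl_norm X (steklov h f) <= C.

Definition bandlimited sigma g :=
  [/\ bl_car X g, ccontinuous g
    & exists T, [/\ tempered T, represented_by T g
        & dist_supp (dist_fourier T) `<=` `[- sigma, sigma]]].

Definition bernstein_spaces (Phi : R -> set (R -> R[i])) (B : R) :=
  [/\ forall sigma, 0 < sigma ->
        [/\ Phi sigma `<=` bl_car X, Phi sigma (fun=> 0)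
          & forall (a : R[i]) f g, Phi sigma f -> Phi sigma g ->
              Phi sigma (fun x => a * f x + g x)],
      forall sigma' sigma, 0 <= sigma' -> sigma' <= sigma ->
        Phi sigma' `<=` Phi sigma,
      Phi 0 = [set (fun=> 0)]
    & forall sigma phi, 0 < sigma -> Phi sigma phi ->
        csmooth phi /\ forall q, (0 < q)%N ->
          (bl_enorm (cderiv q phi) <= ((B * sigma) ^+ q * bl_norm X phi)%:E)%E].

(* The sum over all integers is pointwise finite as soon as the half-open
   intervals are disjoint, which holds for increasing nodes. *)
Definition sample_step (x : int -> R) f : R -> R := fun t =>
  \sum_(k \in [set: int]) normc (f (x k)) * \1_(`[x k, x (k + 1)[) t.

Definition sample_enorm (x : int -> R) f : \bar R :=
  bl_enorm (fun t => (sample_step x f t)%:C).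

Definition sampled_space (x : int -> R) f :=
  bl_car X f /\ (sample_enorm x f < +oo)%E.

(* the terms with index k in [-m, n] *)
Definition sampling_sum (x : int -> R) (phi : int -> R -> R[i]) f (m n : nat) :
    R -> R[i] := fun t =>
  \sum_(i < (m + n).+1) f (x (i%:Z - m%:Z)) * phi (i%:Z - m%:Z) t.

Definition sampling_operators (Phi : R -> set (R -> R[i]))
    (x : R -> int -> R) (phi : R -> int -> R -> R[i]) (gamma gamma' : R)
    (G : R -> (R -> R[i]) -> (R -> R[i])) :=
  forall sigma, 1 <= sigma ->
  [/\ forall k, Phi sigma (phi sigma k),
      injective (x sigma),
      forall k, gamma / sigma <= x sigma (k + 1) - x sigma k <= gamma' / sigma
    & forall f, sampled_space (x sigma) f ->
        forall e : R, 0 < e -> exists N, forall m n, (N <= m)%N -> (N <= n)%N ->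
          (bl_enorm (G sigma f \- sampling_sum (x sigma) (phi sigma) f m n)%R
             < e%:E)%E].

End lattice_notions.

(* Main.v *)
(* Assumption A bounds on X, uniformly in H > 0, the majorant of w obtained by
   convolving |w| with the Poisson kernel of height H, because this kernel is a
   superposition of Steklov kernels.  Hence every operator with a kernel
   dominated by it is bounded on X, and so is the passage to the step function
   sampling the result at nodes with gaps of order H.  In particular, with
   h = gamma / sigma and A, A' the centred and the forward average:
   - (I - A') ^ s u and the sampled (I - A) ^ r u are controlled by h ^ s u^(s),
     since I - A is of second order and s <= 2 r;
   - u in B_X^sigma satisfies u = V * u for a de la Vallee-Poussin kernel V, so
     its sampled norm is at most a multiple of its norm (Nikolskii);
   - u is approximated by some g in B_X^sigma with ||u - g|| and
     sigma ^ (- s) ||g^(s)|| at most a multiple of ||(I - A') ^ s u||: first by a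
     smooth function, u minus a power of I - A' ^ (2 s) applied to u, where
     h ||A' A' u'|| <= K ||(I - A') u|| is obtained by absorption, and then by
     convolution with kernels such as V.
   If g = G f, then f = (f - g) + g, and
   K4 sigma ^ (- s) ||g^(s)|| <= ||G f - G G f|| = ||G (f - G f)|| is bounded by
   the sampled norm of f - G f; this estimates the moduli by the error.
   Conversely, with g as above for a Schwartz function near f,
   f - G f = (f - g) + (g - G g) + G (g - f), where the sampled norm of
   v = f - g is at most that of (I - A) ^ r v plus a multiple of ||v||.  *)

Require Import Defs.
From HB Require Import structures.
From mathcomp Require Import all_boot all_order all_algebra.
From mathcomp Require Import complex.
From mathcomp Require Import all_classical all_reals all_analysis.
From mathcomp Require Import measurable_realfun ring lra zify.
Set Implicit Arguments.
Unset Strict Implicit.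
Unset Printing Implicit Defensive.
Import Order.TTheory GRing.Theory Num.Theory.
Import numFieldNormedType.Exports.
Local Open Scope classical_set_scope.
Local Open Scope ring_scope.

(** * Integration over the Lebesgue sigma-algebra *)

(** This shapes the absorption step. The identity for h u' contains a translate of the defect of u;
    u is therefore averaged twice, since a translated average is still below the majorant, and this
    is why 2 s averages accompany s derivatives. Moreover the operator to be absorbed, [ramp], need
    not have norm below 1 on X; but its kernel has mass 1/2 while the support of its iterates only
    grows linearly, so the bound 2^(-n) (1 + (n + 1)^2) C for the power n + 1 eventually drops below
    1/2. A second obstacle: f is defined pointwise and may be discontinuous, so approximation in
    norm says nothing about its values at nodes. Those values are never approximated: subtracting
    averages changes a sampled norm by at most a multiple of the norm, and what remains is (I - A)^r
    f at the nodes, a term of the right-hand side, and (I - A)^r g with g smooth. *)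

Section completed_lebesgue.
Context {R : realType}.
Local Notation lmu := (@lebesgue_measure R).
Local Notation cmu := (leb R).

Lemma measurable_lebT (A : set R) : measurable A -> measurable (A : set (lebT R)).
Proof. by move=> mA; exact: (@sub_caratheodory _ _ _ (wlength idfun)). Qed.

Lemma measurable_fun_lebT d (T : measurableType d) (D : set R) (f : R -> T) :
  measurable D -> measurable_fun D f -> measurable_fun (D : set (lebT R)) f.
Proof. by move=> mD mf _ B mB; apply: measurable_lebT; apply: mf. Qed.

Lemma lebE (A : set R) : measurable A -> cmu A = lmu A.
Proof.
move=> mA; rewrite /= /completed_lebesgue_measure /completed_lebesgue_stieltjes_measure.
rewrite /completed_measure_extension /lebesgue_measure /lebesgue_stieltjes_measure.
rewrite /measure_extension //.
Qed.

(** The identity is measurable from the completed space to the Borel line and transports the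
    completed measure to Lebesgue measure, so nonnegative Borel functions transfer by change of
    variables, and signed ones through their two parts. *)
Lemma integral_leb (D : set R) (f : R -> \bar R) : measurable D ->
  measurable_fun D f ->
  (\int[cmu]_(x in D) f x = \int[lmu]_(x in D) f x)%E.
Proof.
move=> mD mf.
have ge0 (g : R -> \bar R) : measurable_fun D g -> (forall x, 0 <= g x)%E ->
    (\int[cmu]_(x in D) g x = \int[lmu]_(x in D) g x)%E.
  move=> mg g0.
  have mid : measurable_fun (setT : set (lebT R)) (idfun : lebT R -> measurableTypeR R).
    by apply: measurable_fun_lebT => //; exact: measurable_id.
  transitivity (\int[pushforward cmu (idfun : lebT R -> measurableTypeR R)]_(x in D) g x)%E.
    by rewrite (ge0_integral_pushforward mid).
  by apply: eq_measure_integral => A mA _; exact: lebE.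
rewrite integralE [RHS]integralE; congr (_ - _)%E; apply: ge0 => //.
  exact: measurable_funepos.
exact: measurable_funeneg.
Qed.

Lemma Rintegral_leb (D : set R) (f : R -> R) : measurable D ->
  measurable_fun D f -> Rintegral cmu D f = Rintegral lmu D f.
Proof.
by move=> mD mf; rewrite /Rintegral integral_leb//; exact/measurable_EFinP.
Qed.

Lemma integrable_leb (D : set R) (f : R -> \bar R) : measurable D ->
  measurable_fun D f -> cmu.-integrable D f <-> lmu.-integrable D f.
Proof.
move=> mD mf; split=> /integrableP[_ fi]; apply/integrableP; split => //.
- by rewrite -integral_leb//; exact: measurableT_comp.
- exact: measurable_fun_lebT.
- by rewrite integral_leb//; exact: measurableT_comp.
Qed.


Lemma measurable_fun_cont (D : set R) (f : R -> R) :
  measurable D -> continuous f -> measurable_fun (D : set (lebT R)) f.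
Proof.
move=> mD cf; apply: measurable_fun_lebT => //.
by apply: measurable_funTS; exact: continuous_measurable_fun.
Qed.

(** The pushforward under t -> a + c t, multiplied by c, gives each half-open interval its length,
    and uniqueness of Lebesgue measure identifies it. *)
Lemma lebesgue_measure_affine (a c : R) (A : set R) : 0 < c -> measurable A ->
  lmu ((fun t => a + c * t) @^-1` A) = ((c^-1)%:E * lmu A)%E.
Proof.
move=> c0 mA.
pose phi (t : measurableTypeR R) : measurableTypeR R := a + c * t.
have mphi : measurable_fun setT phi.
  by apply: continuous_measurable_fun => t; apply: cvgD; [exact: cvg_cst|apply: cvgM; [exact: cvg_cst|exact: cvg_id]].
have c1 : 0 <= c by exact: ltW.
pose m0 := mscale (NngNum c1) (pushforward lmu phi).
pose m := m0 mphi.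
suff -> : lmu A = m A.
  by rewrite /m /m0 /mscale/= muleA -EFinM mulVf ?gt_eqF// mul1e.
apply: lebesgue_measure_unique => // X [[u v]] _ <-.
transitivity (c%:E * lmu (phi @^-1` `]u, v]))%E; last by [].
rewrite (_ : phi @^-1` _ = `](u - a) / c, (v - a) / c]%classic); last first.
  apply/seteqP; split => t /=; rewrite /phi !in_itv/= ltr_pdivrMr// ler_pdivlMr// => /andP[h1 h2];
    by apply/andP; split; lra.
rewrite !lebesgue_measure_itv/= !lte_fin ltr_pM2r ?invr_gt0// ltrD2r.
have c' : c != 0 by rewrite gt_eqF.
case: ifPn => _; last by rewrite mule0.
rewrite -EFinB -EFinM; congr _%:E.
by field.
Qed.


Lemma ge0_integral_affine (a c : R) (f : R -> \bar R) : 0 < c ->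
  measurable_fun setT f -> (forall x, 0 <= f x)%E ->
  (\int[lmu]_x f (a + c * x)%R = (c^-1)%:E * \int[lmu]_x f x)%E.
Proof.
move=> c0 mf f0.
pose phi (t : measurableTypeR R) : measurableTypeR R := a + c * t.
have mphi : measurable_fun setT phi.
  by apply: continuous_measurable_fun => t; apply: cvgD; [exact: cvg_cst|apply: cvgM; [exact: cvg_cst|exact: cvg_id]].
have c1 : 0 <= c^-1 by rewrite invr_ge0 ltW.
have := ge0_integral_pushforward mphi lmu (measurableT : measurable [set: measurableTypeR R]) mf (fun x _ => f0 x).
rewrite preimage_setT => <-.
rewrite -(@ge0_integral_mscale _ _ _ lmu setT _ (NngNum c1) f)//.
by apply: eq_measure_integral => A mA _; exact: lebesgue_measure_affine.
Qed.

Lemma ge0_integral_opp (f : R -> \bar R) :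
  measurable_fun setT f -> (forall x, 0 <= f x)%E ->
  (\int[lmu]_x f (- x)%R = \int[lmu]_x f x)%E.
Proof.
move=> mf f0.
pose phi (t : measurableTypeR R) : measurableTypeR R := - t.
have mphi : measurable_fun setT phi.
  by apply: continuous_measurable_fun => t; apply: cvgN; exact: cvg_id.
have := ge0_integral_pushforward mphi lmu (measurableT : measurable [set: measurableTypeR R]) mf (fun x _ => f0 x).
rewrite preimage_setT => <-.
by apply: eq_measure_integral => A mA _; exact: lebesgue_measureN.
Qed.

Local Notation I := (Rintegral cmu).
Local Notation intg D f := (cmu.-integrable D (EFin \o f)).

Lemma integral_affine (a c : R) (f : R -> \bar R) : 0 < c ->
  lmu.-integrable setT f ->
  (\int[lmu]_x f (a + c * x)%R = (c^-1)%:E * \int[lmu]_x f x)%E.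
Proof.
move=> c0 fi; have mf := measurable_int _ fi.
rewrite integralE [in RHS]integralE.
rewrite (_ : (fun x : R => f (a + c * x)) = f \o (fun x => a + c * x))//.
rewrite funepos_comp funeneg_comp.
rewrite (@ge0_integral_affine a c (f^\+)%E)//; last exact: measurable_funepos.
rewrite (@ge0_integral_affine a c (f^\-)%E)//; last exact: measurable_funeneg.
rewrite [RHS]muleBr//; apply: fin_num_adde_defl; rewrite fin_numN.
exact: integrable_neg_fin_num.
Qed.

Lemma integral_opp (f : R -> \bar R) :
  measurable_fun setT f ->
  (\int[lmu]_x f (- x)%R = \int[lmu]_x f x)%E.
Proof.
move=> mf; rewrite integralE [in RHS]integralE.
rewrite (_ : (fun x : R => f (- x)) = f \o (fun x => - x))//.
rewrite funepos_comp funeneg_comp.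
rewrite (@ge0_integral_opp (f^\+)%E)//; last exact: measurable_funepos.
by rewrite (@ge0_integral_opp (f^\-)%E)//; exact: measurable_funeneg.
Qed.

Lemma integrable_affine (a c : R) (f : R -> \bar R) : 0 < c ->
  lmu.-integrable setT f -> lmu.-integrable setT (fun x : R => f (a + c * x)).
Proof.
move=> c0 /integrableP[mf fi]; apply/integrableP; split.
  apply: measurableT_comp => //; apply: continuous_measurable_fun => t.
  by apply: cvgD; [exact: cvg_cst|apply: cvgM; [exact: cvg_cst|exact: cvg_id]].
rewrite (@ge0_integral_affine a c (fun x => `|f x|%E))//; last exact: measurableT_comp.
by rewrite lte_mul_pinfty// lee_fin invr_ge0 ltW.
Qed.

Lemma integrable_opp (f : R -> \bar R) :
  lmu.-integrable setT f -> lmu.-integrable setT (fun x : R => f (- x)).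
Proof.
move=> /integrableP[mf fi]; apply/integrableP; split.
  have cN : continuous (fun t : R => - t) by move=> t; apply: cvgN; exact: cvg_id.
  by apply: measurableT_comp => //; exact: continuous_measurable_fun cN.
by rewrite (@ge0_integral_opp (fun x => `|f x|%E))//; exact: measurableT_comp.
Qed.

End completed_lebesgue.

(** * Real integrals on the completed line *)

Section real_integral.
Context {R : realType}.
Implicit Types (D E : set R) (f g : R -> R) (a b c k : R).

Definition Int D f : R := Rintegral (leb R) D f.
Definition intg D f : Prop := (leb R).-integrable D (EFin \o f).
Definition meas f : Prop := measurable_fun (setT : set (lebT R)) f.

Lemma measS D f : meas f -> measurable_fun (D : set (lebT R)) f.
Proof. by move=> mf; apply: measurable_funTS. Qed.

Lemma meas_cont f : continuous f -> meas f.
Proof. exact: measurable_fun_cont. Qed.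

Lemma meas_cst k : meas (fun=> k).
Proof. exact: measurable_cst. Qed.

Lemma measB f g : meas f -> meas g -> meas (fun x => f x - g x).
Proof. exact: measurable_funB. Qed.

Lemma measM f g : meas f -> meas g -> meas (fun x => f x * g x).
Proof. exact: measurable_funM. Qed.

Lemma meas_norm f : meas f -> meas (fun x => `|f x|).
Proof. by move=> mf; apply: measurableT_comp. Qed.

Lemma measurable_itv_lebT (i : interval R) : measurable ([set` i] : set (lebT R)).
Proof. by apply: measurable_lebT; exact: measurable_itv. Qed.

Lemma measurableT_lebT : measurable ([set: R] : set (lebT R)).
Proof. exact: measurableT. Qed.

Hint Resolve measurable_itv_lebT measurableT_lebT : core.

Lemma intg_le D f g : measurable (D : set (lebT R)) -> meas f ->
  (forall x, D x -> `|f x| <= g x) -> intg D g -> intg D f.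
Proof.
move=> mD mf fg gi; apply: (@le_integrable _ _ _ _ _ mD (EFin \o f) (EFin \o g)) => //.
  by apply/measurable_EFinP; exact: measS.
by move=> x Dx /=; rewrite lee_fin (le_trans (fg x Dx))// ler_norm.
Qed.

Lemma intgS D E f : measurable (D : set (lebT R)) -> measurable (E : set (lebT R)) ->
  D `<=` E -> intg E f -> intg D f.
Proof. by move=> mD mE DE; exact: (@integrableS _ _ _ (leb R) E D). Qed.

Lemma intgD D f g : measurable (D : set (lebT R)) -> intg D f -> intg D g ->
  intg D (fun x => f x + g x).
Proof. by move=> mD fi gi; exact: (integrableD mD fi gi). Qed.

Lemma intgB D f g : measurable (D : set (lebT R)) -> intg D f -> intg D g ->
  intg D (fun x => f x - g x).
Proof. by move=> mD fi gi; exact: (integrableB mD fi gi). Qed.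

Lemma intgZ D k f : measurable (D : set (lebT R)) -> intg D f ->
  intg D (fun x => k * f x).
Proof. by move=> mD fi; exact: (integrableZl mD k fi). Qed.

Lemma intg_norm D f : measurable (D : set (lebT R)) -> intg D f ->
  intg D (fun x => `|f x|).
Proof. by move=> mD fi; exact: (integrable_norm fi). Qed.

Lemma eq_Int D f g : (forall x, D x -> f x = g x) -> Int D f = Int D g.
Proof. by move=> fg; apply: eq_Rintegral => x /set_mem; exact: fg. Qed.

Lemma IntD D f g : measurable (D : set (lebT R)) -> intg D f -> intg D g ->
  Int D (fun x => f x + g x) = Int D f + Int D g.
Proof. by move=> mD fi gi; exact: RintegralD. Qed.

Lemma IntB D f g : measurable (D : set (lebT R)) -> intg D f -> intg D g ->
  Int D (fun x => f x - g x) = Int D f - Int D g.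
Proof. by move=> mD fi gi; exact: RintegralB. Qed.

Lemma IntZ D k f : measurable (D : set (lebT R)) -> intg D f ->
  Int D (fun x => k * f x) = k * Int D f.
Proof. by move=> mD fi; exact: RintegralZl. Qed.

Lemma le_Int D f g : measurable (D : set (lebT R)) -> intg D f -> intg D g ->
  (forall x, D x -> f x <= g x) -> Int D f <= Int D g.
Proof. by move=> mD fi gi fg; rewrite /Int; apply: le_Rintegral. Qed.

Lemma Int_ge0 D f : (forall x, D x -> 0 <= f x) -> 0 <= Int D f.
Proof. by move=> f0; rewrite /Int; apply: Rintegral_ge0. Qed.

Lemma norm_Int D f : measurable (D : set (lebT R)) -> intg D f ->
  `|Int D f| <= Int D (fun x => `|f x|).
Proof. by move=> mD fi; rewrite /Int; apply: le_normr_Rintegral. Qed.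

Lemma norm_Int_le D f g : measurable (D : set (lebT R)) -> meas f -> intg D g ->
  (forall x, D x -> `|f x| <= g x) -> `|Int D f| <= Int D g.
Proof.
move=> mD mf gi fg; have fi : intg D f by exact: intg_le gi.
by apply: (le_trans (norm_Int mD fi)); apply: le_Int => //; exact: intg_norm.
Qed.

Lemma EFin_Int D f : measurable (D : set (lebT R)) -> intg D f -> (Int D f)%:E = (\int[leb R]_(x in D) (f x)%:E)%E.
Proof. by move=> mD fi; rewrite /Int /Rintegral fineK//; apply: integrable_fin_num. Qed.

Lemma Int_subset D E f : measurable (D : set (lebT R)) ->
  measurable (E : set (lebT R)) -> D `<=` E -> intg E f ->
  (forall x, E x -> 0 <= f x) -> Int D f <= Int E f.
Proof.
move=> mD mE DE fi f0; rewrite -lee_fin !EFin_Int//; last exact: intgS fi.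
apply: ge0_subset_integral; [exact: mD|exact: mE|by case/integrableP : fi| |exact: DE].
by move=> x Ex; rewrite lee_fin f0.
Qed.

Lemma Int_cst a b k : a <= b -> Int `[a, b] (fun=> k) = k * (b - a).
Proof.
move=> ab; rewrite /Int Rintegral_leb; [|exact: measurable_itv|exact: measurable_cst].
rewrite Rintegral_cst; last exact: measurable_itv.
congr (k * _); apply: (etrans (congr1 fine (lebesgue_measure_itv `[a, b]))) => /=.
rewrite lte_fin; move: ab; rewrite le_eqVlt => /predU1P[->|ab]; first by rewrite ltxx subrr.
by rewrite ab.
Qed.

Lemma intg_itv a b f : continuous f -> intg `[a, b] f.
Proof.
move=> cf; apply/integrable_leb.
- exact: measurable_itv.
- by apply/measurable_EFinP; apply: measurable_funTS; exact: continuous_measurable_fun.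
- apply: continuous_compact_integrable; first exact: segment_compact.
  exact: continuous_subspaceT.
Qed.

Lemma Int_ftc a b f (F : R -> R) : a <= b -> continuous f ->
  (forall x : R, is_derive x 1 F (f x)) -> Int `[a, b] f = F b - F a.
Proof.
move=> ab cf dF; have cF : continuous F.
  by move=> x; apply/differentiable_continuous/derivable1_diffP; exact: (@ex_derive _ _ _ _ _ _ _ (dF x)).
move: ab; rewrite le_eqVlt => /predU1P[->|ab].
  by rewrite subrr /Int set_itv1 Rintegral_leb ?Rintegral_set1//; exact: measurable_fun_set1.
rewrite /Int Rintegral_leb; last 2 first.
- exact: measurable_itv.
- by apply: measurable_funTS; exact: continuous_measurable_fun.
rewrite /Rintegral (@continuous_FTC2 _ f F)//.
- exact: continuous_subspaceT.
- split.
  + by move=> x _; exact: (@ex_derive _ _ _ _ _ _ _ (dF x)).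
  + exact: (cvg_at_right_filter (cF a)).
  + exact: (cvg_at_left_filter (cF b)).
- by move=> x _; rewrite derive1E; exact: (@derive_val _ _ _ _ _ _ _ (dF x)).
Qed.

End real_integral.
Global Hint Resolve measurable_itv_lebT measurableT_lebT : core.

(** * Smooth functions *)

Section smooth_functions.
Context {R : realType}.
Implicit Types (f g F : R -> R) (a b c k x : R) (n m : nat).

Definition smooth f := forall n x, derivable (derive1n n f) x 1.

Lemma is_derive_derive1 f x (d : R) : is_derive x 1 f d -> (derive1 f) x = d.
Proof. by move=> fd; rewrite derive1E; exact: derive_val. Qed.

Lemma smooth_is_derive f x : smooth f -> is_derive x 1 f ((derive1 f) x).
Proof. by move=> sf; rewrite derive1E; apply: DeriveDef => //; exact: (sf 0%N x). Qed.

Lemma is_derive_val f x (d d' : R) : is_derive x 1 f d -> d = d' -> is_derive x 1 f d'.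
Proof. by move=> fd <-. Qed.

Lemma is_derive_cont f (df : R -> R) :
  (forall x : R, is_derive x 1 f (df x)) -> continuous f.
Proof.
by move=> fd x; apply/differentiable_continuous/derivable1_diffP; exact: (@ex_derive _ _ _ _ _ _ _ (fd x)).
Qed.

Lemma smooth_cont f : smooth f -> continuous f.
Proof. by move=> sf; apply: is_derive_cont => x; exact: smooth_is_derive. Qed.

Lemma smooth_derive1 f : smooth f -> smooth (derive1 f).
Proof. by move=> sf n x; rewrite -derive1Sn; exact: (sf n.+1). Qed.

Lemma derive1_eq F f : (forall x : R, is_derive x 1 F (f x)) -> (derive1 F) = f.
Proof. by move=> Ff; apply/funext => x; exact: is_derive_derive1. Qed.

Lemma smooth_primitive F f : (forall x : R, is_derive x 1 F (f x)) ->
  smooth f -> smooth F.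
Proof.
move=> Ff sf [|n] x; first exact: (@ex_derive _ _ _ _ _ _ _ (Ff x)).
by rewrite derive1Sn (derive1_eq Ff); exact: sf.
Qed.

(** Replaces inductions over explicit iterated derivatives: to prove smoothness it suffices to
    exhibit a class stable under differentiation and large enough to contain the function. *)
Lemma smooth_coind (C : set (R -> R)) :
  (forall f, C f -> exists2 g, C g & forall x : R, is_derive x 1 f (g x)) ->
  C `<=` smooth.
Proof.
move=> CD f Cf n; elim: n f Cf => [|n IH] f Cf x; have [g Cg fg] := CD f Cf.
  exact: (@ex_derive _ _ _ _ _ _ _ (fg x)).
by rewrite derive1Sn (derive1_eq fg); exact: IH.
Qed.

(** The product rule leaves the class of products but stays in the algebra generated by smooth
    functions, so [smooth_coind] is applied to that algebra. *)
Inductive smooth_alg : (R -> R) -> Prop :=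
| smooth_alg_base f : smooth f -> smooth_alg f
| smooth_algD f g : smooth_alg f -> smooth_alg g -> smooth_alg (fun x => f x + g x)
| smooth_algM f g : smooth_alg f -> smooth_alg g -> smooth_alg (fun x => f x * g x).

Lemma is_deriveD_fun f g (df dg : R) x : is_derive x 1 f df -> is_derive x 1 g dg ->
  is_derive x 1 (fun t => f t + g t) (df + dg).
Proof. exact: is_deriveD. Qed.

Lemma is_deriveM_fun f g (df dg : R) x : is_derive x 1 f df -> is_derive x 1 g dg ->
  is_derive x 1 (fun t => f t * g t) (df * g x + f x * dg).
Proof.
move=> fd gd; rewrite addrC (mulrC df) -![_ * _]/(_ *: _ : R^o); exact: is_deriveM.
Qed.

Lemma is_deriveZ_fun k f (df : R) x : is_derive x 1 f df ->
  is_derive x 1 (fun t => k * f t) (k * df).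
Proof.
move=> fd; apply: (is_derive_val (is_deriveM_fun (is_derive_cst k x 1) fd)).
by rewrite mul0r add0r.
Qed.

Lemma is_deriveB_fun f g (df dg : R) x : is_derive x 1 f df -> is_derive x 1 g dg ->
  is_derive x 1 (fun t => f t - g t) (df - dg).
Proof. exact: is_deriveB. Qed.

Lemma is_derive_affine f (df : R) a b x : is_derive (a * x + b) 1 f df ->
  is_derive x 1 (fun t => f (a * t + b)) (a * df).
Proof.
move=> fd; have ad : is_derive x 1 (fun t => a * t + b) a.
  rewrite -[X in is_derive _ _ _ X]addr0; apply: is_deriveD_fun.
  apply: (is_derive_val (is_deriveM_fun (is_derive_cst a x 1) (is_derive_id x 1))).
  by rewrite mul0r add0r mulr1.
apply: (is_derive_val (@is_derive1_comp _ f (fun t => a * t + b) x _ _ fd ad)).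
by rewrite mulrC.
Qed.

Lemma smooth_alg_smooth f : smooth_alg f -> smooth f.
Proof.
apply: smooth_coind => {}f; elim=> {f}.
- move=> f sf; exists (derive1 f); last by move=> x; exact: smooth_is_derive.
  exact/smooth_alg_base/smooth_derive1.
- move=> f g _ [df sdf fd] _ [dg sdg gd].
  exists (fun x => df x + dg x); first exact: smooth_algD.
  by move=> x; exact: is_deriveD_fun.
- move=> f g sf [df sdf fd] sg [dg sdg gd].
  exists (fun x => df x * g x + f x * dg x).
    by apply: smooth_algD; exact: smooth_algM.
  by move=> x; exact: is_deriveM_fun.
Qed.

Lemma smoothD f g : smooth f -> smooth g -> smooth (fun x => f x + g x).
Proof. by move=> sf sg; apply: smooth_alg_smooth; apply: smooth_algD; exact: smooth_alg_base. Qed.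

Lemma smoothM f g : smooth f -> smooth g -> smooth (fun x => f x * g x).
Proof. by move=> sf sg; apply: smooth_alg_smooth; apply: smooth_algM; exact: smooth_alg_base. Qed.

Lemma smooth_cst k : smooth (fun=> k).
Proof.
apply: (@smooth_coind [set f | exists k, f = fun=> k]); last by exists k.
by move=> _ [c ->]; exists (fun=> 0); [exists 0|move=> x; exact: is_derive_cst].
Qed.

Lemma smoothZ k f : smooth f -> smooth (fun x => k * f x).
Proof. by move=> sf; apply: (smoothM _ sf); exact: smooth_cst. Qed.

Lemma smoothB f g : smooth f -> smooth g -> smooth (fun x => f x - g x).
Proof.
move=> sf sg; rewrite (_ : (fun _ => _) = fun x => f x + (-1) * g x).
  by apply: (smoothD sf); exact: smoothZ.
by apply/funext => x; rewrite mulN1r.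
Qed.

Lemma smooth_affine a b f : smooth f -> smooth (fun x => f (a * x + b)).
Proof.
move=> sf; apply: (@smooth_coind [set h | exists k f, smooth f /\ h = fun x => k * f (a * x + b)]).
  move=> _ [k [g [sg ->]]]; exists (fun x => (k * a) * (derive1 g) (a * x + b)).
    by exists (k * a), (derive1 g); split; first exact: smooth_derive1.
  move=> x; by apply: (is_derive_val (is_deriveM_fun (is_derive_cst k x 1) (is_derive_affine (smooth_is_derive (a * x + b) sg)))); rewrite mul0r add0r mulrA.
by exists 1, f; split => //; apply/funext => x; rewrite mul1r.
Qed.

Lemma smooth_id : smooth (fun x => x).
Proof.
by apply: (@smooth_primitive _ (fun=> 1)); exact: smooth_cst.
Qed.

Lemma derive1nD n f g : smooth f -> smooth g ->
  derive1n n (fun x => f x + g x) = fun x => derive1n n f x + derive1n n g x.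
Proof.
elim: n f g => [//|n IH] f g sf sg; rewrite !derive1Sn -IH; try exact: smooth_derive1.
by congr derive1n; apply: derive1_eq => x; apply: is_deriveD_fun; exact: smooth_is_derive.
Qed.

Lemma derive1_affine a b f : smooth f ->
  derive1 (fun x => f (a * x + b)) = fun x => a * (derive1 f) (a * x + b).
Proof. by move=> sf; apply: derive1_eq => x; apply: is_derive_affine; exact: smooth_is_derive. Qed.

Lemma derive1Z k f : smooth f -> derive1 (fun x => k * f x) = fun x => k * (derive1 f) x.
Proof.
move=> sf; apply: derive1_eq => x.
by apply: (is_derive_val (is_deriveM_fun (is_derive_cst k x 1) (smooth_is_derive x sf))); rewrite mul0r add0r.
Qed.

Lemma derive1nZ n k f : smooth f ->
  derive1n n (fun x => k * f x) = fun x => k * derive1n n f x.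
Proof.
elim: n f => [//|n IH] f sf; rewrite !derive1Sn -IH; last exact: smooth_derive1.
by congr derive1n; exact: derive1Z.
Qed.

Lemma derive1nB n f g : smooth f -> smooth g ->
  derive1n n (fun x => f x - g x) = fun x => derive1n n f x - derive1n n g x.
Proof.
move=> sf sg; rewrite (_ : (fun _ => _) = fun x => f x + (-1) * g x).
  rewrite (derive1nD _ sf); last exact: smoothZ.
  by rewrite (derive1nZ _ _ sg); apply/funext => x; rewrite mulN1r.
by apply/funext => x; rewrite mulN1r.
Qed.

Lemma derive1n_affine n a b f : smooth f ->
  derive1n n (fun x => f (a * x + b)) = fun x => a ^+ n * derive1n n f (a * x + b).
Proof.
elim: n f => [|n IH] f sf; first by apply/funext => x; rewrite expr0 mul1r.
rewrite !derive1Sn derive1_affine// derive1nZ; last exact/smooth_affine/smooth_derive1.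
rewrite IH; last exact: smooth_derive1.
by apply/funext => x; rewrite exprS mulrA.
Qed.

(** Differentiation adds pi / 2 to the phase, so the class in the proof keeps the frequency and lets
    amplitude and phase vary. *)
Lemma smooth_cosin a b c : smooth (fun x => a * cos (c * x + b)).
Proof.
apply: (@smooth_coind [set h | exists a b, h = fun x => a * cos (c * x + b)]); last by exists a, b.
move=> _ [{}a [{}b ->]]; exists (fun x => (a * c) * cos (c * x + (b + pi / 2))).
  by exists (a * c), (b + pi / 2).
move=> x; apply: (is_derive_val (is_deriveM_fun (is_derive_cst a x 1) (is_derive_affine (is_derive_cos (c * x + b))))); rewrite (_ : c * x + (b + pi / 2) = (c * x + b) + pi / 2) ?addrA// (cosD (c * x + b)) cos_pihalf sin_pihalf.
by rewrite /=; ring.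
Qed.

Lemma smooth_diff_le f a b : smooth f -> a <= b ->
  `|f b - f a| <= Int `[a, b] (fun x => `|(derive1 f) x|).
Proof.
move=> sf ab; have cf : continuous (derive1 f) by exact/smooth_cont/smooth_derive1.
have <- : Int `[a, b] (derive1 f) = f b - f a.
  by apply: Int_ftc => // x; exact: smooth_is_derive.
by apply: norm_Int => //; exact: intg_itv.
Qed.

End smooth_functions.

(** * Real parts in the lattice *)


Section complex_values.
Import ComplexField.Normc.
Local Open Scope complex_scope.
Context {R : realType}.
Implicit Types (a b : R) (z : R[i]).

Lemma normc_real a : normc a%:C = `|a|.
Proof. by rewrite /normc /= expr0n addr0 sqrtr_sqr. Qed.

Lemma normc_ge0 z : 0 <= normc z.
Proof. by case: z => a b; rewrite /normc sqrtr_ge0. Qed.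

Lemma normc_ge_re z : `|complex.Re z| <= normc z.
Proof.
case: z => a b; rewrite /normc /= -sqrtr_sqr ler_wsqrtr// lerDl.
exact: sqr_ge0.
Qed.

Lemma normc_ge_im z : `|complex.Im z| <= normc z.
Proof.
case: z => a b; rewrite /normc /= -sqrtr_sqr ler_wsqrtr// lerDr.
exact: sqr_ge0.
Qed.

Lemma normc_le a b : normc (a +i* b) <= `|a| + `|b|.
Proof.
have -> : a +i* b = a%:C + 'i * b%:C.
  by apply/eqP; rewrite eq_complex /=; apply/andP; split; apply/eqP; ring.
apply: (le_trans (le_normcD _ _)); rewrite normcM !normc_real.
by rewrite [normc 'i]/normc /= expr0n expr1n add0r sqrtr1 mul1r.
Qed.

End complex_values.

Section real_part_norm.
Import ComplexField.Normc.
Local Open Scope complex_scope.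
Context {R : realType} (X : banach_lattice R).
Implicit Types (u v w : R -> R) (f : R -> R[i]) (k : R).

(** The analysis is done for real functions, embedded as complex ones with zero imaginary part. Real
    and imaginary parts of an element have no larger norm, so complex statements follow at the cost
    of a factor 2. *)
Definition cpx u : R -> R[i] := fun x => (u x)%:C.
Definition rcar u : Prop := bl_car X (cpx u).
Definition rn u : R := bl_norm X (cpx u).

Lemma rcar_meas u : rcar u -> meas u.
Proof. by move=> /bl_measurable[]. Qed.

Lemma rn_ge0 u : rcar u -> 0 <= rn u.
Proof. exact: bl_norm_ge0. Qed.

Lemma cmeasurable_cpx u : meas u -> cmeasurable (cpx u).
Proof. by move=> mu; split; [exact: mu|exact: measurable_cst]. Qed.

Lemma rideal u v : meas u -> rcar v -> (forall x, `|u x| <= `|v x|) ->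
  rcar u /\ rn u <= rn v.
Proof.
move=> mu vX uv; apply: (bl_ideal (cmeasurable_cpx mu) vX).
by apply: aeW => x; rewrite !normc_real.
Qed.

Lemma cpxD u v : cpx (fun x => u x + v x) = (cpx u \+ cpx v)%R.
Proof. by apply/funext => x; rewrite /cpx /= rmorphD. Qed.

Lemma cpxZ k u : cpx (fun x => k * u x) = fun x => k%:C * cpx u x.
Proof. by apply/funext => x; rewrite /cpx /= rmorphM. Qed.

Lemma rcarD u v : rcar u -> rcar v -> rcar (fun x => u x + v x).
Proof. by rewrite /rcar cpxD; exact: bl_carD. Qed.

Lemma rnD u v : rcar u -> rcar v -> rn (fun x => u x + v x) <= rn u + rn v.
Proof. by rewrite /rn cpxD; exact: bl_normD. Qed.

Lemma rcarZ k u : rcar u -> rcar (fun x => k * u x).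
Proof. by rewrite /rcar cpxZ; exact: bl_carZ. Qed.

Lemma rnZ k u : rcar u -> rn (fun x => k * u x) = `|k| * rn u.
Proof. by move=> uX; rewrite /rn cpxZ bl_normZ// normc_real. Qed.

Lemma rcarN u : rcar u -> rcar (fun x => - u x).
Proof.
move=> /(rcarZ (-1)); rewrite /rcar; congr (bl_car X (cpx _)).
by apply/funext => x; rewrite mulN1r.
Qed.

Lemma rnN u : rcar u -> rn (fun x => - u x) = rn u.
Proof.
move=> uX; rewrite -[RHS]mul1r -(normr1 R) -normrN -rnZ//.
by congr rn; apply/funext => x; rewrite mulN1r.
Qed.

Lemma rcarB u v : rcar u -> rcar v -> rcar (fun x => u x - v x).
Proof. by move=> uX vX; apply: rcarD => //; exact: rcarN. Qed.

Lemma rnB u v : rcar u -> rcar v -> rn (fun x => u x - v x) <= rn u + rn v.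
Proof. by move=> uX vX; rewrite -(rnN vX); apply: rnD => //; exact: rcarN. Qed.

Lemma rn0 : rn (fun=> 0) = 0.
Proof. by apply/(bl_norm_eq0 (bl_car0 X)); apply: aeW. Qed.

Lemma rcar_norm u : rcar u -> rcar (fun x => `|u x|) /\ rn (fun x => `|u x|) <= rn u.
Proof.
move=> uX; apply: rideal => //; first exact/meas_norm/rcar_meas.
by move=> x; rewrite normr_id.
Qed.

Lemma car_re f : bl_car X f -> rcar (re f) /\ rn (re f) <= bl_norm X f.
Proof.
move=> fX; have [mr mi] := bl_measurable fX.
apply: (bl_ideal (cmeasurable_cpx mr) fX).
by apply: aeW => x; rewrite normc_real normc_ge_re.
Qed.

Lemma car_im f : bl_car X f -> rcar (im f) /\ rn (im f) <= bl_norm X f.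
Proof.
move=> fX; have [mr mi] := bl_measurable fX.
apply: (bl_ideal (cmeasurable_cpx mi) fX).
by apply: aeW => x; rewrite normc_real normc_ge_im.
Qed.

Lemma car_reim u v : rcar u -> rcar v ->
  bl_car X (fun x => u x +i* v x) /\ bl_norm X (fun x => u x +i* v x) <= rn u + rn v.
Proof.
move=> uX vX.
have -> : (fun x => u x +i* v x) = (cpx u \+ (fun x => 'i * cpx v x))%R.
  apply/funext => x; apply/eqP; rewrite eq_complex /cpx /=.
  by apply/andP; split; apply/eqP; ring.
split; first by apply: bl_carD => //; exact: bl_carZ.
apply: (le_trans (bl_normD _ _)) => //; first exact: bl_carZ.
by rewrite bl_normZ// [normc 'i]/normc /= expr0n expr1n add0r sqrtr1 mul1r.
Qed.

Lemma rcar_intg u (a b : R) : rcar u -> intg `[a, b] u.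
Proof.
move=> uX; have mu := rcar_meas uX.
have ab : measurable (`[a, b]%classic : set (lebT R)) by exact: measurable_itv_lebT.
have fab : (leb R `[a, b]%classic < +oo)%E.
  rewrite lebE; last exact: measurable_itv.
  have -> : lebesgue_measure `[a, b]%classic = _ := lebesgue_measure_itv `[a, b].
  by case: ifP => _; rewrite ?ltry.
have [_ [c c0 H]] := bl_finite X ab fab.
apply/integrableP; split; first by apply/measurable_EFinP; exact: measS.
apply: (@le_lt_trans _ _ (c * rn u)%:E); last exact: ltry.
apply: le_trans (H _ uX); apply: ge0_le_integral; [exact: ab|by move=> x _; exact: abse_ge0| | |].
- by apply/measurable_EFinP; apply: measurableT_comp => //; exact: measS.
- apply/measurable_EFinP; apply: (measS (f := fun x => normc (cpx u x))).
  rewrite (_ : (fun _ => _) = fun x => `|u x|); first exact: meas_norm.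
  by apply/funext => x; exact: normc_real.
- by move=> x _; rewrite (normc_real (u x)).
Qed.

End real_part_norm.

(** * Steklov averages of real functions *)

Section steklov_real.
Import ComplexField.Normc.
Local Open Scope complex_scope.
Context {R : realType}.
Implicit Types (u v w : R -> R) (f : R -> R[i]) (h x : R).

Definition rst h u : R -> R := fun x => h^-1 * Int `[x - h / 2, x + h / 2] u.

Lemma steklovE h f x : steklov h f x = rst h (re f) x +i* rst h (im f) x.
Proof.
rewrite /steklov /cintegral /rst /Int.
by apply/eqP; rewrite eq_complex /=; apply/andP; split; apply/eqP; ring.
Qed.

Lemma Int0 (D : set R) : Int D (fun=> 0) = 0.
Proof. by rewrite /Int /Rintegral integral0. Qed.

Lemma steklov_cpx h u : steklov h (cpx u) = cpx (rst h u).
Proof.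
apply/funext => x; rewrite steklovE /cpx; congr (_ +i* _).
by rewrite /rst (_ : im _ = fun=> 0)// Int0 mulr0.
Qed.

End steklov_real.

(** * Norm and growth bounds from Assumption A *)

Section majorant.
Import ComplexField.Normc.
Local Open Scope complex_scope.
Context {R : realType} (X : banach_lattice R).
Implicit Types (u v w U : R -> R) (h H x t c : R).
Local Notation rcar := (rcar X).
Local Notation rn := (rn X).

Lemma rst_bound : assumptionA X -> exists2 C : R, 0 < C & forall h u, 0 < h -> rcar u ->
  rcar (rst h u) /\ rn (rst h u) <= C * rn u.
Proof.
move=> [A1 [C0 A2]]; exists (`|C0| + 1); first by rewrite ltr_wpDl.
set C := `|C0| + 1; have C_gt0 : 0 < C by rewrite ltr_wpDl.
move=> h u h0 uX; split.
  by have := A1 h _ h0 uX; rewrite steklov_cpx.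
apply/ler_addgt0Pr => e e0.
(* [k] scales [u] into the unit ball, where Assumption A speaks; the summand [e / C] covers the case
   of norm zero. *)
have [k k0 kE] : exists2 k, 0 < k & k^-1 = rn u + e / C.
  exists (rn u + e / C)^-1; last by rewrite invrK.
  by rewrite invr_gt0 ltr_wpDl ?divr_gt0// rn_ge0.
have kuX := rcarZ k uX.
have := A2 h (cpx (fun x => k * u x)) h0 kuX.
rewrite steklov_cpx -/(rn _) -/(rn _) rnZ// gtr0_norm//.
have -> : rst h (fun x => k * u x) = fun x => k * rst h u x.
  apply/funext => x; rewrite /rst IntZ//; first by rewrite mulrCA.
  exact: (rcar_intg _ _ uX).
have ruX : rcar (rst h u) by have := A1 h _ h0 uX; rewrite steklov_cpx.
rewrite rnZ// gtr0_norm// => H.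
have k1 : k * rn u <= 1.
  rewrite -ler_pdivlMl// mulr1 kE lerDl ltW// divr_gt0//.
have := H k1; rewrite mulrC -ler_pdivlMr// kE => H2.
apply: (le_trans H2); apply: (@le_trans _ _ (C * (rn u + e / C))).
  rewrite ler_wpM2r ?addr_ge0 ?rn_ge0 ?divr_ge0 ?ltW//.
  by rewrite (le_lt_trans (ler_norm _))// ltrDl.
by rewrite mulrDr mulrCA divff ?gt_eqF// mulr1.
Qed.

Let J : set R := `[-(1/2), 1/2].

(** A fixed element of nonzero norm, against which pointwise lower bounds are measured. *)
Lemma rcar_indic : rcar \1_J /\ 0 < rn \1_J.
Proof.
have mJ : measurable (J : set (lebT R)) by exact: measurable_itv_lebT.
have lJ : leb R J = 1%:E.
  rewrite lebE; last exact: measurable_itv.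
  have -> : lebesgue_measure J = _ := lebesgue_measure_itv `[-(1/2), 1/2].
  have a2 : -(1/2) < 1/2 :> R by lra.
  by rewrite /= lte_fin a2 -EFinB; congr _%:E; lra.
have [JX _] := @bl_finite _ X J mJ (eq_rect_r (fun y => y < +oo)%E (ltry 1) lJ).
split=> //; rewrite lt_neqAle rn_ge0// andbT eq_sym; apply/negP => /eqP.
move=> /(bl_norm_eq0 JX) [N [mN N0 sN]].
have : (leb R J <= leb R N)%E.
  apply: le_measure; rewrite ?inE// => x Jx; apply: sN => /=.
  move=> /eqP; rewrite eq_complex /= indicE mem_set//= oner_eq0.
  by [].
by rewrite lJ N0 lee_fin ler10.
Qed.

(** Every window of length 4 N centred in the unit interval [J] contains [- N, N], so on [J] the
    average of |w| is at least the left-hand side divided by 4 N; the norm of the indicator of [J]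
    turns this into a bound. It makes Poisson integrals finite at every point. *)
Lemma growth : assumptionA X -> exists2 C : R, 0 < C & forall w (N : R), 1 <= N -> rcar w ->
  Int `[- N, N] (fun x => `|w x|) <= C * N * rn w.
Proof.
move=> /rst_bound[C C0 HC]; have [JX e0] := rcar_indic.
exists (4 * C / rn \1_J); first by rewrite divr_gt0// mulr_gt0.
move=> w N N1 wX; have [nwX nw] := rcar_norm wX.
have N0 : 0 < 4 * N by lra.
have [rX rle] := HC (4 * N) _ N0 nwX.
set I := Int _ _.
have I0 : 0 <= I by apply: Int_ge0.
have k0 : 0 <= (4 * N)^-1 * I by rewrite mulr_ge0// invr_ge0 ltW.
have kX := rcarZ ((4 * N)^-1 * I) JX.
have := @rideal _ X _ _ (rcar_meas kX) rX.
case=> [x|_].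
  rewrite indicE; case: (boolP (x \in J)) => [|_]; last by rewrite mulr0 normr0.
  rewrite inE /J /= in_itv/= => /andP[x1 x2].
  rewrite mulr1 (ger0_norm k0).
  apply: le_trans (ler_norm _); rewrite /rst ler_pM2l ?invr_gt0//.
  apply: Int_subset => //; last exact: rcar_intg nwX.
  by move=> y /=; rewrite !in_itv/= => /andP[y1 y2]; apply/andP; split; lra.
rewrite rnZ// (ger0_norm k0) => H.
have H2 : (4 * N)^-1 * I * rn \1_J <= C * rn w.
  by apply: (le_trans H); apply: (le_trans rle); rewrite ler_pM2l.
have -> : 4 * C / rn \1_J * N * rn w = (4 * N) * (C * rn w) / rn \1_J.
  by field; rewrite gt_eqF.
by rewrite ler_pdivlMr// -ler_pdivrMl// mulrA.
Qed.

End majorant.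

(** * The Poisson majorant *)

Section real_integral2.
Context {R : realType}.
Implicit Types (D E : set R) (f : R -> R).

Lemma Int_setD D E f : measurable (D : set (lebT R)) -> measurable (E : set (lebT R)) ->
  D `<=` E -> intg E f -> Int E f = Int D f + Int (E `\` D) f.
Proof.
move=> mD mE DE fi.
have -> : Int E f = Int (D `|` (E `\` D)) f.
  by congr (Int _ f); rewrite setDUK.
have mED : measurable ((E `\` D) : set (lebT R)) by exact: measurableD.
apply: Rintegral_setU => //.
  by rewrite setDUK.
by apply/disj_setPS => x /= [? []].
Qed.

Lemma le_Int_cut D E f g : measurable (D : set (lebT R)) -> measurable (E : set (lebT R)) ->
  D `<=` E -> intg E f -> intg E g -> (forall x, E x -> 0 <= g x) ->
  (forall x, E x -> ~ D x -> f x <= g x) -> Int E f <= Int D f + Int E g.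
Proof.
move=> mD mE DE fi gi g0 fg; rewrite (Int_setD mD mE DE fi) lerD2l.
have mED : measurable ((E `\` D) : set (lebT R)) by exact: measurableD.
apply: (@le_trans _ _ (Int (E `\` D) g)); last by apply: Int_subset => // x [].
by apply: le_Int => //; [exact: intgS fi|exact: intgS gi|move=> x [Ex Dx]; exact: fg].
Qed.

Lemma intg_exhaust (F : nat -> set (lebT R)) f (M : R) :
  nondecreasing_seq F -> (forall n, measurable (F n)) -> \bigcup_n F n = setT ->
  meas f -> (forall x, 0 <= f x) ->
  (forall n, intg (F n) f) -> (forall n, Int (F n) f <= M) ->
  intg setT f /\ Int setT f <= M.
Proof.
move=> ndF mF UF mf f0 fi fM.
have lim : (\int[leb R]_y (f y)%:E <= M%:E)%E.
  have := @ge0_nondecreasing_set_cvg_integral _ (lebT R) R F (EFin \o f) (leb R) ndF mF.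
  rewrite UF => cvgf; apply: (cvge_to_le (cvgf _ _)).
  - by move=> i; apply/measurable_EFinP; exact: measS.
  - by move=> i x _; rewrite lee_fin.
  - by apply: nearW => n; rewrite -(EFin_Int (mF n))// lee_fin.
have fT : intg setT f.
  apply/integrableP; split; first by apply/measurable_EFinP; exact: mf.
  apply: le_lt_trans (ltry M); apply: le_trans lim.
  rewrite le_eqVlt; apply/orP; left; apply/eqP; apply: eq_integral => y _ /=.
  by rewrite ger0_norm.
by split => //; rewrite -lee_fin EFin_Int.
Qed.

End real_integral2.

Section poisson.
Context {R : realType} (X : banach_lattice R).
Implicit Types (u v w U : R -> R) (h H x t c : R).
Local Notation rcar := (rcar X).
Local Notation rn := (rn X).

(* The Poisson kernel of height [H], without the factor [1 / pi]. *)
Definition pk H t : R := H / (H ^+ 2 + t ^+ 2).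
Definition pois H w x : R := Int setT (fun y => pk H (x - y) * `|w y|).

Lemma pk_den H t : 0 < H -> 0 < H ^+ 2 + t ^+ 2.
Proof. by move=> H0; rewrite ltr_wpDr ?sqr_ge0// exprn_gt0. Qed.

Lemma pk_gt0 H t : 0 < H -> 0 < pk H t.
Proof. by move=> H0; rewrite divr_gt0// pk_den. Qed.

Lemma pk_le H t : 0 < H -> pk H t <= H^-1.
Proof.
move=> H0; rewrite ler_pdivrMr ?pk_den// ler_pdivlMl// -expr2 lerDl.
exact: sqr_ge0.
Qed.

Lemma pk_cont H x : 0 < H -> continuous (fun y => pk H (x - y)).
Proof.
move=> H0 y; apply: cvgM; first exact: cvg_cst.
apply: cvgV; first by rewrite gt_eqF// pk_den.
apply: cvgD; first exact: cvg_cst.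
by apply: cvgM; (apply: cvgB; [exact: cvg_cst|exact: cvg_id]).
Qed.

Let B H x n : set R := `[x - 2 ^+ n * H, x + 2 ^+ n * H].
(** The weight: for j >= 1, at distance more than 2^(j - 1) H from x the kernel is at most 4^(1 - j)
    / H, while the Steklov kernel of width 2^(j + 1) H has height 2^(- j - 1) / H; the ratio is 8 /
    2^j. *)
Let S H w n x : R := \sum_(j < n.+1) 8 * 2 ^- j * rst (2 * (2 ^+ j * H)) (fun y => `|w y|) x.

Lemma pk_intg_itv H w x (a b : R) : 0 < H -> rcar w ->
  intg `[a, b] (fun y => pk H (x - y) * `|w y|).
Proof.
move=> H0 wX; have mw := rcar_meas wX.
apply: (@intg_le _ _ _ (fun y => H^-1 * `|w y|)) => //.
- apply: measM; last exact: meas_norm.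
  by apply: meas_cont; exact: pk_cont.
- move=> y _; rewrite normrM normr_id (gtr0_norm (pk_gt0 _ H0)).
  by rewrite ler_wpM2r// pk_le.
- by apply: intgZ => //; apply: intg_norm => //; exact: rcar_intg wX.
Qed.

Lemma pois_cut H w x n : 0 < H -> rcar w ->
  Int (B H x n) (fun y => pk H (x - y) * `|w y|) <= S H w n x.
Proof.
move=> H0 wX; have mB k : measurable (B H x k : set (lebT R)) by exact: measurable_itv_lebT.
elim: n => [|n IH].
  rewrite /S big_ord1 expr0 invr1 mulr1 mul1r /rst.
  have -> : 2 * H / 2 = H by field.
  apply: (@le_trans _ _ (Int (B H x 0) (fun y => H^-1 * `|w y|))).
    apply: le_Int => //; first exact: (pk_intg_itv _ _ _ H0 wX).
      by apply: intgZ => //; apply: intg_norm => //; exact: rcar_intg wX.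
    by move=> y _; rewrite ler_wpM2r// pk_le.
  rewrite IntZ//; last by apply: intg_norm => //; exact: rcar_intg wX.
  rewrite /B expr0 mul1r mulrA ler_wpM2r//; first exact: Int_ge0.
  have Hi : 0 < H^-1 by rewrite invr_gt0.
  have -> : 8 * (2 * H)^-1 = 4 * H^-1 by field; rewrite gt_eqF.
  by lra.
have L0 : 0 < 2 ^+ n * H :> R by rewrite mulr_gt0// exprn_gt0.
set L := 2 ^+ n * H in L0.
have BE : B H x n.+1 = `[x - 2 * L, x + 2 * L]%classic by rewrite /B exprS /L mulrA.
rewrite /S big_ord_recr/= -/(S H w n x).
apply: le_trans; last by apply: lerD; [exact: IH|exact: lexx].
have -> : 8 * 2 ^- n.+1 * rst (2 * (2 ^+ n.+1 * H)) (fun y => `|w y|) x =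
    Int (B H x n.+1) (fun y => (H / L ^+ 2) * `|w y|).
  rewrite IntZ//; last by apply: intg_norm => //; exact: rcar_intg wX.
  rewrite /rst -/(B _ _ _) BE.
  have -> : 2 * (2 ^+ n.+1 * H) / 2 = 2 * L by rewrite exprS /L; field.
  rewrite mulrA; congr (_ * _); rewrite exprS /L.
  have n0 : 2 ^+ n != 0 :> R by rewrite expf_neq0.
  by field; rewrite n0 gt_eqF.
apply: le_Int_cut => //.
- move=> y; rewrite BE /B /= !in_itv/= -/L => /andP[y1 y2].
  by apply/andP; split; lra.
- exact: (pk_intg_itv _ _ _ H0 wX).
- by apply: intgZ => //; apply: intg_norm => //; exact: rcar_intg wX.
- by move=> y _; rewrite mulr_ge0// divr_ge0 ?sqr_ge0// ltW.
move=> y _ /negP; rewrite /B /= in_itv/= -/L negb_and -!ltNge => yL.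
rewrite ler_wpM2r// ler_wpM2l ?(ltW H0)// lef_pV2 ?posrE ?pk_den ?exprn_gt0//.
rewrite -[leLHS]add0r lerD ?sqr_ge0//.
by case/orP: yL => yL; nra.
Qed.

(** A bound at each point, uniform in [n], which gives the increasing sums a finite limit
    everywhere; the norm bound of [S_rn] alone does not. *)
Lemma S_bound : assumptionA X -> exists2 C : R, 0 < C & forall H w x n, 0 < H -> rcar w ->
  S H w n x <= C * ((`|x| + 1) / H + 1) * rn w.
Proof.
move=> /growth[C C0 HC]; exists (16 * C); first by rewrite mulr_gt0.
move=> H w x n H0 wX.
set M := C * ((`|x| + 1) / H + 1) * rn w.
have M0 : 0 <= M.
  have q0 : 0 <= (`|x| + 1) / H by apply: divr_ge0; [have := normr_ge0 x; lra|exact: ltW].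
  by rewrite mulr_ge0 ?rn_ge0// mulr_ge0 ?(ltW C0)//; lra.
(* 16 - 16 / 2^(n + 1) is the sum of the weights 8 / 2^j over j <= n. *)
suff : S H w n x <= (16 - 16 * 2 ^- n.+1) * M.
  move=> /le_trans; apply.
  have -> : 16 * C * ((`|x| + 1) / H + 1) * rn w = 16 * M by rewrite /M !mulrA.
  by rewrite ler_wpM2r// gerBl mulr_ge0// invr_ge0 exprn_ge0.
have rb j : rst (2 * (2 ^+ j * H)) (fun y => `|w y|) x <= M.
  have L0 : H <= 2 ^+ j * H by rewrite ler_peMl ?(ltW H0)// exprn_ege1// ler1n.
  set L := 2 ^+ j * H in L0 *.
  rewrite /rst; have -> : 2 * L / 2 = L by field.
  apply: (@le_trans _ _ ((2 * L)^-1 * (C * (`|x| + L + 1) * rn w))).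
    rewrite ler_wpM2l ?invr_ge0//; first by lra.
    apply: le_trans (HC w (`|x| + L + 1) _ wX); last by have := normr_ge0 x; lra.
    apply: Int_subset => //; last by apply: intg_norm => //; exact: rcar_intg wX.
    move=> y /=; rewrite !in_itv/= => /andP[y1 y2].
    have := ler_norm x; have := ler_normr x x => _ x1.
    have x2 := ler_norm (- x); rewrite normrN in x2.
    by apply/andP; split; lra.
  rewrite /M mulrA ler_wpM2r ?rn_ge0// mulrCA ler_pM2l//.
  have Lp : 0 < 2 * L by lra.
  rewrite ler_pdivrMl// mulrDr mulr1.
  have q0 : 0 <= (`|x| + 1) / H by apply: divr_ge0; [have := normr_ge0 x; lra|exact: ltW].
  have qE : `|x| + 1 = (`|x| + 1) / H * H by rewrite divfK// gt_eqF.
  rewrite addrAC qE mulfK ?gt_eqF//.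
  set q := (_ / H) in q0 *.
  nra.
elim: n => [|n IH].
  rewrite /S big_ord1 expr0 expr1 invr1 mulr1.
  have -> : 16 - 16 * 2^-1 = 8 :> R by field.
  by rewrite ler_pM2l//; have := rb 0%N; rewrite expr0.
rewrite /S big_ord_recr/= -/(S H w n x).
apply: le_trans (lerD IH (ler_wpM2l _ (rb n.+1))) _.
  by rewrite mulr_ge0// invr_ge0 exprn_ge0.
rewrite -mulrDl ler_wpM2r//.
rewrite !exprS; have n0 : 2 ^+ n != 0 :> R by rewrite expf_neq0.
rewrite le_eqVlt; apply/orP; left; apply/eqP; by field.
Qed.


Lemma S_rn : assumptionA X -> exists2 C : R, 0 < C & forall H w n, 0 < H -> rcar w ->
  rcar (S H w n) /\ rn (S H w n) <= C * rn w.
Proof.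
move=> /rst_bound[C C0 HC]; exists (16 * C); first by rewrite mulr_gt0.
move=> H w n H0 wX.
have [nwX nw] := rcar_norm wX.
have hj j : rcar (fun x => 8 * 2 ^- j * rst (2 * (2 ^+ j * H)) (fun y => `|w y|) x) /\
    rn (fun x => 8 * 2 ^- j * rst (2 * (2 ^+ j * H)) (fun y => `|w y|) x) <=
    8 * 2 ^- j * (C * rn w).
  have L0 : 0 < 2 * (2 ^+ j * H) by rewrite mulr_gt0// mulr_gt0// exprn_gt0.
  have [rX rle] := HC _ _ L0 nwX.
  split; first exact: rcarZ.
  have k0 : 0 <= 8 * 2 ^- j :> R by rewrite mulr_ge0// invr_ge0 exprn_ge0.
  rewrite rnZ// (ger0_norm k0) ler_wpM2l//.
  by apply: (le_trans rle); rewrite ler_pM2l.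
suff [h1 h2] : rcar (S H w n) /\ rn (S H w n) <= (16 - 16 * 2 ^- n.+1) * (C * rn w).
  split => //; apply: (le_trans h2); rewrite -mulrA ler_wpM2r//.
    by rewrite mulr_ge0 ?rn_ge0// ltW.
  by rewrite gerBl mulr_ge0// invr_ge0 exprn_ge0.
elim: n => [|n [IH1 IH2]].
  have -> : S H w 0 = fun x => 8 * 2 ^- 0 * rst (2 * (2 ^+ 0 * H)) (fun y => `|w y|) x.
    by apply/funext => x; rewrite /S big_ord1.
  have [h1 h2] := hj 0%N; split => //; apply: (le_trans h2).
  by rewrite expr0 expr1 le_eqVlt; apply/orP; left; apply/eqP; field.
have -> : S H w n.+1 = fun x => S H w n x + 8 * 2 ^- n.+1 * rst (2 * (2 ^+ n.+1 * H)) (fun y => `|w y|) x.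
  by apply/funext => x; rewrite /S big_ord_recr.
have [h1 h2] := hj n.+1; split; first exact: rcarD.
apply: (le_trans (rnD _ _)) => //; apply: (le_trans (lerD IH2 h2)).
rewrite -mulrDl ler_wpM2r//.
  by rewrite mulr_ge0 ?rn_ge0// ltW.
rewrite !exprS; have n0 : 2 ^+ n != 0 :> R by rewrite expf_neq0.
rewrite le_eqVlt; apply/orP; left; apply/eqP; by field.
Qed.

Lemma rst_ge0 h u x : 0 <= h -> (forall y, 0 <= u y) -> 0 <= rst h u x.
Proof. by move=> h0 u0; rewrite /rst mulr_ge0 ?invr_ge0//; exact: Int_ge0. Qed.

(* Dyadic decomposition: [pk H] is at most a sum of multiples, with geometric
   weights, of centred Steklov kernels of widths [2 ^ (j + 1) H]. *)
Lemma pois_sum : assumptionA X -> exists2 C : R, 0 < C & forall H w, 0 < H -> rcar w ->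
  (forall x, intg setT (fun y => pk H (x - y) * `|w y|)) /\
  exists T, [/\ rcar T, rn T <= C * rn w & forall x, pois H w x <= T x].
Proof.
move=> AX; have [C1 C10 HS] := S_bound AX; have [C2 C20 HC] := S_rn AX.
exists C2 => // H w H0 wX.
pose M x := C1 * ((`|x| + 1) / H + 1) * rn w.
have k0 j : 0 <= 8 * 2 ^- j :> R by rewrite mulr_ge0// invr_ge0 exprn_ge0.
have r0 j x : 0 <= rst (2 * (2 ^+ j * H)) (fun y => `|w y|) x.
  by apply: rst_ge0 => //; rewrite mulr_ge0// mulr_ge0// ?exprn_ge0// ltW.
have ndS x : nondecreasing_seq (fun n => S H w n x).
  apply/nondecreasing_seqP => n; rewrite /S [leRHS]big_ord_recr lerDl.
  exact: mulr_ge0.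
have cS x : cvgn (fun n => S H w n x).
  apply: nondecreasing_is_cvgn => //; exists (M x) => _ [n _ <-].
  exact: HS.
pose T x := limn (fun n => S H w n x).
have ST x n : S H w n x <= T x by exact: nondecreasing_cvgn_le.
(* The limit is finite pointwise by [S_bound]; the Fatou property then puts it in X with the same
   norm bound. *)
have [TX Tlim] : rcar T /\ (fun n => rn (S H w n)) @ \oo --> rn T.
  apply: (@bl_fatou R X (fun n x => S H w n x) T).
  - by move=> n; have [] := HC H w n H0 wX.
  - by exists (C2 * rn w) => n; have [] := HC H w n H0 wX.
  apply: aeW => x; split => [n|]; last exact: cS.
  apply/andP; split; last by apply: ndS; exact: leqnSn.
  by apply: sumr_ge0 => j _; exact: mulr_ge0.
have rT : rn T <= C2 * rn w.
  by apply: (cvgr_to_le Tlim); near=> n; have [] := HC H w n H0 wX.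
have mw := rcar_meas wX.
have mB x n : measurable (B H x n : set (lebT R)) by exact: measurable_itv_lebT.
pose f x y := pk H (x - y) * `|w y|.
have mf x : meas (f x).
  apply: measM; last exact: meas_norm.
  by apply: meas_cont; exact: pk_cont.
have f0 x y : 0 <= f x y by rewrite mulr_ge0// ltW// pk_gt0.
have Bup x : \bigcup_n B H x n = setT.
  apply/seteqP; split => // y _.
  pose n := Num.bound (`|x - y| / H).
  exists n => //; rewrite /B /= in_itv/=.
  have : `|x - y| / H < 2 ^+ n.
    apply: (lt_trans (archi_boundP _)); first by rewrite divr_ge0// ltW.
    by rewrite -natrX ltr_nat ltn_expl.
  rewrite ltr_pdivrMr// => h.
  have h1 := le_lt_trans (ler_norm _) h.
  have h2 := le_lt_trans (ler_norm (- (x - y))) (eq_ind_r (fun z => z < _) h (normrN _)).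
  by apply/andP; split; lra.
have ndB x : nondecreasing_seq (B H x).
  apply/nondecreasing_seqP => n; rewrite subsetEset => y.
  rewrite /B /= !in_itv/= exprS => /andP[y1 y2].
  have : 0 < 2 ^+ n * H :> R by rewrite mulr_gt0// exprn_gt0.
  by move=> h; apply/andP; split; lra.
have fT x : intg setT (f x) /\ Int setT (f x) <= T x.
  apply: (intg_exhaust (ndB x) (mB x) (Bup x)) => // n.
    exact: (pk_intg_itv _ _ _ H0 wX).
  apply: le_trans (ST x n); exact: pois_cut.
split=> [x|]; first by have [] := fT x.
by exists T; split => // x; have [] := fT x.
Unshelve. all: by end_near.
Qed.

(** Phrased for a measurable [U] below the majorant, so that the measurability of [pois H w] itself
    never has to be established. *)
Lemma pois_bound : assumptionA X -> exists2 C : R, 0 < C & forall H w, 0 < H -> rcar w ->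
  (forall x, intg setT (fun y => pk H (x - y) * `|w y|)) /\
  forall U c, 0 <= c -> meas U -> (forall x, `|U x| <= c * pois H w x) ->
    rcar U /\ rn U <= c * C * rn w.
Proof.
move=> /pois_sum[C C0 HC]; exists C => // H w H0 wX.
have [wi [T [TX rT pT]]] := HC H w H0 wX; split => // U c c0 mU Uc.
have [x|UX rU] := @rideal _ X U _ mU (rcarZ c TX).
  apply: (le_trans (Uc x)); rewrite normrM (ger0_norm c0) ler_wpM2l//.
  by apply: (le_trans (pT x)); exact: ler_norm.
split => //; apply: (le_trans rU); rewrite rnZ// (ger0_norm c0) -mulrA.
by rewrite ler_wpM2l.
Qed.

End poisson.

(** * Dominated convergence and moving windows *)

Section convergence.
Context {R : realType}.
Implicit Types (D E : set R) (f g u : R -> R).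

Lemma Int_indic D f : Int D f = Int setT (fun y => f y * \1_D y).
Proof.
rewrite /Int Rintegral_mkcond; congr (Rintegral _ _ _); apply/funext => y.
by rewrite patchE indicE; case: ifP => _; rewrite ?mulr1 ?mulr0.
Qed.

Lemma meas_indic D : measurable (D : set (lebT R)) -> meas \1_D.
Proof. by move=> mD; exact: measurable_indic. Qed.

Lemma intg_indic D f : measurable (D : set (lebT R)) -> meas f -> intg D f ->
  intg setT (fun y => f y * \1_D y).
Proof.
move=> mD mf fi; apply/integrableP; split.
  by apply/measurable_EFinP; apply: measM => //; exact: meas_indic.
case/integrableP: fi => _; rewrite integral_mkcond; congr (_ < _)%E.
apply: eq_integral => y _; rewrite patchE /= indicE; case: ifP => _.
  by rewrite mulr1.
by rewrite mulr0 normr0.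
Qed.

Lemma Int_dct (fn : nat -> R -> R) f g : (forall n, meas (fn n)) -> meas f ->
  {ae leb R, forall y, fn n y @[n --> \oo] --> f y} ->
  (forall n y, `|fn n y| <= g y) -> intg setT g ->
  Int setT (fn n) @[n --> \oo] --> Int setT f.
Proof.
move=> mfn mf fnf fng gi.
have mT : measurable ([set: R] : set (lebT R)) by [].
have h1 : {ae leb R, forall y, setT y -> EFin (fn n y) @[n --> \oo] --> EFin (f y)}.
  apply: negligibleS fnf => y /= h1 h2; apply: h1 => _.
  by apply: cvg_EFin h2 => //; exact: nearW.
have h2 : {ae leb R, forall y n, setT y -> (`|EFin (fn n y)| <= EFin (g y))%E}.
  by apply: aeW => y n _ /=; rewrite lee_fin.
have [fi _ lim] := @dominated_convergence _ _ _ (leb R) setT mT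
  (fun n => EFin \o fn n) (EFin \o f) (EFin \o g)
  (fun n => iffRL (measurable_EFinP _ _) (mfn n)) (iffRL (measurable_EFinP _ _) mf)
  h1 gi h2.
apply: fine_cvg; rewrite fineK; first exact: lim.
exact: integrable_fin_num.
Qed.

Lemma negligible_pts (a b : R) : (leb R).-negligible [set a; b].
Proof.
have m1 (c : R) : measurable ([set c] : set (lebT R)) by apply: measurable_lebT; exact: measurable_set1.
exists [set a; b]; split => //; first exact: measurableU.
rewrite lebE; last by apply: measurableU; exact: measurable_set1.
apply: countable_lebesgue_measure0.
by apply: finite_set_countable.
Qed.

Lemma near_same_side (x z y c : R) : `|x - z| < `|y - (x + c)| ->
  (z + c <= y) = (x + c <= y) /\ (y <= z + c) = (y <= x + c).
Proof.
move=> h.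
have x1 := le_lt_trans (ler_norm _) h.
have x2 := le_lt_trans (ler_norm (- (x - z))) (eq_ind_r (fun t => t < _) h (normrN _)).
have [yc|yc] : x + c <= y \/ y < x + c by case: (leP (x + c) y) => ?; [left|right].
  by rewrite ger0_norm ?subr_ge0// in x1 x2; split; apply/idP/idP => ?; lra.
by rewrite ltr0_norm ?subr_lt0// in x1 x2; split; apply/idP/idP => ?; lra.
Qed.

(** The indicators of the moving windows converge except possibly at the two endpoints of the limit
    window. For [u] merely in X this is what makes Steklov averages measurable. *)
Lemma continuous_Int_window (a b : R) u : meas u -> (forall c d, intg `[c, d] u) ->
  continuous (fun x => Int `[x + a, x + b] u).
Proof.
move=> mu ui x; apply/(@cvg_nbhsP _ R^o) => z zx.
pose I (c : R) : set R := `[c + a, c + b]%classic.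
pose J : set R := `[x + a - 1, x + b + 1]%classic.
have mI c : measurable (I c : set (lebT R)) by exact: measurable_itv_lebT.
have mJ : measurable (J : set (lebT R)) by exact: measurable_itv_lebT.
have IJ c : `|x - c| < 1 -> I c `<=` J.
  move=> h y; rewrite /I /J /= !in_itv/= => /andP[y1 y2].
  by move: h; rewrite ltr_norml => /andP[h1 h2]; apply/andP; split; lra.
have nz : \forall n \near \oo, `|x - z n| < 1.
  by move/cvgrPdist_lt : zx; apply.
have E n : `|x - z n| < 1 -> Int setT (fun y => u y * \1_(I (z n) `&` J) y) = Int (I (z n)) u.
  by move=> h; rewrite -Int_indic; congr Int; apply/setIidl; exact: IJ.
have Ex : Int (I x) u = Int setT (fun y => u y * \1_(I x) y) by rewrite Int_indic.
rewrite -/(I x) Ex.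
(* Intersecting with the fixed window [J] provides one dominating function; it changes nothing once
   [z n] is within 1 of [x]. *)
suff : Int setT (fun y => u y * \1_(I (z n) `&` J) y) @[n --> \oo] --> Int setT (fun y => u y * \1_(I x) y).
  apply: cvg_trans; apply: near_eq_cvg; near=> n; apply: E; near: n; exact: nz.
apply: (@Int_dct _ _ (fun y => `|u y| * \1_J y)).
- by move=> n; apply: measM => //; apply: meas_indic; exact: measurableI.
- by apply: measM => //; exact: meas_indic.
- have := negligible_pts (x + a) (x + b); apply: negligibleS => y /= ny.
  apply: contrapT => yab; apply: ny.
  apply: cvgM; first exact: cvg_cst.
  apply: (@cvg_trans _ ((fun=> \1_(I x) y) @ \oo)); last exact: cvg_cst.
  apply: near_eq_cvg.
  have ya : y <> x + a by move=> h; apply: yab; left.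
  have yb : y <> x + b by move=> h; apply: yab; right.
  have d0 : 0 < Num.min `|y - (x + a)| `|y - (x + b)|.
    by rewrite lt_min !normr_gt0 !subr_eq0; apply/andP; split; apply/eqP.
  near=> n.
  have h1 : `|x - z n| < 1 by near: n; exact: nz.
  have h2 : `|x - z n| < Num.min `|y - (x + a)| `|y - (x + b)|.
    by near: n; move/cvgrPdist_lt : zx; apply.
  have h3 : `|x - z n| < `|y - (x + a)| by move: h2; rewrite lt_min => /andP[].
  have h4 : `|x - z n| < `|y - (x + b)| by move: h2; rewrite lt_min => /andP[].
  rewrite !indicE; congr (_%:R); congr nat_of_bool.
  rewrite (_ : I (z n) `&` J = I (z n)); last by apply/setIidl; exact: IJ.
  have [ea _] := near_same_side h3; have [_ eb] := near_same_side h4.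
  by apply/idP/idP; rewrite !inE /I /= !in_itv/= ea eb.
- move=> n y; rewrite normrM ler_wpM2l//.
  rewrite !indicE; case: (boolP (y \in J)) => yJ.
    by case: (_ \in _); rewrite ?normr1 ?normr0.
  by rewrite memNset ?normr0// => -[_ /mem_set yJ']; rewrite yJ' in yJ.
- by apply: intg_indic => //; [exact: meas_norm|apply: intg_norm => //; exact: ui].
Unshelve. all: by end_near.
Qed.

End convergence.

(** * Steklov averages and their differences *)

Section primitive.
Context {R : realType}.
Implicit Types (f g u : R -> R) (a b c x y h : R).

Lemma Int_cat a b c u : continuous u -> a <= b -> b <= c ->
  Int `[a, c] u = Int `[a, b] u + Int `[b, c] u.
Proof.
move=> cu ab bc.
have mu (D : set R) : measurable_fun D u by apply: measurable_funTS; exact: continuous_measurable_fun.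
have ui : lebesgue_measure.-integrable `[a, c]%classic (EFin \o u).
  by apply: continuous_compact_integrable; [exact: segment_compact|exact: continuous_subspaceT].
rewrite /Int !Rintegral_leb//; try exact: measurable_itv.
apply/eqP; rewrite addrC -subr_eq; apply/eqP.
rewrite (@Rintegral_itvB _ u (BLeft a) (BRight c) b) ?bnd_simp//.
rewrite Rintegral_itv_obnd_cbnd//; apply: integrableS ui => //; try exact: measurable_itv.
by move=> y /=; rewrite !in_itv/= => /andP[y1 y2]; apply/andP; split => //; lra.
Qed.

Lemma Int_point c u : Int `[c, c] u = 0.
Proof.
rewrite /Int set_itv1 Rintegral_leb ?Rintegral_set1//; last exact: measurable_fun_set1.
Qed.

Lemma is_derive_near f g x (d : R) : (\forall y \near x, f y = g y) ->
  is_derive x 1 g d -> is_derive x 1 f d.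
Proof.
move=> fg gd; have dg : derivable g x 1 := @ex_derive _ _ _ _ _ _ _ gd.
have gf : \forall y \near x, g y = f y by apply: filterS fg => y.
apply: DeriveDef; first exact: near_eq_derivable gf dg.
rewrite (near_eq_derive _ fg); exact: (@derive_val _ _ _ _ _ _ _ gd).
Qed.

(** Away from 0 one of the two integrals is over an empty interval, so their difference is the
    signed integral from 0 to x. *)
Lemma ex_primitive u : continuous u ->
  exists U : R -> R, forall x : R, is_derive x 1 U (u x).
Proof.
move=> cu; exists (fun x => Int `[0, x] u - Int `[x, 0] u) => x.
(* With a base point [c] below both 0 and [x], the signed integral is, near [x], an integral from
   [c] minus a constant. *)
pose c := Num.min 0 x - 1.
have c0 : c <= 0 by have : Num.min 0 x <= 0 by [rewrite ge_min lexx]; rewrite /c; lra.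
have cx : c < x by have : Num.min 0 x <= x by [rewrite ge_min lexx orbT]; rewrite /c; lra.
apply: (@is_derive_near _ (fun y => Int `[c, y] u + (- Int `[c, 0] u))).
  near=> y.
  have cy : c < y by near: y; exact: lt_nbhsr.
  have [y0|y0] := leP 0 y.
    rewrite (@Int_cat c 0 y)//.
    have -> : Int `[y, 0] u = 0.
      move: y0; rewrite le_eqVlt => /predU1P[<-|y0]; first exact: Int_point.
      by rewrite set_itv_ge ?bnd_simp -?ltNge// /Int Rintegral_set0.
    by rewrite subr0 addrAC subrr add0r.
  rewrite (@Int_cat c y 0)//; try exact: ltW.
  rewrite [in LHS]set_itv_ge ?bnd_simp -?ltNge// /Int Rintegral_set0.
  by rewrite opprD addrA subrr.
suff dc : is_derive x 1 (fun t => Int `[c, t] u) (u x).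
  by apply: (is_derive_val (is_deriveD_fun dc (is_derive_cst (- Int `[c, 0] u) x 1))); rewrite addr0.
have mu (D : set R) : measurable_fun D u by apply: measurable_funTS; exact: continuous_measurable_fun.
have ui : lebesgue_measure.-integrable `[c, x + 1]%classic (EFin \o u).
  by apply: continuous_compact_integrable; [exact: segment_compact|exact: continuous_subspaceT].
have xx1 : x < x + 1 by rewrite ltrDl.
have [d1 d2] := @continuous_FTC1_closed R u c x (x + 1) xx1 ui cx (cu x).
rewrite (_ : (fun t => Int `[c, t] u) = fun t => Rintegral lebesgue_measure `[c, t] u).
  by apply: DeriveDef; [exact: d1|rewrite -derive1E; exact: d2].
by apply/funext => t; rewrite /Int Rintegral_leb//; exact: measurable_itv.
Unshelve. all: by end_near.
Qed.

End primitive.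

(** * Powers of the identity minus a Steklov average *)

Section steklov_family.
Context {R : realType}.
Implicit Types (u v w : R -> R) (a b c x y h : R) (n m : nat).

(* The centred average for [a = - (h / 2)], the forward one for [a = 0]. *)
Definition St h a u : R -> R := fun x => h^-1 * Int `[x + a, x + a + h] u.

Lemma rst_St h u : rst h u = St h (- (h / 2)) u.
Proof. by apply/funext => x; rewrite /rst /St (_ : x + h / 2 = x - h / 2 + h)//; field. Qed.

Lemma rst_St0 h u x : rst h u (x + h / 2) = St h 0 u x.
Proof. by rewrite /rst /St addrK addr0 (_ : x + h / 2 + h / 2 = x + h)//; field. Qed.

Definition rdef h a m u : R -> R := iter m (fun v x => v x - St h a v x) u.

Lemma rdefS h a m u : rdef h a m.+1 u = fun x => rdef h a m u x - St h a (rdef h a m u) x.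
Proof. by []. Qed.

Lemma St_is_derive h a u x : continuous u -> 0 < h ->
  is_derive x 1 (St h a u) (h^-1 * (u (x + a + h) - u (x + a))).
Proof.
move=> cu h0; have [U dU] := ex_primitive cu.
have -> : St h a u = fun x => h^-1 * (U (1 * x + (a + h)) - U (1 * x + a)).
  apply/funext => y; rewrite /St (Int_ftc _ cu dU); last by rewrite lerDl ltW.
  by rewrite !mul1r addrA.
apply: (is_derive_val (is_deriveZ_fun h^-1 (is_deriveB_fun
  (is_derive_affine (dU (1 * x + (a + h)))) (is_derive_affine (dU (1 * x + a)))))).
by rewrite !mul1r addrA.
Qed.

Lemma St_derive1 h a u : smooth u -> 0 < h ->
  forall x : R, is_derive x 1 (St h a u) (St h a (derive1 u) x).
Proof.
move=> su h0 x; apply: (is_derive_val (St_is_derive a x (smooth_cont su) h0)).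
have cu' := smooth_cont (smooth_derive1 su).
rewrite /St (Int_ftc _ cu' (fun x => smooth_is_derive x su))//.
by rewrite lerDl ltW.
Qed.

Lemma smooth_St h a u : 0 < h -> smooth u -> smooth (St h a u).
Proof.
move=> h0 su; apply: (@smooth_coind _ [set f | exists2 v, smooth v & f = St h a v]); last by exists u.
move=> _ [v sv ->]; exists (St h a (derive1 v)).
  by exists (derive1 v); first exact: smooth_derive1.
by move=> x; exact: St_derive1.
Qed.

Lemma derive1n_St h a n u : 0 < h -> smooth u ->
  derive1n n (St h a u) = St h a (derive1n n u).
Proof.
move=> h0; elim: n u => [//|n IH] u su; rewrite !derive1Sn.
by rewrite (derive1_eq (St_derive1 a su h0)) (IH _ (smooth_derive1 su)).
Qed.

Lemma smooth_rdef h a m u : 0 < h -> smooth u -> smooth (rdef h a m u).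
Proof.
move=> h0 su; elim: m => [|m IH]; first exact: su.
by rewrite rdefS; by apply: (smoothB IH); exact: smooth_St.
Qed.

Lemma derive1n_rdef h a n m u : 0 < h -> smooth u ->
  derive1n n (rdef h a m u) = rdef h a m (derive1n n u).
Proof.
move=> h0 su; elim: m => [//|m IH]; rewrite !rdefS.
have sr : smooth (rdef h a m u) by exact: smooth_rdef.
rewrite derive1nB; [|exact: sr|exact: smooth_St].
by rewrite derive1n_St; [rewrite IH|exact: h0|exact: sr].
Qed.

(** The averaging window contains [x] because -h <= a <= 0, and it stays within distance [h] of [x],
    so each difference u x - u y is at most the integral of |u'| on the right. *)
Lemma St_mean_le h a u x : 0 < h -> - h <= a -> a <= 0 -> smooth u ->
  `|u x - St h a u x| <= Int `[x - h, x + h] (fun y => `|derive1 u y|).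
Proof.
move=> h0 ha a0 su; have cu := smooth_cont su; have cu' := smooth_cont (smooth_derive1 su).
have cn : continuous (fun y => `|derive1 u y|).
  by move=> y; apply: cvg_norm; exact: cu'.
set M := Int _ _.
have hx y : x + a <= y <= x + a + h -> `|u x - u y| <= M.
  move=> /andP[y1 y2].
  have [xy|/ltW yx] := leP x y.
    rewrite distrC; apply: (le_trans (smooth_diff_le su xy)); apply: Int_subset => //.
      by move=> z /=; rewrite !in_itv/= => /andP[z1 z2]; apply/andP; split; lra.
    exact: intg_itv.
  apply: (le_trans (smooth_diff_le su yx)); apply: Int_subset => //.
    by move=> z /=; rewrite !in_itv/= => /andP[z1 z2]; apply/andP; split; lra.
  exact: intg_itv.
have le1 : x + a <= x + a + h by rewrite lerDl ltW.
have -> : u x - St h a u x = h^-1 * Int `[x + a, x + a + h] (fun y => u x - u y).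
  rewrite IntB//; [|by apply: intg_itv => ?; exact: cvg_cst|exact: intg_itv].
  rewrite Int_cst// mulrBr addrAC subrr add0r; congr (_ - _).
  by field; rewrite gt_eqF.
rewrite normrM gtr0_norm ?invr_gt0// ler_pdivrMl//.
apply: (@le_trans _ _ (Int `[x + a, x + a + h] (fun=> M))).
  apply: norm_Int_le => //.
  - by apply: measB; [exact: meas_cst|exact: meas_cont].
  - by apply: intg_itv => ?; exact: cvg_cst.
by rewrite (Int_cst M le1) (_ : x + a + h - (x + a) = h) 1?mulrC//; ring.
Qed.

(** The centred average annihilates y - x, so the linear part of the tangent at [x] may be
    subtracted from [u]; the remainder [g] has derivative u' - u'(x), which is at most the integral
    of |u''|, and one more integration brings the factor [h]. *)
Lemma St_sym_le h u x : 0 < h -> smooth u ->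
  `|u x - St h (- (h / 2)) u x| <= h * Int `[x - h, x + h] (fun y => `|derive1 (derive1 u) y|).
Proof.
move=> h0 su; have cu := smooth_cont su; have su' := smooth_derive1 su.
have cu' := smooth_cont su'; have cu'' := smooth_cont (smooth_derive1 su').
pose g y := u y - derive1 u x * (y - x).
have sg : smooth g.
  apply: (smoothB su); apply: smoothZ; apply: smoothB; [exact: smooth_id|exact: smooth_cst].
have dg : derive1 g = fun y => derive1 u y - derive1 u x.
  apply: derive1_eq => y.
  have d1 : is_derive y 1 (fun t : R => t - x) 1.
    by apply: (is_derive_val (is_deriveB_fun (is_derive_id y 1) (is_derive_cst x y 1))); rewrite subr0.
  apply: (is_derive_val (is_deriveB_fun (smooth_is_derive y su) (is_deriveZ_fun (derive1 u x) d1))).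
  by rewrite mulr1.
have cn : continuous (fun y => `|derive1 (derive1 u) y|).
  by move=> y; apply: cvg_norm; exact: cu''.
set M := Int _ _.
have M0 : 0 <= M by apply: Int_ge0.
have hd y : x - h <= y <= x + h -> `|derive1 u y - derive1 u x| <= M.
  move=> /andP[y1 y2].
  have [xy|/ltW yx] := leP x y.
    apply: (le_trans (smooth_diff_le su' xy)); apply: Int_subset => //.
      by move=> z /=; rewrite !in_itv/= => /andP[z1 z2]; apply/andP; split; lra.
    exact: intg_itv.
  rewrite distrC; apply: (le_trans (smooth_diff_le su' yx)); apply: Int_subset => //.
    by move=> z /=; rewrite !in_itv/= => /andP[z1 z2]; apply/andP; split; lra.
  exact: intg_itv.
have hx y : x + - (h / 2) <= y <= x + - (h / 2) + h -> `|g x - g y| <= h * M.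
  move=> /andP[y1 y2].
  have key (p q : R) : p <= q -> q <= p + h -> x - h <= p -> q <= x + h ->
      `|g q - g p| <= h * M.
    move=> pq qp xp qx; apply: (le_trans (smooth_diff_le sg pq)).
    apply: (@le_trans _ _ (Int `[p, q] (fun=> M))).
      apply: le_Int => //; first by apply: intg_itv => ?; apply: cvg_norm; apply: smooth_cont; exact: smooth_derive1.
        by apply: intg_itv => ?; exact: cvg_cst.
      move=> z /=; rewrite in_itv/= => /andP[z1 z2]; rewrite dg; apply: hd.
      by apply/andP; split; lra.
    by rewrite Int_cst// mulrC ler_wpM2r//; lra.
  have [xy|/ltW yx] := leP x y; first by rewrite distrC; apply: key => //; lra.
  by apply: key => //; lra.
have le1 : x + - (h / 2) <= x + - (h / 2) + h by rewrite lerDl ltW.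
have cg := smooth_cont sg.
have -> : u x - St h (- (h / 2)) u x = h^-1 * Int `[x + - (h / 2), x + - (h / 2) + h] (fun y => g x - g y).
  rewrite IntB//; [|by apply: intg_itv => ?; exact: cvg_cst|exact: intg_itv].
  rewrite Int_cst// mulrBr.
  have cl : continuous (fun y => derive1 u x * (y - x)).
    apply: smooth_cont; apply: smoothZ; apply: smoothB; [exact: smooth_id|exact: smooth_cst].
  have -> : Int `[x + - (h / 2), x + - (h / 2) + h] g = Int `[x + - (h / 2), x + - (h / 2) + h] u.
    rewrite /g IntB//; [|exact: intg_itv|exact: intg_itv].
    pose Q (y : R) := derive1 u x / 2 * ((y - x) * (y - x)).
    have -> : Int `[x + - (h / 2), x + - (h / 2) + h] (fun y => derive1 u x * (y - x)) =
        Q (x + - (h / 2) + h) - Q (x + - (h / 2)).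
      apply: Int_ftc => // y; have d1 : is_derive y 1 (fun t : R => t - x) 1.
        by apply: (is_derive_val (is_deriveB_fun (is_derive_id y 1) (is_derive_cst x y 1))); rewrite subr0.
      apply: (is_derive_val (is_deriveZ_fun (derive1 u x / 2) (is_deriveM_fun d1 d1))).
      by field.
    by rewrite -[RHS]subr0; congr (_ - _); rewrite /Q; field.
  have gx : g x = u x by rewrite /g subrr mulr0 subr0.
  rewrite gx /St; congr (_ - _).
  by field; rewrite gt_eqF.
rewrite normrM gtr0_norm ?invr_gt0// ler_pdivrMl//.
apply: (@le_trans _ _ (Int `[x + - (h / 2), x + - (h / 2) + h] (fun=> h * M))).
  apply: norm_Int_le => //.
  - by apply: measB; [exact: meas_cst|exact: meas_cont].
  - by apply: intg_itv => ?; exact: cvg_cst.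
by rewrite (Int_cst (h * M) le1) (_ : x + - (h / 2) + h - (x + - (h / 2)) = h) 1?mulrC//; ring.
Qed.

End steklov_family.

(** * Operators dominated by the Poisson majorant *)

Section lattice_operators.
Context {R : realType} (X : banach_lattice R).
Implicit Types (u v w U K : R -> R) (a b c h H x t y : R) (m n s r : nat).
Local Notation rcar := (rcar X).
Local Notation rn := (rn X).

(** The form in which Assumption A enters all later estimates, with its constant named so that it
    can be threaded through them. *)
Definition poisson_bounded (C : R) := 0 < C /\ forall H w, 0 < H -> rcar w ->
  (forall x, intg setT (fun y => pk H (x - y) * `|w y|)) /\
  forall U c, 0 <= c -> meas U -> (forall x, `|U x| <= c * pois H w x) ->
    rcar U /\ rn U <= c * C * rn w.

Lemma ex_poisson_bounded : assumptionA X -> exists C, poisson_bounded C.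
Proof. by move=> /pois_bound[C C0 HC]; exists C. Qed.

Lemma pois_ge0 H w x : 0 < H -> 0 <= pois H w x.
Proof. by move=> H0; apply: Int_ge0 => y _; rewrite mulr_ge0// ltW// pk_gt0. Qed.

Context (C : R) (PC : poisson_bounded C).

Let C0 : 0 < C. Proof. by case: PC. Qed.

Lemma pois_intg H w x : 0 < H -> rcar w -> intg setT (fun y => pk H (x - y) * `|w y|).
Proof. by move=> H0 wX; have [_ /(_ H w H0 wX)[]] := PC. Qed.

Lemma pois_X H w U c : 0 < H -> rcar w -> 0 <= c -> meas U ->
  (forall x, `|U x| <= c * pois H w x) -> rcar U /\ rn U <= c * C * rn w.
Proof. by move=> H0 wX c0 mU Uc; have [_ /(_ H w H0 wX)[_]] := PC; apply. Qed.

(** For |x - y| <= c H the kernel [pk H (x - y)] is at least 1 / ((1 + c^2) H). *)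
Lemma pois_itv H w x a b c : 0 < H -> rcar w -> 0 <= c -> x - c * H <= a -> b <= x + c * H ->
  Int `[a, b] (fun y => `|w y|) <= (1 + c ^+ 2) * H * pois H w x.
Proof.
move=> H0 wX c0 ha hb; have iw := pois_intg x H0 wX.
rewrite -IntZ//; apply: (@le_trans _ _ (Int `[a, b] (fun y => (1 + c ^+ 2) * H * (pk H (x - y) * `|w y|)))).
  apply: le_Int => //.
  - by apply: intg_norm => //; exact: rcar_intg wX.
  - by apply: intgZ => //; apply: intgS iw.
  move=> y; rewrite /= in_itv/= => /andP[y1 y2].
  rewrite mulrA -[leLHS]mul1r ler_wpM2r// /pk mulrA ler_pdivlMr ?pk_den// mul1r.
  have : (x - y) ^+ 2 <= (c * H) ^+ 2.
    by nra.
  by rewrite exprMn; nra.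
apply: Int_subset => //; first exact: intgZ.
move=> y _; rewrite mulr_ge0//; last by rewrite mulr_ge0// ltW// pk_gt0.
by rewrite mulr_ge0 ?(ltW H0)// addr_ge0// sqr_ge0.
Qed.

Lemma pois_conv H w K c x : 0 < H -> rcar w -> continuous K ->
  (forall t, `|K t| <= c * pk H t) ->
  intg setT (fun y => K (x - y) * w y) /\
  `|Int setT (fun y => K (x - y) * w y)| <= c * pois H w x.
Proof.
move=> H0 wX cK Kc; have iw := pois_intg x H0 wX.
have mK : meas (fun y => K (x - y) * w y).
  apply: measM; last exact: rcar_meas wX.
  apply: meas_cont => y; apply: (@continuous_comp _ _ _ (fun y => x - y) K); last exact: cK.
  by apply: cvgB; [exact: cvg_cst|exact: cvg_id].
have le y : `|K (x - y) * w y| <= c * (pk H (x - y) * `|w y|).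
  by rewrite normrM mulrA ler_wpM2r.
have iC := intgZ c measurableT_lebT iw.
split; first by apply: intg_le iC.
by rewrite -IntZ//; apply: norm_Int_le.
Qed.

(** A Harnack inequality: since (t - y)^2 <= 2 (t - x)^2 + 2 (x - y)^2, moving the centre by at most
    [b * H] changes the kernel by a bounded factor. It carries estimates at a node to the whole cell
    next to it. *)
Lemma pois_shift H w x t b : 0 < H -> rcar w -> 0 <= b -> `|t - x| <= b * H ->
  pois H w x <= 2 * (1 + b ^+ 2) * pois H w t.
Proof.
move=> H0 wX b0 tx; rewrite -IntZ//; last exact: pois_intg.
apply: le_Int => //; first exact: pois_intg.
  by apply: intgZ => //; exact: pois_intg.
move=> y _; rewrite mulrA ler_wpM2r// /pk mulrCA ler_wpM2l ?(ltW H0)//.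
rewrite ler_pdivlMr ?pk_den// mulrC ler_pdivrMr ?pk_den//.
have : (t - x) ^+ 2 <= (b * H) ^+ 2 by rewrite -(real_normK (num_real (t - x))) lerXn2r ?nnegrE// mulr_ge0// ltW.
rewrite exprMn => h.
have h2 : (t - y) ^+ 2 <= 2 * (t - x) ^+ 2 + 2 * (x - y) ^+ 2.
  rewrite -subr_ge0; have -> : 2 * (t - x) ^+ 2 + 2 * (x - y) ^+ 2 - (t - y) ^+ 2 = (t - x - (x - y)) ^+ 2 by ring.
  exact: sqr_ge0.
have := sqr_ge0 b; have := sqr_ge0 H; have := sqr_ge0 (x - y); have := sqr_ge0 (b * (x - y)).
by rewrite exprMn; nra.
Qed.

Lemma St_pois h a u x : 0 < h -> - h <= a -> a <= 0 -> rcar u ->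
  `|St h a u x| <= 2 * pois h u x.
Proof.
move=> h0 ha a0 uX; rewrite /St normrM gtr0_norm ?invr_gt0// ler_pdivrMl//.
apply: le_trans (norm_Int _ _) _ => //; first exact: rcar_intg uX.
apply: le_trans (@pois_itv h u x _ _ 1 h0 uX _ _ _) _ => //; lra.
Qed.

Lemma meas_St h a u : rcar u -> meas (St h a u).
Proof.
move=> uX; apply: measM; first exact: meas_cst.
apply: meas_cont; rewrite (_ : (fun x => _) = fun x => Int `[x + a, x + (a + h)] u).
  by apply: continuous_Int_window; [exact: rcar_meas uX|move=> c d; exact: rcar_intg uX].
by apply/funext => x; rewrite addrA.
Qed.

Lemma St_X h a u : 0 < h -> - h <= a -> a <= 0 -> rcar u ->
  rcar (St h a u) /\ rn (St h a u) <= 2 * C * rn u.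
Proof.
move=> h0 ha a0 uX; apply: (pois_X h0 uX) => //; first exact: meas_St.
by move=> x; exact: St_pois.
Qed.

Lemma St_B h a u v x : rcar u -> rcar v -> St h a (fun y => u y - v y) x = St h a u x - St h a v x.
Proof.
by move=> uX vX; rewrite /St IntB ?mulrBr//; [exact: rcar_intg uX|exact: rcar_intg vX].
Qed.

Lemma rdef_X h a m u : 0 < h -> - h <= a -> a <= 0 -> rcar u ->
  rcar (rdef h a m u) /\ rn (rdef h a m u) <= (1 + 2 * C) ^+ m * rn u.
Proof.
move=> h0 ha a0 uX; elim: m => [|m [IH1 IH2]]; first by rewrite expr0 mul1r.
have [sX sle] := St_X h0 ha a0 IH1.
rewrite rdefS; split; first exact: rcarB.
apply: (le_trans (rnB _ _)) => //; apply: (le_trans (lerD (lexx _) sle)).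
rewrite -[X in X + _]mul1r -mulrDl exprS -mulrA ler_wpM2l//.
by rewrite addr_ge0// mulr_ge0// ltW.
Qed.

Lemma rdef_B h a m u v : 0 < h -> - h <= a -> a <= 0 -> rcar u -> rcar v ->
  rdef h a m (fun y => u y - v y) = fun y => rdef h a m u y - rdef h a m v y.
Proof.
move=> h0 ha a0 uX vX; elim: m => [//|m IH]; rewrite !rdefS IH.
have [u1 _] := rdef_X m h0 ha a0 uX; have [v1 _] := rdef_X m h0 ha a0 vX.
by apply/funext => y; rewrite St_B//; ring.
Qed.

Lemma St_mean_pois h a u x : 0 < h -> - h <= a -> a <= 0 -> smooth u -> rcar (derive1 u) ->
  `|u x - St h a u x| <= 2 * h * pois h (derive1 u) x.
Proof.
move=> h0 ha a0 su u'X; apply: (le_trans (St_mean_le x h0 ha a0 su)).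
apply: le_trans (@pois_itv h _ x _ _ 1 h0 u'X _ _ _) _ => //; lra.
Qed.

Lemma St_sym_pois h u x : 0 < h -> smooth u -> rcar (derive1 (derive1 u)) ->
  `|u x - St h (- (h / 2)) u x| <= 2 * h ^+ 2 * pois h (derive1 (derive1 u)) x.
Proof.
move=> h0 su u''X; apply: (le_trans (St_sym_le x h0 su)).
have -> : 2 * h ^+ 2 * pois h (derive1 (derive1 u)) x = h * (2 * h * pois h (derive1 (derive1 u)) x) by ring.
rewrite ler_wpM2l ?(ltW h0)//.
apply: le_trans (@pois_itv h _ x _ _ 1 h0 u''X _ _ _) _ => //; lra.
Qed.

(** [St] commutes with differentiation, so the factors I - [St] can be traded one at a time for a
    derivative and a constant times [h]. *)
Lemma rdef_smooth_X h a s u : 0 < h -> - h <= a -> a <= 0 -> smooth u ->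
  rcar (derive1n s u) ->
  rcar (rdef h a s u) /\ rn (rdef h a s u) <= (2 * h * C) ^+ s * rn (derive1n s u).
Proof.
move=> h0 ha a0; elim: s u => [|s IH] u su usX; first by rewrite expr0 mul1r.
have su' := smooth_derive1 su.
rewrite derive1Sn in usX *; have [wX wle] := IH _ su' usX.
have dw : derive1 (rdef h a s u) = rdef h a s (derive1 u) by exact: (derive1n_rdef a 1 s h0 su).
have sw : smooth (rdef h a s u) by exact: smooth_rdef.
have [] := @pois_X h (rdef h a s (derive1 u)) (rdef h a s.+1 u) (2 * h) h0 wX.
- by rewrite mulr_ge0// ltW.
- by apply: meas_cont; apply: smooth_cont; exact: smooth_rdef.
- by move=> x; rewrite rdefS -dw; apply: St_mean_pois => //; rewrite dw.
move=> rX rle; split => //; apply: (le_trans rle).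
by rewrite exprS -[leRHS]mulrA ler_wpM2l// !mulr_ge0// ltW.
Qed.

Local Notation symdef h := (rdef h (- (h / 2))).

(** The induction hypothesis over [r]. It is kept for all s <= 2 r at once, since removing a factor
    lowers [s] by two, or by one when s = 1. *)
Let sym_bounded r := forall s, (s <= 2 * r)%N -> exists2 K : R, 0 <= K &
  forall h u, 0 < h -> smooth u -> rcar (derive1n s u) ->
    rcar (symdef h r u) /\ rn (symdef h r u) <= K * h ^+ s * rn (derive1n s u).

(* The outermost factor absorbs two derivatives, or a single one when [s = 1]. *)
Let sym_step r s : sym_bounded r -> (0 < s <= 2 * r.+1)%N -> exists2 K : R, 0 <= K &
  forall h u, 0 < h -> smooth u -> rcar (derive1n s u) ->
    exists w, [/\ rcar w, rn w <= K * h ^+ s * rn (derive1n s u) &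
      forall x, `|symdef h r.+1 u x| <= pois h w x].
Proof.
move=> IH; have scale (k : R) h w (v : R) x : 0 < h -> 0 <= k -> rcar w -> `|v| <= k * pois h w x ->
    `|v| <= pois h (fun y => k * w y) x.
  move=> h0 k0 wX vk; apply: (le_trans vk); rewrite -IntZ//; last exact: pois_intg.
  rewrite le_eqVlt; apply/orP; left; apply/eqP; apply: eq_Int => y _.
  by rewrite normrM (ger0_norm k0) mulrCA.
case: s => [//|[_|s sr]].
  have [//|K K0 HK] := IH 0%N _.
  exists (2 * K); first by rewrite mulr_ge0.
  move=> h u h0 su usX; have su' := smooth_derive1 su.
  have [w'X w'le] := HK h (derive1 u) h0 su' usX.
  have ha : - h <= - (h / 2) by lra.
  have a0 : - (h / 2) <= 0 by lra.
  have dw : derive1 (symdef h r u) = symdef h r (derive1 u) by exact: (derive1n_rdef _ 1 r h0 su).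
  have h20 : 0 <= 2 * h by lra.
  exists (fun y => (2 * h) * symdef h r (derive1 u) y); split; first exact: rcarZ.
    rewrite rnZ// (ger0_norm h20); apply: (le_trans (ler_wpM2l h20 w'le)).
    by rewrite expr0 expr1 le_eqVlt; apply/orP; left; apply/eqP; ring.
  move=> x; apply: scale => //; rewrite rdefS -dw.
  apply: (St_mean_pois _ h0 ha a0); first exact: smooth_rdef.
  by rewrite dw.
have [|K K0 HK] := IH s _; first by move: sr; rewrite mulnS !ltnS /=.
exists (2 * K); first by rewrite mulr_ge0.
move=> h u h0 su; rewrite 2!derive1Sn => usX; have su' := smooth_derive1 su.
have su'' := smooth_derive1 su'.
have [w'X w'le] := HK h _ h0 su'' usX.
have dw : derive1 (derive1 (symdef h r u)) = symdef h r (derive1 (derive1 u)).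
  exact: (derive1n_rdef _ 2 r h0 su).
have h20 : 0 <= 2 * h ^+ 2 by rewrite mulr_ge0// sqr_ge0.
exists (fun y => (2 * h ^+ 2) * symdef h r (derive1 (derive1 u)) y); split; first exact: rcarZ.
  rewrite rnZ// (ger0_norm h20); apply: (le_trans (ler_wpM2l h20 w'le)).
  by rewrite !exprS expr0 le_eqVlt; apply/orP; left; apply/eqP; ring.
move=> x; apply: scale => //; rewrite rdefS -dw.
apply: (St_sym_pois _ h0); first exact: smooth_rdef.
by rewrite dw.
Qed.

Let sym_all r : sym_bounded r.
Proof.
elim: r => [|r IH] s sr.
  move: sr; rewrite muln0 leqn0 => /eqP ->; exists 1 => // h u h0 su uX.
  by rewrite expr0 !mul1r.
have C20 : 0 <= 1 + 2 * C by rewrite addr_ge0// mulr_ge0// ltW.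
case: s sr => [_|s sr].
  exists ((1 + 2 * C) ^+ r.+1); first by rewrite exprn_ge0.
  move=> h u h0 su uX; rewrite expr0 mulr1.
  by apply: rdef_X => //; lra.
have [K K0 HK] := @sym_step r s.+1 IH sr.
exists (C * K); first by rewrite mulr_ge0// ltW.
move=> h u h0 su uX; have [w [wX wle wp]] := HK h u h0 su uX.
have [] := @pois_X h w (symdef h r.+1 u) 1 h0 wX.
- by [].
- by apply: meas_cont; apply: smooth_cont; exact: smooth_rdef.
- by move=> x; rewrite mul1r.
rewrite mul1r => rX rle; split => //; apply: (le_trans rle).
by rewrite -!mulrA ler_wpM2l ?(ltW C0)// mulrA.
Qed.

(** The outermost factor is left as a pointwise bound by a majorant: it will be evaluated at the
    nodes, where a norm bound says nothing. A derivative has to be available for this factor, whence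
    0 < s. *)
Lemma rdef_sym_pois r s : (0 < s <= 2 * r)%N -> exists2 K : R, 0 <= K &
  forall h u, 0 < h -> smooth u -> rcar (derive1n s u) ->
    exists w, [/\ rcar w, rn w <= K * h ^+ s * rn (derive1n s u) &
      forall x, `|symdef h r u x| <= pois h w x].
Proof.
case: r => [|r sr]; first by rewrite muln0 leqn0; case: s.
exact: (@sym_step r s (@sym_all r) sr).
Qed.

End lattice_operators.

(** * Nice functions and the operator [ramp] *)

Section smoothing.
Context {R : realType} (X : banach_lattice R).
Implicit Types (u v w d e : R -> R) (a b c h x y t : R) (m n s r k i : nat).
Local Notation rcar := (rcar X).
Local Notation rn := (rn X).
Context (C : R) (PC : poisson_bounded X C).

Let C0 : 0 < C. Proof. by case: PC. Qed.

(** Bounds on all derivatives are added to membership in X because they justify changing variables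
    and differentiating under convolution integrals. Schwartz functions in X provide the
    examples. *)
Definition nice u := smooth u /\ forall n, rcar (derive1n n u) /\
  exists M : R, forall x, `|derive1n n u x| <= M.

Lemma nice_smooth u : nice u -> smooth u. Proof. by case. Qed.

Lemma nice_rcar u : nice u -> rcar u. Proof. by case=> _ /(_ 0%N)[]. Qed.

Lemma nice_cont u : nice u -> continuous u. Proof. by case=> /smooth_cont. Qed.

Lemma nice_derive1 u : nice u -> nice (derive1 u).
Proof.
by move=> [su un]; split; [exact: smooth_derive1|move=> n; rewrite -derive1Sn; exact: un].
Qed.

Lemma nice_derive1n n u : nice u -> nice (derive1n n u).
Proof. by elim: n => [//|n IH] /IH; rewrite derive1nS; exact: nice_derive1. Qed.

Lemma niceD u v : nice u -> nice v -> nice (fun x => u x + v x).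
Proof.
move=> [su un] [sv vn]; split; first exact: smoothD.
move=> n; rewrite derive1nD//; have [uX [Mu hu]] := un n; have [vX [Mv hv]] := vn n.
split; first exact: rcarD.
by exists (Mu + Mv) => x; rewrite (le_trans (ler_normD _ _))// lerD.
Qed.

Lemma niceB u v : nice u -> nice v -> nice (fun x => u x - v x).
Proof.
move=> [su un] [sv vn]; split; first exact: smoothB.
move=> n; rewrite derive1nB//; have [uX [Mu hu]] := un n; have [vX [Mv hv]] := vn n.
split; first exact: rcarB.
by exists (Mu + Mv) => x; rewrite (le_trans (ler_normB _ _))// lerD.
Qed.

Lemma nice_St h a u : 0 < h -> - h <= a -> a <= 0 -> nice u -> nice (St h a u).
Proof.
move=> h0 ha a0 [su un]; split; first exact: smooth_St.
move=> n; rewrite derive1n_St//; have [uX [M hu]] := un n; split.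
  by have [] := St_X PC h0 ha a0 uX.
exists M => x; rewrite /St normrM gtr0_norm ?invr_gt0// ler_pdivrMl//.
have le1 : x + a <= x + a + h by rewrite lerDl ltW.
apply: (@le_trans _ _ (Int `[x + a, x + a + h] (fun=> M))).
  apply: norm_Int_le => //; first exact: rcar_meas uX.
  by apply: intg_itv => ?; exact: cvg_cst.
by rewrite Int_cst// (_ : x + a + h - (x + a) = h) 1?mulrC//; ring.
Qed.

Lemma nice_rdef h a m u : 0 < h -> - h <= a -> a <= 0 -> nice u -> nice (rdef h a m u).
Proof.
move=> h0 ha a0 nu; elim: m => [//|m IH]; rewrite rdefS.
by apply: niceB => //; exact: nice_St.
Qed.

(** Integration by parts in the forward average produces the weight (y - x) / h^2 on [x, x + h], see
    [ramp_eq]; its mass 1/2 is what makes the powers decay. *)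
Definition ramp h w : R -> R := fun x => h ^- 2 * Int `[x, x + h] (fun y => (y - x) * w y).

Lemma cont_ramp h w : continuous w -> continuous (ramp h w).
Proof.
move=> cw; have cyw : continuous (fun y => y * w y).
  by move=> y; apply: cvgM; [exact: cvg_id|exact: cw].
have -> : ramp h w = fun x => h ^- 2 * (Int `[x + 0, x + h] (fun y => y * w y) - x * Int `[x + 0, x + h] w).
  apply/funext => x; rewrite /ramp addr0 -IntZ//; last exact: intg_itv.
  rewrite -IntB//; [|exact: intg_itv|by apply: intgZ => //; exact: intg_itv].
  by congr (_ * _); apply: eq_Int => y _; rewrite mulrBl.
have win (f : R -> R) : continuous f -> continuous (fun x => Int `[x + 0, x + h] f).
  by move=> cf; apply: continuous_Int_window; [exact: meas_cont|move=> *; exact: intg_itv].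
move=> x; apply: cvgM; first exact: cvg_cst.
by apply: cvgB; [exact: win|apply: cvgM; [exact: cvg_id|exact: win]].
Qed.

Lemma ramp_eq h u x : 0 < h -> smooth u ->
  ramp h (fun y => h * derive1 u y) x = u (x + h) - St h 0 u x.
Proof.
move=> h0 su; have cu := smooth_cont su; have cu' := smooth_cont (smooth_derive1 su).
have [U dU] := ex_primitive cu.
have le1 : x <= x + h by rewrite lerDl ltW.
rewrite /St addr0 (Int_ftc le1 cu dU) /ramp.
pose Q (y : R) := h * ((y - x) * u y - U y).
have -> : Int `[x, x + h] (fun y => (y - x) * (h * derive1 u y)) = Q (x + h) - Q x.
  apply: (Int_ftc le1).
    move=> y; apply: cvgM; first by apply: cvgB; [exact: cvg_id|exact: cvg_cst].
    by apply: cvgM; [exact: cvg_cst|exact: cu'].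
  move=> y; have d1 : is_derive y 1 (fun t : R => t - x) 1.
    by apply: (is_derive_val (is_deriveB_fun (is_derive_id y 1) (is_derive_cst x y 1))); rewrite subr0.
  apply: (is_derive_val (is_deriveZ_fun h (is_deriveB_fun (is_deriveM_fun d1 (smooth_is_derive y su)) (dU y)))).
  by ring.
by rewrite /Q; field; rewrite gt_eqF.
Qed.

(** The first application is estimated by the supremum 1 / h of the kernel; each further one
    contributes the mass 1/2 and lengthens the window by [h]. *)
Lemma ramp_iter_le h w n x : 0 < h -> continuous w ->
  `|iter n.+1 (ramp h) w x| <= 2 ^- n * (h^-1 * Int `[x, x + n.+1%:R * h] (fun y => `|w y|)).
Proof.
move=> h0 cw; have cn : continuous (fun y => `|w y|) by move=> y; apply: cvg_norm; exact: cw.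
have ci k : continuous (iter k (ramp h) w).
  by elim: k => [//|k IH]; rewrite iterS; exact: cont_ramp.
elim: n x => [|n IH] x.
  rewrite expr0 invr1 !mul1r /= /ramp normrM gtr0_norm ?invr_gt0 ?exprn_gt0//.
  rewrite -[leRHS](_ : h ^- 2 * (h * Int `[x, x + h] (fun y => `|w y|)) = _); last first.
    by field; rewrite gt_eqF.
  rewrite ler_wpM2l ?invr_ge0 ?sqr_ge0// -IntZ//; last exact: intg_itv.
  apply: norm_Int_le => //.
  - apply: meas_cont => y; apply: cvgM; last exact: cw.
    by apply: cvgB; [exact: cvg_id|exact: cvg_cst].
  - by apply: intgZ => //; exact: intg_itv.
  - move=> y; rewrite /= in_itv/= => /andP[y1 y2]; rewrite normrM ler_wpM2r//.
    by rewrite ger0_norm; lra.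
rewrite iterS {1}/ramp normrM gtr0_norm ?invr_gt0 ?exprn_gt0//.
set M := Int `[x, x + n.+2%:R * h] _.
have M0 : 0 <= M by apply: Int_ge0.
pose k := 2 ^- n * (h^-1 * M).
have k0 : 0 <= k by rewrite mulr_ge0 ?invr_ge0 ?exprn_ge0// mulr_ge0 ?invr_ge0// ltW.
have le1 : x <= x + h by rewrite lerDl ltW.
have cl : continuous (fun y => k * (y - x)).
  move=> y; apply: cvgM; first exact: cvg_cst.
  by apply: cvgB; [exact: cvg_id|exact: cvg_cst].
apply: (@le_trans _ _ (h ^- 2 * Int `[x, x + h] (fun y => k * (y - x)))).
  rewrite ler_wpM2l ?invr_ge0 ?sqr_ge0//; apply: norm_Int_le => //.
  - apply: meas_cont => y; apply: cvgM; last exact: ci.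
    by apply: cvgB; [exact: cvg_id|exact: cvg_cst].
  - exact: intg_itv.
  move=> y; rewrite /= in_itv/= => /andP[y1 y2]; have yx0 : 0 <= y - x by lra.
  rewrite normrM (ger0_norm yx0) [leLHS]mulrC ler_wpM2r//; apply: (le_trans (IH y)).
  rewrite /k ler_wpM2l ?invr_ge0 ?exprn_ge0// ler_wpM2l ?invr_ge0 ?(ltW h0)//.
  apply: Int_subset => //; last exact: intg_itv.
  move=> z /=; rewrite !in_itv/= => /andP[z1 z2]; apply/andP; split; first lra.
  by apply: (le_trans z2); rewrite -[in leRHS]natr1 mulrDl mul1r; lra.
pose Q (y : R) := k / 2 * ((y - x) * (y - x)).
have -> : Int `[x, x + h] (fun y => k * (y - x)) = Q (x + h) - Q x.
  apply: Int_ftc => // y; have d1 : is_derive y 1 (fun t : R => t - x) 1.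
    by apply: (is_derive_val (is_deriveB_fun (is_derive_id y 1) (is_derive_cst x y 1))); rewrite subr0.
  apply: (is_derive_val (is_deriveZ_fun (k / 2) (is_deriveM_fun d1 d1))).
  by field.
rewrite /Q /k (exprS 2 n); have n0 : 2 ^+ n != 0 :> R by rewrite expf_neq0.
by rewrite le_eqVlt; apply/orP; left; apply/eqP; field; rewrite n0 gt_eqF.
Qed.

Lemma ramp_iter_X h w n : 0 < h -> continuous w -> rcar w ->
  rcar (iter n.+1 (ramp h) w) /\
  rn (iter n.+1 (ramp h) w) <= 2 ^- n * (1 + n.+1%:R ^+ 2) * C * rn w.
Proof.
move=> h0 cw wX.
have ci k : continuous (iter k (ramp h) w).
  by elim: k => [//|k IH]; rewrite iterS; exact: cont_ramp.
apply: (pois_X PC h0 wX).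
- by rewrite mulr_ge0 ?invr_ge0 ?exprn_ge0// addr_ge0// sqr_ge0.
- by apply: meas_cont; exact: ci.
move=> x; apply: (le_trans (ramp_iter_le n x h0 cw)).
rewrite -mulrA ler_wpM2l ?invr_ge0 ?exprn_ge0// ler_pdivrMl//.
have := @pois_itv _ _ _ PC h w x x (x + n.+1%:R * h) n.+1%:R h0 wX.
rewrite (_ : h * ((1 + n.+1%:R ^+ 2) * pois h w x) = (1 + n.+1%:R ^+ 2) * h * pois h w x); last by ring.
apply => //; rewrite gerBl mulr_ge0// ltW//.
Qed.

Lemma ex_small_ramp : exists n, 2 ^- n * (1 + n.+1%:R ^+ 2) * C <= 2^-1.
Proof.
(* For n = 4 m one has 2^n >= (m + 1)^4 and 1 + (n + 1)^2 <= 16 (m + 1)^2, so 32 C < m is enough. *)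
pose m := Num.bound (32 * C).
have hm : 32 * C < m%:R by apply: archi_boundP; rewrite mulr_ge0// ltW.
exists (4 * m)%N; rewrite -mulrA ler_pdivrMl ?exprn_gt0//.
have h1 : m.+1%:R <= 2 ^+ m :> R by rewrite -natrX ler_nat; exact: ltn_expl.
have -> : 2 ^+ (4 * m) = (2 ^+ m) ^+ 4 :> R by rewrite mulnC exprM.
have h2 : (m.+1%:R) ^+ 4 <= (2 ^+ m) ^+ 4 :> R by rewrite lerXn2r ?nnegrE// exprn_ge0.
rewrite ler_pdivlMr//; apply: le_trans h2.
have -> : (4 * m).+1%:R = 4 * m%:R + 1 :> R by rewrite -natr1 natrM.
have -> : m.+1%:R = m%:R + 1 :> R by rewrite -natr1.
have m0 : 0 <= m%:R :> R by [].
set p := m%:R in hm m0 *.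
have h3 : (1 + (4 * p + 1) ^+ 2) <= 16 * (p + 1) ^+ 2 by nra.
have h4 : (1 + (4 * p + 1) ^+ 2) * C <= 16 * (p + 1) ^+ 2 * C by rewrite ler_wpM2r// ltW.
apply: (@le_trans _ _ (16 * (p + 1) ^+ 2 * C * 2)); first by rewrite ler_wpM2r.
have -> : 16 * (p + 1) ^+ 2 * C * 2 = (32 * C) * (p + 1) ^+ 2 by ring.
rewrite (_ : (p + 1) ^+ 4 = (p + 1) ^+ 2 * (p + 1) ^+ 2); last by ring.
by rewrite ler_wpM2r ?sqr_ge0//; nra.
Qed.

End smoothing.

(** * A K-functional for forward differences *)

Section k_functional.
Context {R : realType} (X : banach_lattice R).
Implicit Types (u v w d e : R -> R) (a b c h x y t : R) (m n s r k i : nat).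
Local Notation rcar := (rcar X).
Local Notation rn := (rn X).
Local Notation nice := (nice X).
Context (C : R) (PC : poisson_bounded X C).

Let C0 : 0 < C. Proof. by case: PC. Qed.

Local Notation A h := (St h 0).

Lemma nice_fwd h u : 0 < h -> nice u -> nice (A h u).
Proof. by move=> h0 nu; apply: (nice_St PC) => //; rewrite oppr_le0 ltW. Qed.

Lemma fwd_X h u : 0 < h -> rcar u -> rcar (A h u) /\ rn (A h u) <= 2 * C * rn u.
Proof. by move=> h0; apply: (St_X PC) => //; rewrite oppr_le0 ltW. Qed.

(** A translate of [d] need not be controlled in X, but a translated average is: its window stays
    within 2 h of [x]. *)
Lemma fwd_diff_X h d : 0 < h -> rcar d ->
  rcar (fun x => A h d (x + h) - A h d x) /\
  rn (fun x => A h d (x + h) - A h d x) <= 7 * C * rn d.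
Proof.
move=> h0 dX; have dloc a b : intg `[a, b] d by exact: rcar_intg dX.
apply: (pois_X PC h0 dX) => //.
  have cw : continuous (fun x => Int `[x + h, x + (h + h)] d).
    by apply: continuous_Int_window => //; exact: rcar_meas dX.
  apply: measB; last exact: (meas_St _ _ dX).
  apply: measM; first exact: meas_cst.
  rewrite (_ : (fun _ => _) = fun x => Int `[x + h, x + (h + h)] d); first exact: meas_cont.
  by apply/funext => x; rewrite addr0 addrA.
move=> x; apply: (le_trans (ler_normB _ _)).
(* 5 = 1 + 2^2 comes from the shifted window, within 2 h of [x], and 2 from the unshifted one. *)
have -> : 7 * pois h d x = 5 * pois h d x + 2 * pois h d x by ring.
apply: lerD; last by apply: (St_pois PC) => //; rewrite oppr_le0 ltW.
rewrite /St normrM gtr0_norm ?invr_gt0// ler_pdivrMl// addr0.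
apply: (le_trans (norm_Int _ _)) => //.
apply: le_trans (@pois_itv _ _ _ PC h d x _ _ 2 h0 dX _ _ _) _ => //; lra.
Qed.

Lemma cont_fwd_diff h d : 0 < h -> continuous d -> continuous (fun x => A h d (x + h) - A h d x).
Proof.
move=> h0 cd.
have cA : continuous (A h d).
  by apply: (@is_derive_cont _ _ (fun x => h^-1 * (d (x + 0 + h) - d (x + 0)))) => x; exact: St_is_derive.
move=> x; apply: cvgB; last exact: cA.
apply: (@continuous_comp _ _ _ (fun x => x + h) (A h d)); last exact: cA.
by apply: cvgD; [exact: cvg_id|exact: cvg_cst].
Qed.

Lemma absorb (p q t w : R) : p <= q + t -> q <= 2^-1 * p -> t <= w -> p <= 2 * w.
Proof. by lra. Qed.

(* Writing [v] for [h u'] with [u] replaced by [A (A u)] and [d = (I - A) u],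
   one has [v = ramp v + e] where [e] only involves [d]; the powers of [ramp]
   tend to 0 in norm, so [v] is absorbed. *)
Lemma fwd_derive_le : exists2 K : R, 0 <= K & forall h u, 0 < h -> nice u ->
  h * rn (A h (A h (derive1 u))) <= K * rn (fun x => u x - A h u x).
Proof.
have [n hn] := ex_small_ramp PC.
pose k i : R := 2 ^- i * (1 + i.+1%:R ^+ 2) * C.
have k0 i : 0 <= k i.
  by rewrite mulr_ge0 ?(ltW C0)// mulr_ge0 ?invr_ge0 ?exprn_ge0// addr_ge0// sqr_ge0.
pose Ke := 7 * C + 2 * C * (2 * C).
have Ke0 : 0 <= Ke by rewrite addr_ge0// !mulr_ge0// ltW.
have [Ks Ks0 HKs] : exists2 Ks : R, 0 <= Ks & forall h v e, 0 < h -> continuous v -> continuous e ->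
    rcar v -> rcar e -> (forall x, v x = ramp h v x + e x) ->
    rn v <= k n * rn v + Ks * rn e.
  (* Iterating v = ramp v + e gives v = ramp^(m + 1) v + z, where z sums the images of [e] under the
     powers of [ramp] up to m. *)
  suff H m : exists2 Ks : R, 0 <= Ks & forall h v e, 0 < h -> continuous v -> continuous e ->
    rcar v -> rcar e -> (forall x, v x = ramp h v x + e x) ->
    exists2 z, rcar z /\ rn z <= Ks * rn e & forall x, v x = iter m.+1 (ramp h) v x + z x.
    have [Ks Ks0 HKs] := H n; exists Ks => // h v e h0 cv ce vX eX ve.
    have [z [zX zle] vz] := HKs h v e h0 cv ce vX eX ve.
    have [iX ile] := ramp_iter_X PC n h0 cv vX.
    have -> : rn v <= k n * rn v + Ks * rn e =
      (rn (fun x => iter n.+1 (ramp h) v x + z x) <= k n * rn v + Ks * rn e).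
      by congr (_ <= _); congr (bl_norm X (cpx _)); apply/funext.
    by apply: (le_trans (rnD iX zX)); exact: (lerD ile zle).
  elim: m => [|m [Ks Ks0 IH]].
    exists 1 => // h v e h0 cv ce vX eX ve; exists e => //.
    by rewrite mul1r.
  exists (Ks + k m); first by rewrite addr_ge0.
  move=> h v e h0 cv ce vX eX ve; have [z [zX zle] vz] := IH h v e h0 cv ce vX eX ve.
  have [iX ile] := ramp_iter_X PC m h0 ce eX.
  exists (fun x => iter m.+1 (ramp h) e x + z x).
    split; first exact: rcarD.
    by apply: (le_trans (rnD iX zX)); rewrite mulrDl addrC; exact: (lerD zle ile).
  have ci w j : continuous w -> continuous (iter j (ramp h) w).
    by move=> cw; elim: j => [//|j IHj]; rewrite iterS; exact: cont_ramp.
  have rD f g : continuous f -> continuous g -> forall x, ramp h (fun y => f y + g y) x = ramp h f x + ramp h g x.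
    move=> cf cg x; rewrite /ramp -mulrDr; congr (_ * _).
    have cyf (p : R -> R) : continuous p -> continuous (fun y => (y - x) * p y).
      by move=> cp y; apply: cvgM; [apply: cvgB; [exact: cvg_id|exact: cvg_cst]|exact: cp].
    rewrite -IntD//; [|by apply: intg_itv; exact: cyf|by apply: intg_itv; exact: cyf].
    by apply: eq_Int => y _; rewrite mulrDr.
  have vE : v = fun x => ramp h v x + e x by apply/funext.
  have iD j f g : continuous f -> continuous g -> forall x,
      iter j (ramp h) (fun y => f y + g y) x = iter j (ramp h) f x + iter j (ramp h) g x.
    move=> cf cg; elim: j => [//|j IHj] x; rewrite !iterS.
    rewrite (_ : iter j _ (fun y => _) = fun y => iter j (ramp h) f y + iter j (ramp h) g y).
      by rewrite rD//; exact: ci.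
    by apply/funext.
  move=> x; rewrite {1}vz {1}vE iD//; last exact: cont_ramp.
  by rewrite -[iter m.+1 (ramp h) (ramp h v) x]/(iter m.+1 (ramp h) (ramp h v) x) -iterSr addrA.
exists (2 * Ks * Ke); first by rewrite !mulr_ge0.
move=> h u h0 nu.
pose d x := u x - A h u x.
have nd : nice d by apply: niceB => //; exact: nice_fwd.
pose v x := h * derive1 (A h (A h u)) x.
(* v x = A u (x + h) - A u x and ramp v x = A A u (x + h) - A A A u x, while A u - A A A u = A d + A
   A d. With one average fewer, the translate of [d] itself would occur here. *)
pose e x := (A h d (x + h) - A h d x) - A h (A h d) x.
have nAu := nice_fwd h0 nu; have nAAu := nice_fwd h0 nAu.
have nAd := nice_fwd h0 nd; have nAAd := nice_fwd h0 nAd.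
have dAA w : nice w -> derive1 (A h (A h w)) = A h (A h (derive1 w)).
  move=> nw; have sw := nice_smooth nw.
  rewrite (derive1_eq (St_derive1 0 (@smooth_St _ h 0 w h0 sw) h0)).
  by rewrite (derive1_eq (St_derive1 0 sw h0)).
have [fX fle] := fwd_diff_X h0 (nice_rcar nd).
have [a1 l1] := fwd_X h0 (nice_rcar nd); have [a2 l2] := fwd_X h0 a1.
have eX : rcar e by apply: rcarB.
have ele : rn e <= Ke * rn d.
  apply: (le_trans (rnB _ _)) => //; rewrite mulrDl; apply: lerD => //.
  by apply: (le_trans l2); rewrite -[leRHS]mulrA ler_wpM2l// mulr_ge0// ltW.
have vX : rcar v by apply: rcarZ; exact: nice_rcar (nice_derive1 nAAu).
have cv : continuous v by move=> x; apply: cvgM; [exact: cvg_cst|exact: (nice_cont (nice_derive1 nAAu))].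
have ce : continuous e.
  by move=> x; apply: cvgB; [exact: (cont_fwd_diff h0 (nice_cont nd))|exact: (nice_cont nAAd)].
have ve x : v x = ramp h v x + e x.
  rewrite /v (ramp_eq x h0 (nice_smooth nAAu)) /e.
  have dE : A h d = fun x => A h u x - A h (A h u) x.
    by apply/funext => z; rewrite (St_B h 0 z (nice_rcar nu) (nice_rcar nAu)).
  have ddE : A h (A h d) = fun x => A h (A h u) x - A h (A h (A h u)) x.
    by apply/funext => z; rewrite dE (St_B h 0 z (nice_rcar nAu) (nice_rcar nAAu)).
  rewrite ddE dE.
  have -> : h * derive1 (A h (A h u)) x = A h u (x + h) - A h u x.
    rewrite (is_derive_derive1 (St_is_derive 0 x (nice_cont nAu) h0)) addr0.
    by rewrite mulrA divff ?gt_eqF// mul1r.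
  move: (A h (A h (A h u)) x) (A h (A h u) (x + h)) (A h (A h u) x) (A h u (x + h)) (A h u x) => a b p q t.
  by ring.
have := HKs h v e h0 cv ce vX eX ve.
have vn : rn v = h * rn (A h (A h (derive1 u))).
  have [w1 _] := fwd_X h0 (nice_rcar (nice_derive1 nu)); have [w2 _] := fwd_X h0 w1.
  have vE : v = fun x => h * A h (A h (derive1 u)) x by rewrite /v (dAA u nu).
  by rewrite vE (rnZ h w2) gtr0_norm.
rewrite -vn => H1; have v0 := rn_ge0 vX.
have H2 : k n * rn v <= 2^-1 * rn v by rewrite ler_wpM2r.
have H3 : Ks * rn e <= Ks * (Ke * rn d) by rewrite ler_wpM2l.
have -> : 2 * Ks * Ke * rn (fun x => u x - A h u x) = 2 * (Ks * (Ke * rn d)) by rewrite -/d -!mulrA.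
by apply: absorb H1 H2 H3.
Qed.

Lemma nice_iter_fwd h n u : 0 < h -> nice u -> nice (iter n (A h) u).
Proof. by move=> h0 nu; elim: n => [//|n IH]; rewrite iterS; exact: nice_fwd. Qed.

Lemma iter_fwd_X h n u : 0 < h -> rcar u ->
  rcar (iter n (A h) u) /\ rn (iter n (A h) u) <= (2 * C) ^+ n * rn u.
Proof.
move=> h0 uX; elim: n => [|n [IH1 IH2]]; first by rewrite expr0 mul1r.
rewrite iterS; have [h1 h2] := fwd_X h0 IH1; split => //.
by apply: (le_trans h2); rewrite exprS -[leRHS]mulrA ler_wpM2l// mulr_ge0// ltW.
Qed.

Lemma iter_fwd_B h n u v : 0 < h -> rcar u -> rcar v ->
  iter n (A h) (fun x => u x - v x) = fun x => iter n (A h) u x - iter n (A h) v x.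
Proof.
move=> h0 uX vX; elim: n => [//|n IH]; rewrite !iterS IH; apply/funext => x.
have [u1 _] := iter_fwd_X n h0 uX; have [v1 _] := iter_fwd_X n h0 vX.
by rewrite (St_B h 0 x u1 v1).
Qed.

Lemma derive1n_iter_fwd h m n u : 0 < h -> smooth u ->
  derive1n m (iter n (A h) u) = iter n (A h) (derive1n m u).
Proof.
move=> h0 su; have si n' : smooth (iter n' (A h) u).
  by elim: n' => [|n' IH]; [exact: su|rewrite iterS; exact: smooth_St].
elim: n => [//|n IH]; rewrite !iterS -IH.
by rewrite derive1n_St; [by []|exact: h0|exact: si].
Qed.

(** Each derivative is paid for by two averages and returns one factor I - A; this can be repeated
    because A commutes with differentiation. *)
Lemma iter_fwd_derive_le s : exists2 K : R, 0 <= K & forall h u, 0 < h -> nice u ->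
  h ^+ s * rn (iter (2 * s) (A h) (derive1n s u)) <= K * rn (rdef h 0 s u).
Proof.
have [K K0 HK] := fwd_derive_le.
elim: s => [|s [K' K'0 IH]]; first by exists 1 => // h u h0 nu; rewrite muln0 expr0.
exists (K * K'); first exact: mulr_ge0.
move=> h u h0 nu.
pose p := iter (2 * s) (A h) (derive1n s u).
have np : nice p by apply: nice_iter_fwd => //; exact: nice_derive1n.
have nAu := nice_fwd h0 nu.
have dp : derive1 p = iter (2 * s) (A h) (derive1n s.+1 u).
  exact: (derive1n_iter_fwd 1 (2 * s) h0 (nice_smooth (nice_derive1n s nu))).
rewrite mulnS add2n !iterS -dp exprSr -mulrA.
apply: (le_trans (ler_wpM2l (exprn_ge0 s (ltW h0)) (HK h p h0 np))).
have -> : (fun x => p x - A h p x) = iter (2 * s) (A h) (derive1n s (fun x => u x - A h u x)).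
  rewrite derive1nB; [|exact: nice_smooth nu|exact: nice_smooth nAu].
  rewrite iter_fwd_B//; [|exact: nice_rcar (nice_derive1n s nu)|exact: nice_rcar (nice_derive1n s nAu)].
  by rewrite derive1n_St//; [rewrite -iterSr -iterS|exact: nice_smooth nu].
rewrite mulrCA -mulrA ler_wpM2l//.
have -> : rdef h 0 s.+1 u = rdef h 0 s (fun x => u x - A h u x) by rewrite /rdef iterSr.
by apply: IH => //; exact: niceB.
Qed.

(* With [T = I - A ^ (2 s)], the smooth function is [F = u - T ^ s u = A ^ (2 s) q]. *)
Lemma k_functional s : exists2 K : R, 0 <= K & forall h u, 0 < h -> nice u ->
  exists F, [/\ nice F, rn (fun x => u x - F x) <= K * rn (rdef h 0 s u) &
    h ^+ s * rn (derive1n s F) <= K * rn (rdef h 0 s u)].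
Proof.
have [K1 K10 HK1] := iter_fwd_derive_le s.
pose N := (2 * s)%N.
pose T h w : R -> R := fun x => w x - iter N (A h) w x.
have nh h : 0 < h -> - h <= 0 by move=> h0; rewrite oppr_le0 ltW.
have nT h w : 0 < h -> nice w -> nice (T h w).
  by move=> h0 nw; apply: niceB => //; exact: nice_iter_fwd.
have nTi h i w : 0 < h -> nice w -> nice (iter i (T h) w).
  by move=> h0 nw; elim: i => [//|i IH]; rewrite iterS; exact: nT.
have nr h i w : 0 < h -> nice w -> nice (rdef h 0 i w).
  by move=> h0 nw; apply: (nice_rdef PC) => //; exact: nh.
have commA h i w : 0 < h -> nice w -> rdef h 0 i (A h w) = A h (rdef h 0 i w).
  move=> h0 nw; elim: i => [//|i IH]; rewrite !rdefS IH; apply/funext => x.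
  have nri := nr h i w h0 nw.
  by rewrite (St_B h 0 x (nice_rcar nri) (nice_rcar (nice_fwd h0 nri))).
have commAi h i j w : 0 < h -> nice w -> rdef h 0 i (iter j (A h) w) = iter j (A h) (rdef h 0 i w).
  move=> h0 nw; elim: j => [//|j IH]; rewrite !iterS commA ?IH//.
  exact: nice_iter_fwd.
have commT h i w : 0 < h -> nice w -> rdef h 0 i (T h w) = T h (rdef h 0 i w).
  move=> h0 nw; rewrite /T (rdef_B PC)//; [|exact: nh|exact: nice_rcar nw|].
    by rewrite commAi.
  exact: nice_rcar (nice_iter_fwd N h0 nw).
have commTi h i j w : 0 < h -> nice w -> rdef h 0 i (iter j (T h) w) = iter j (T h) (rdef h 0 i w).
  by move=> h0 nw; elim: j => [//|j IH]; rewrite !iterS commT ?IH//; exact: nTi.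
(* I - A^m is I - A followed by the sum of the powers of A below m, each of which is bounded on
   X. *)
have [G G0 HG] : exists2 G : R, 0 <= G & forall h w, 0 < h -> nice w ->
    rn (T h w) <= G * rn (fun x => w x - A h w x).
  rewrite /T; move: (N) => m; elim: m => [|n [G G0 IH]].
    exists 0 => // h w h0 nw; rewrite mul0r (_ : (fun _ => _) = fun=> 0) ?rn0//.
    by apply/funext => x; rewrite /= subrr.
  exists (G + (2 * C) ^+ n); first by rewrite addr_ge0// exprn_ge0// mulr_ge0// ltW.
  move=> h w h0 nw; have nAw := nice_fwd h0 nw.
  have ni := nice_iter_fwd n h0 nw.
  have -> : (fun x => w x - iter n.+1 (A h) w x) = fun x => (w x - iter n (A h) w x) +
      iter n (A h) (fun y => w y - A h w y) x.
    apply/funext => x; rewrite iter_fwd_B//; [|exact: nice_rcar nw|exact: nice_rcar nAw].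
    by rewrite -iterSr; ring.
  have [dX dle] := iter_fwd_X n h0 (nice_rcar (niceB nw nAw)).
  apply: (le_trans (rnD _ dX)); first exact: nice_rcar (niceB nw ni).
  by rewrite mulrDl; apply: lerD => //; exact: IH.
have [T1 T10 HT1] : exists2 T1 : R, 0 <= T1 & forall h w, 0 < h -> nice w -> rn (T h w) <= T1 * rn w.
  exists (1 + (2 * C) ^+ N); first by rewrite addr_ge0// exprn_ge0// mulr_ge0// ltW.
  move=> h w h0 nw; have [iX ile] := iter_fwd_X N h0 (nice_rcar nw).
  by apply: (le_trans (rnB (nice_rcar nw) iX)); rewrite mulrDl mul1r; exact: lerD.
have Ti h i w : 0 < h -> nice w -> rn (iter i (T h) w) <= G ^+ i * rn (rdef h 0 i w).
  move=> h0; elim: i w => [|i IH] w nw; first by rewrite expr0 mul1r.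
  rewrite iterSr; apply: (le_trans (IH _ (nT _ _ h0 nw))).
  rewrite commT// exprSr -mulrA ler_wpM2l ?exprn_ge0//.
  by apply: (le_trans (HG h _ h0 (nr h i w h0 nw))); rewrite -rdefS.
have Ti2 h i w : 0 < h -> nice w -> rn (iter i (T h) w) <= T1 ^+ i * rn w.
  move=> h0 nw; elim: i => [|i IH]; first by rewrite expr0 mul1r.
  rewrite iterS; apply: (le_trans (HT1 h _ h0 (nTi h i w h0 nw))).
  by rewrite exprS -mulrA ler_wpM2l.
pose S := \sum_(j < s) T1 ^+ j.
have S0 : 0 <= S by apply: sumr_ge0 => i _; exact: exprn_ge0.
exists (G ^+ s + K1 * S); first by rewrite addr_ge0 ?exprn_ge0// mulr_ge0.
move=> h u h0 nu.
(* I - T^i = A^(2 s) (I + T + ... + T^(i - 1)), so [q] is this sum applied to [u]. *)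
have /(_ s)[q [nq qle qE]] : forall i, exists q, [/\ nice q,
    rn (rdef h 0 s q) <= \sum_(j < i) T1 ^+ j * rn (rdef h 0 s u) &
    forall x, u x - iter N (A h) q x = iter i (T h) u x].
  elim=> [|i [q [nq qle qE]]].
    exists (fun=> 0); have n0 : nice (fun=> 0).
      have := niceB nu nu; congr nice.
      by apply/funext => x; rewrite subrr.
    have z0 j : iter j (A h) (fun=> 0) = fun=> 0.
      by elim: j => [//|j IH]; rewrite iterS IH; apply/funext => x; rewrite /St Int0 mulr0.
    split => //; last by move=> x; rewrite z0 subr0.
    rewrite big_ord0 (_ : rdef h 0 s _ = fun=> 0) ?rn0//.
    move: (s) => m; elim: m => [//|j IH]; rewrite rdefS IH; apply/funext => x.
    by rewrite /St Int0 mulr0 subrr.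
  have niu := nTi h i u h0 nu.
  exists (fun x => q x + iter i (T h) u x); split; first exact: niceD.
    have rD v w : nice v -> nice w -> rdef h 0 s (fun x => v x + w x) = fun x => rdef h 0 s v x + rdef h 0 s w x.
      move=> nv nw; have n0 : nice (fun=> 0).
        by have := niceB nu nu; congr nice; apply/funext => x; rewrite subrr.
      have nNw : nice (fun x => 0 - w x) by exact: niceB.
      have r0 : rdef h 0 s (fun=> 0) = fun=> 0.
        move: (s) => m; elim: m => [//|j IH]; rewrite rdefS IH; apply/funext => x.
        by rewrite /St Int0 mulr0 subrr.
      have -> : (fun x => v x + w x) = fun x => v x - (0 - w x) by apply/funext => x; ring.
      rewrite (rdef_B PC)//; [|exact: nh|exact: nice_rcar|exact: nice_rcar].
      apply/funext => x; rewrite (rdef_B PC)//; [|exact: nh|exact: nice_rcar|exact: nice_rcar].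
      by rewrite r0; ring.
    rewrite (rD _ _ nq niu) (commTi _ _ _ _ h0 nu) big_ord_recr/=.
    apply: (le_trans (rnD _ _)).
    - exact: nice_rcar (nr _ _ _ h0 nq).
    - exact: nice_rcar (nTi h i _ h0 (nr _ _ _ h0 nu)).
    by apply: lerD => //; apply: Ti2 => //; exact: nr.
  move=> x; have n0 : nice (fun=> 0).
    by have := niceB nu nu; congr nice; apply/funext => z; rewrite subrr.
  have nNw : nice (fun x => 0 - iter i (T h) u x) by exact: niceB.
  have z0 j : iter j (A h) (fun=> 0) = fun=> 0.
    by elim: j => [//|j IH]; rewrite iterS IH; apply/funext => z; rewrite /St Int0 mulr0.
  have -> : (fun x => q x + iter i (T h) u x) = fun x => q x - (0 - iter i (T h) u x) by apply/funext => z; ring.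
  rewrite iter_fwd_B//; [|exact: nice_rcar nq|exact: nice_rcar nNw].
  rewrite iter_fwd_B//; [|exact: nice_rcar n0|exact: nice_rcar niu].
  by rewrite z0 iterS {2}/T -qE; ring.
exists (iter N (A h) q); split; first exact: nice_iter_fwd.
  rewrite (_ : (fun x => _) = iter s (T h) u); last by apply/funext.
  apply: (le_trans (Ti h s u h0 nu)); rewrite ler_wpM2r ?lerDl ?mulr_ge0//.
  exact: rn_ge0 (nice_rcar (nr _ _ _ h0 nu)).
rewrite derive1n_iter_fwd//; last exact: nice_smooth nq.
apply: (le_trans (HK1 h q h0 nq)).
have r0 := rn_ge0 (nice_rcar (nr h s u h0 nu)).
rewrite -mulr_suml in qle; apply: (le_trans (ler_wpM2l K10 qle)); rewrite mulrA ler_wpM2r// lerDr exprn_ge0//.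
Qed.

End k_functional.

(** * Smooth cut-offs *)

Section bump.
Context {R : realType}.
Implicit Types (f g u : R -> R) (a b c k x y t : R) (p : {poly R}).

(** Serves to differentiate integrals depending on a parameter: a quadratic Taylor remainder of the
    integrand is integrated, with no interchange of limits. *)
Lemma is_derive_quad f x (d M : R) (delta : R) : 0 < delta ->
  (forall t, `|t| < delta -> `|f (x + t) - f x - d * t| <= M * t ^+ 2) ->
  is_derive x 1 f d.
Proof.
move=> d0 H.
have lim : h^-1 *: ((f \o shift x) (h *: (1 : R)) - f x) @[h --> 0^'] --> d.
  apply/cvgrPdist_le => /= e e0.
  pose D := Num.min delta (e / (`|M| + 1)).
  have M1 : 0 < `|M| + 1 by have := normr_ge0 M; lra.
  have D0 : 0 < D by rewrite lt_min d0 divr_gt0.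
  near=> h.
  have hn0 : h != 0 by near: h; exact: nbhs_dnbhs_neq.
  have : `|h| < D by near: h; apply: dnbhs0_lt.
  rewrite lt_min => /andP[h1 h2].
  have := H h h1.
  have -> : d - h^-1 *: (f (h *: (1 : R) + x) - f x) = - (h^-1 * (f (x + h) - f x - d * h)).
    by rewrite /GRing.scale/= mulr1 (addrC h x); field.
  rewrite normrN normrM normfV => H1.
  have hp : 0 < `|h| by rewrite normr_gt0.
  rewrite ler_pdivrMl//; apply: (le_trans H1).
  have -> : h ^+ 2 = `|h| * `|h| by rewrite -expr2 real_normK// num_real.
  have h3 : `|h| * (`|M| + 1) <= e by rewrite -ler_pdivlMr// ltW.
  have h4 : M * (`|h| * `|h|) <= `|M| * (`|h| * `|h|).
    by rewrite ler_wpM2r ?mulr_ge0// ler_norm.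
  have := normr_ge0 M; nra.
apply: DeriveDef; first by apply/cvg_ex; exists d.
by apply: cvg_lim.
Unshelve. all: by end_near.
Qed.

(** The family of all p(1/x) exp(-1/x) is closed under differentiation: [p] becomes X^2 (p - p').
    For p = 1 it is the usual smooth function that is flat at 0. *)
Definition flat p x : R := if 0 < x then p.[x^-1] * expR (- x^-1) else 0.

Lemma powM_expR_le n y : 0 <= y -> y ^+ n.+1 * expR (- y) <= n.+1`!%:R.
Proof.
move=> y0; rewrite expRN ler_pdivrMr ?expR_gt0// -ler_pdivrMl ?ltr0n ?fact_gt0//.
by apply: le_trans (expR_ge1Dxn n y0); rewrite mulrC; lra.
Qed.

Lemma poly_expR_le p n : exists2 M : R, 0 <= M & forall y, 0 <= y ->
  y ^+ n.+1 * `|p.[y]| * expR (- y) <= M.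
Proof.
exists (\sum_(i < size p) `|p`_i| * (n + i).+1`!%:R).
  by apply: sumr_ge0 => i _; rewrite mulr_ge0.
move=> y y0; rewrite horner_coef.
apply: (@le_trans _ _ (y ^+ n.+1 * (\sum_(i < size p) `|p`_i| * y ^+ i) * expR (- y))).
  rewrite ler_wpM2r ?expR_ge0// ler_wpM2l ?exprn_ge0//.
  apply: (le_trans (ler_norm_sum _ _ _)); apply: ler_sum => i _.
  by rewrite normrM (ger0_norm (exprn_ge0 _ y0)).
rewrite mulr_sumr mulr_suml; apply: ler_sum => i _.
rewrite mulrCA -mulrA ler_wpM2l// -exprD addSn.
exact: powM_expR_le.
Qed.

(** Exponential decay beats every polynomial; order 2 is what [is_derive_quad] requires for
    derivative 0 at the origin. *)
Lemma flat_quad p : exists2 M : R, 0 <= M & forall t, `|flat p t| <= M * t ^+ 2.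
Proof.
have [M M0 HM] := poly_expR_le p 1; exists M => // t; rewrite /flat.
case: ifPn => t0; last by rewrite normr0 mulr_ge0// sqr_ge0.
have ti : 0 <= t^-1 by rewrite invr_ge0 ltW.
rewrite normrM (ger0_norm (expR_ge0 _)) -ler_pdivrMr ?exprn_gt0//.
apply: le_trans (HM _ ti); rewrite exprVn.
by rewrite -mulrA mulrC.
Qed.

Lemma flat_is_derive p x : is_derive x 1 (flat p) (flat ('X^2 * (p - p^`())) x).
Proof.
have [x0|x0|->] := ltrgt0P x.
- apply: (@is_derive_near _ _ (fun y => p.[y^-1] * expR (- y^-1))).
    by near=> y; rewrite /flat ifT//; near: y; exact: lt_nbhsr.
  have xn0 : x != 0 by rewrite gt_eqF.
  have dV : is_derive x 1 (fun y => y^-1) (- x ^- 2).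
    apply: (is_derive_val (is_deriveV xn0 (is_derive_id x 1))).
    by rewrite /GRing.scale/= mulr1.
  have dp : is_derive x 1 (fun y => p.[y^-1]) (- x ^- 2 * (p^`()).[x^-1]).
    have := @is_derive1_comp R (horner p) (fun y => y^-1) x _ _ (is_derive_poly p x^-1) dV.
    by move=> h; apply: (is_derive_val h); rewrite mulrC.
  have dN : is_derive x 1 (fun y => - y^-1) (x ^- 2).
    by apply: (is_derive_val (is_deriveN dV)); rewrite opprK.
  have de : is_derive x 1 (fun y => expR (- y^-1)) (x ^- 2 * expR (- x^-1)).
    have := @is_derive1_comp R expR (fun y => - y^-1) x _ _ (is_derive_expR _) dN.
    by move=> h; apply: (is_derive_val h); rewrite mulrC.
  apply: (is_derive_val (is_deriveM_fun dp de)).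
  rewrite /flat x0 hornerM hornerD hornerN hornerXn; field; exact: xn0.
- apply: (@is_derive_near _ _ (fun=> 0)).
    near=> y; rewrite /flat ifN// -leNgt ltW//; near: y; exact: lt_nbhsl.
  by rewrite /flat ifN -?leNgt ?ltW//; exact: is_derive_cst.
have [M M0 HM] := flat_quad p.
apply: (@is_derive_quad _ _ _ M 1) => // t _.
by rewrite /flat ltxx add0r mul0r !subr0; exact: HM.
Unshelve. all: by end_near.
Qed.

Lemma smooth_flat p : smooth (flat p).
Proof.
apply: (@smooth_coind _ [set f | exists p, f = flat p]); last by exists p.
by move=> _ [q ->]; exists (flat ('X^2 * (q - q^`()))); [exists ('X^2 * (q - q^`()))|exact: flat_is_derive].
Qed.

Lemma flat1E x : flat 1 x = if 0 < x then expR (- x^-1) else 0.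
Proof. by rewrite /flat hornerE mul1r. Qed.

Lemma flat1_ge0 x : 0 <= flat 1 x.
Proof. by rewrite flat1E; case: ifP => // _; exact: expR_ge0. Qed.

Lemma flat1_eq0 x : x <= 0 -> flat 1 x = 0.
Proof. by move=> x0; rewrite flat1E ltNge x0. Qed.

(** A normalised primitive of the bump exp(-1/x) exp(-1/(1 - x)) on (0, 1), extended by 0. *)
Lemma ex_smooth_step : exists S : R -> R, [/\ smooth S, forall x, 0 <= S x <= 1,
  forall x, x <= 0 -> S x = 0 & forall x, 1 <= x -> S x = 1].
Proof.
pose b x := flat 1 x * flat 1 (- 1 * x + 1).
have sb : smooth b.
  by apply: smoothM; [exact: smooth_flat|apply: smooth_affine; exact: smooth_flat].
have cb := smooth_cont sb; have [P dP] := ex_primitive cb.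
have b0 x : 0 <= b x by rewrite mulr_ge0// flat1_ge0.
have PI x y : x <= y -> P y - P x = Int `[x, y] b by move=> xy; rewrite (Int_ftc xy cb dP).
have Pnd x y : x <= y -> P x <= P y.
  by move=> xy; rewrite -subr_ge0 PI//; exact: Int_ge0.
have z1 x y : x <= y -> y <= 0 -> P y = P x.
  move=> xy y0; apply/eqP; rewrite -subr_eq0 PI// -[X in _ == X](Int0 `[x, y]); apply/eqP.
  apply: eq_Int => z; rewrite /= in_itv/= => /andP[_ zy].
  by rewrite /b flat1_eq0 ?mul0r//; lra.
have z2 x y : x <= y -> 1 <= x -> P y = P x.
  move=> xy y0; apply/eqP; rewrite -subr_eq0 PI// -[X in _ == X](Int0 `[x, y]); apply/eqP.
  apply: eq_Int => z; rewrite /= in_itv/= => /andP[zx _].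
  by rewrite /b (@flat1_eq0 (- 1 * z + 1)) ?mulr0//; lra.
(* The normalising constant is positive because the bump is at least exp(-4)^2 on [1/4, 3/4]. *)
have c0 : 0 < P 1 - P 0.
  pose e := expR (- 4) ^+ 2 : R.
  have e0 : 0 < e by rewrite exprn_gt0// expR_gt0.
  apply: (@lt_le_trans _ _ (Int `[4^-1, 1 - 4^-1] (fun=> e))).
    by rewrite Int_cst; [apply: mulr_gt0 => //|]; lra.
  apply: (@le_trans _ _ (Int `[4^-1, 1 - 4^-1] b)).
    apply: le_Int => //; [by apply: intg_itv => ?; exact: cvg_cst|exact: intg_itv|].
    move=> x; rewrite /= in_itv/= => /andP[x1 x2].
    have le z : 4^-1 <= z -> expR (- 4) <= flat 1 z.
      move=> z1'; have z0 : 0 < z by lra.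
      rewrite flat1E z0 ler_expR lerN2 -[leRHS]invrK lef_pV2 ?posrE ?invr_gt0//.
    rewrite /e /b expr2 ler_pM ?expR_ge0//; apply: le => //; lra.
  rewrite PI//; apply: Int_subset => //; last exact: intg_itv.
  by move=> x /=; rewrite !in_itv/= => /andP[x1 x2]; apply/andP; split; lra.
set c := P 1 - P 0 in c0.
exists (fun x => c^-1 * (P x - P 0)); split.
- apply: smoothZ; apply: smoothB; last exact: smooth_cst.
  exact: smooth_primitive dP sb.
- have S0 x : 0 <= P x - P 0.
    have [x0|/ltW x0] := leP 0 x; first by rewrite subr_ge0 Pnd.
    by rewrite (z1 _ _ x0) ?subrr.
  have S1 x : P x - P 0 <= c.
    have [x1|/ltW x1] := leP x 1; first by rewrite /c lerD2r Pnd.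
    by rewrite (z2 _ _ x1).
  move=> x; rewrite mulr_ge0 ?invr_ge0 ?(ltW c0)//=.
  by rewrite ler_pdivrMl// mulr1.
- by move=> x x0; rewrite (z1 _ _ x0) ?subrr ?mulr0.
- by move=> x x1; rewrite (z2 _ _ x1)// -/c mulVf// gt_eqF.
Qed.

Lemma ex_cutoff : exists theta : R -> R, [/\ smooth theta, forall x, 0 <= theta x <= 1,
  forall x, theta (- x) = theta x, forall x, `|x| <= 2^-1 -> theta x = 1 &
  forall x, 1 <= `|x| -> theta x = 0].
Proof.
have [S [sS S01 S0 S1]] := ex_smooth_step.
exists (fun x => S (2 * x + 2) * S (- 2 * x + 2)); split.
- by apply: smoothM; exact: smooth_affine.
- move=> x; have /andP[a0 a1] := S01 (2 * x + 2); have /andP[b0 b1] := S01 (- 2 * x + 2).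
  by rewrite mulr_ge0//= mulr_ile1.
- by move=> x; rewrite mulrC mulrNN mulrN mulNr.
- move=> x; rewrite ler_norml => /andP[x1 x2]; rewrite !S1 ?mulr1//; lra.
move=> x; rewrite ler_normr => /orP[x1|x1].
  by rewrite (S0 (- 2 * x + 2)) ?mulr0//; lra.
by rewrite (S0 (2 * x + 2)) ?mul0r//; lra.
Qed.

End bump.

(** * Cosine transforms *)

Section fourier_integrals.
Context {R : realType}.
Implicit Types (f g u phi : R -> R) (a b c k x y t al L : R) (n j : nat).

(** Between x and x + t the derivative of f minus its tangent is at most M |t|; integrating it gives
    a further factor |t|. *)
Lemma taylor2 f x t (M : R) : smooth f ->
  (forall y, `|y - x| <= `|t| -> `|derive1 (derive1 f) y| <= M) ->
  `|f (x + t) - f x - derive1 f x * t| <= M * t ^+ 2.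
Proof.
move=> sf fM; have sf' := smooth_derive1 sf; have sf'' := smooth_derive1 sf'.
have M0 : 0 <= M by apply: le_trans (fM x _) => //; rewrite subrr normr0.
have norm_sub y z : `|y - z| <= `|t| <-> z - `|t| <= y <= z + `|t|.
  rewrite ler_norml; split => /andP[h1 h2]; apply/andP; split; lra.
have h1 p q : x - `|t| <= p -> p <= q -> q <= x + `|t| -> `|derive1 f q - derive1 f p| <= M * (q - p).
  move=> xp pq qx; apply: (le_trans (smooth_diff_le sf' pq)); rewrite -Int_cst//.
  apply: le_Int => //.
  - by apply: intg_itv => ?; apply: cvg_norm; exact: smooth_cont.
  - by apply: intg_itv => ?; exact: cvg_cst.
  move=> y; rewrite /= in_itv/= => /andP[y1 y2]; apply: fM; apply/norm_sub.
  by apply/andP; split; lra.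
pose g y := f y - derive1 f x * y.
have sg : smooth g by apply: (smoothB sf); apply: smoothZ; exact: smooth_id.
have dg : derive1 g = fun y => derive1 f y - derive1 f x.
  apply: derive1_eq => y.
  apply: (is_derive_val (is_deriveB_fun (smooth_is_derive y sf) (is_deriveZ_fun (derive1 f x) (is_derive_id y 1)))).
  by rewrite mulr1.
have t2 : `|t| * `|t| = t ^+ 2 by rewrite -expr2 real_normK// num_real.
have h2 p q : p <= q -> q - p = `|t| -> x - `|t| <= p -> q <= x + `|t| -> (p = x \/ q = x) ->
    `|g q - g p| <= M * t ^+ 2.
  move=> pq qp xp qx pqx; apply: (le_trans (smooth_diff_le sg pq)).
  apply: (@le_trans _ _ (Int `[p, q] (fun=> M * `|t|))); last by rewrite Int_cst// qp -mulrA t2.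
  apply: le_Int => //.
  - by apply: intg_itv => ?; apply: cvg_norm; apply: smooth_cont; exact: smooth_derive1.
  - by apply: intg_itv => ?; exact: cvg_cst.
  move=> y; rewrite /= in_itv/= => /andP[y1 y2]; rewrite dg.
  have [yx|yx] : x <= y \/ y < x by case: (leP x y) => ?; [left|right].
    apply: (le_trans (h1 x y _ _ _)) => //; try lra.
    rewrite ler_wpM2l//; lra.
  rewrite distrC; apply: (le_trans (h1 y x _ _ _)) => //; try lra.
  rewrite ler_wpM2l//; lra.
have -> : f (x + t) - f x - derive1 f x * t = g (x + t) - g x by rewrite /g; ring.
have [t0|t0] := leP 0 t.
  by apply: h2; rewrite ?(ger0_norm t0); [lra|ring|lra|lra|left].
by rewrite distrC; apply: h2; rewrite ?(ltr0_norm t0); [lra|ring|lra|lra|right].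
Qed.

Definition supp L f := forall x, L < `|x| -> f x = 0.

Lemma suppW L (L' : R) f : L <= L' -> supp L f -> supp L' f.
Proof. by move=> LL fL x Lx; apply: fL; exact: le_lt_trans Lx. Qed.

Lemma supp_itv L x : 0 <= L -> ~ `[- L, L]%classic x -> L < `|x|.
Proof.
move=> L0; rewrite /= in_itv/= => /negP; rewrite -ler_norml -ltNge; exact.
Qed.

Lemma supp_indic L f : 0 <= L -> supp L f -> f = fun x => f x * \1_(`[- L, L]%classic) x.
Proof.
move=> L0 fL; apply/funext => x; rewrite indicE; case: (boolP (x \in _)) => [_|]; first by rewrite mulr1.
by rewrite mulr0 notin_setE => /(supp_itv L0)/fL.
Qed.

Lemma Int_supp L f : 0 <= L -> supp L f -> Int setT f = Int `[- L, L] f.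
Proof. by move=> L0 fL; rewrite [RHS]Int_indic -supp_indic. Qed.

Lemma intg_supp L f : 0 <= L -> continuous f -> supp L f -> intg setT f.
Proof.
move=> L0 cf fL; rewrite (supp_indic L0 fL); apply: intg_indic => //.
  exact: meas_cont.
exact: intg_itv.
Qed.

Lemma supp_derive1 L f : smooth f -> supp L f -> supp L (derive1 f).
Proof.
move=> sf fL x Lx; apply: is_derive_derive1; apply: (@is_derive_near _ _ (fun=> 0)).
  have cn : continuous (fun y : R => `|y|) by move=> y; exact: norm_continuous.
  by near=> y; apply: fL; near: y; exact: (cvgr_gt _ (cn x)).
Unshelve. all: by end_near.
Qed.

Definition ctest L phi := smooth phi /\ supp L phi.

Lemma ctest_derive1 L phi : ctest L phi -> ctest L (derive1 phi).
Proof. by move=> [sp pL]; split; [exact: smooth_derive1|exact: supp_derive1]. Qed.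

Lemma ctestM L phi f : ctest L phi -> smooth f -> ctest L (fun x => f x * phi x).
Proof. by move=> [sp pL] sf; split; [exact: smoothM|move=> x /pL ->; rewrite mulr0]. Qed.

(* The phase [al] makes sine transforms special cases ([al = - pi / 2]) and
   turns differentiation into a phase shift. *)
Definition FT al phi x : R := Int setT (fun e => phi e * cos (x * e + al)).

Lemma cos_affine_cont a b : continuous (fun x => cos (a * x + b)).
Proof. by apply: smooth_cont; rewrite (_ : (fun _ => _) = fun x => 1 * cos (a * x + b)); [exact: smooth_cosin|apply/funext => x; rewrite mul1r]. Qed.

Lemma FT_intg L al phi x : 0 <= L -> ctest L phi -> intg setT (fun e => phi e * cos (x * e + al)).
Proof.
move=> L0 [sp pL]; apply: (intg_supp L0); last by move=> e /pL ->; rewrite mul0r.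
by move=> e; apply: cvgM; [exact: smooth_cont|exact: cos_affine_cont].
Qed.

Lemma FT_bound L al phi x : 0 <= L -> ctest L phi ->
  `|FT al phi x| <= Int setT (fun e => `|phi e|).
Proof.
move=> L0 cp; have [sp pL] := cp; have cphi := smooth_cont sp.
apply: norm_Int_le => //.
- by apply: meas_cont => e; apply: cvgM; [exact: cphi|exact: cos_affine_cont].
- by apply: intg_norm => //; exact: intg_supp pL.
move=> e _; rewrite normrM ler_piMr//; rewrite ler_norml cos_geN1 cos_le1//.
Qed.

Lemma cos_taylor a b : `|cos (a + b) - cos a - b * cos (a + pi / 2)| <= b ^+ 2.
Proof.
have dcos (q x : R) : is_derive x 1 (fun t => cos (t + q)) (cos (x + (q + pi / 2))).
  have := is_derive_affine (is_derive_cos (1 * x + q)).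
  rewrite (_ : (fun t => _) = fun t => cos (t + q)); last by apply/funext => t; rewrite mul1r.
  by move=> h; apply: (is_derive_val h); rewrite !mul1r addrA cosD cos_pihalf sin_pihalf mulr0 mulr1 sub0r.
have sc (q : R) : smooth (fun t => cos (t + q)).
  rewrite (_ : (fun t => _) = fun t => 1 * cos (1 * t + q)); first exact: smooth_cosin.
  by apply/funext => t; rewrite !mul1r.
have := @taylor2 (fun t => cos (t + a)) 0 b 1 (sc a).
rewrite (derive1_eq (dcos a)) (derive1_eq (dcos (a + pi / 2))) !add0r !mul1r (addrC b) (mulrC _ b).
by apply => y _; rewrite ler_norml cos_geN1 cos_le1.
Qed.

Lemma FT_is_derive L al phi x : 0 <= L -> ctest L phi ->
  is_derive x 1 (FT al phi) (FT (al + pi / 2) (fun e => e * phi e) x).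
Proof.
move=> L0 cp; have [sp pL] := cp; have ce := ctestM cp smooth_id.
have ce2 := ctestM ce smooth_id.
apply: (@is_derive_quad _ _ _ _ (Int setT (fun e => `|e * (e * phi e)|)) 1) => // t _.
rewrite /FT -IntB//; [|exact: (FT_intg _ _ L0 cp)|exact: (FT_intg _ _ L0 cp)].
rewrite mulrC -IntZ//; last exact: (FT_intg _ _ L0 ce).
rewrite -IntB//; last 2 first.
- by apply: intgB => //; exact: (FT_intg _ _ L0 cp).
- by apply: intgZ => //; exact: (FT_intg _ _ L0 ce).
rewrite [leRHS]mulrC -[leRHS]IntZ//; last first.
  by apply: intg_norm => //; apply: (intg_supp L0); [exact: smooth_cont (proj1 ce2)|exact: proj2 ce2].
apply: norm_Int_le => //.
- apply: meas_cont => e; have cphi := smooth_cont sp.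
  apply: cvgB; last first.
    apply: cvgM; first exact: cvg_cst.
    by apply: cvgM; [apply: cvgM; [exact: cvg_id|exact: cphi]|exact: cos_affine_cont].
  by apply: cvgB; (apply: cvgM; [exact: cphi|exact: cos_affine_cont]).
- by apply: intgZ => //; apply: intg_norm => //; apply: (intg_supp L0); [exact: smooth_cont (proj1 ce2)|exact: proj2 ce2].
move=> e _.
have -> : phi e * cos ((x + t) * e + al) - phi e * cos (x * e + al) -
    t * (e * phi e * cos (x * e + (al + pi / 2))) =
    phi e * (cos ((x * e + al) + t * e) - cos (x * e + al) - t * e * cos ((x * e + al) + pi / 2)).
  by rewrite addrA (_ : (x + t) * e + al = (x * e + al) + t * e); ring.
rewrite normrM; have H := cos_taylor (x * e + al) (t * e).
apply: (le_trans (ler_wpM2l (normr_ge0 _) H)).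
by rewrite mulrA -expr2 normrM normrX real_normK ?num_real// exprMn; lra.
Qed.

Lemma FT_mulx L al phi x : 0 <= L -> ctest L phi ->
  x * FT al phi x = FT (al + pi / 2) (derive1 phi) x.
Proof.
move=> L0 cp; have [sp pL] := cp; have [sp' pL'] := ctest_derive1 cp.
(* [supp] speaks of points strictly beyond [L], so the boundary terms of the integration by parts
   are taken at distance L + 1. *)
have L1 : 0 <= L + 1 by lra.
have LL : L <= L + 1 by lra.
rewrite -IntZ//; last exact: (FT_intg _ _ L0 cp).
apply/eqP; rewrite -subr_eq0 -IntB//; last 2 first.
- by apply: intgZ => //; exact: (FT_intg _ _ L0 cp).
- exact: (FT_intg _ _ L0 (ctest_derive1 cp)).
rewrite (@Int_supp (L + 1))//; last first.
  by move=> e le; rewrite (suppW LL pL)// (suppW LL pL')// !mul0r mulr0 subrr.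
pose Q e := (-1) * (phi e * cos (x * e + (al + pi / 2))).
have -> : Int `[- (L + 1), L + 1] (fun e => x * (phi e * cos (x * e + al)) -
    derive1 phi e * cos (x * e + (al + pi / 2))) = Q (L + 1) - Q (- (L + 1)).
  apply: Int_ftc; first lra.
    have cphi := smooth_cont sp; have cphi' := smooth_cont sp'.
    move=> e; apply: cvgB; last by apply: cvgM; [exact: cphi'|exact: cos_affine_cont].
    by apply: cvgM; [exact: cvg_cst|apply: cvgM; [exact: cphi|exact: cos_affine_cont]].
  move=> e.
  have dc : is_derive e 1 (fun e => cos (x * e + (al + pi / 2))) (- (x * cos (x * e + al))).
    apply: (is_derive_val (is_derive_affine (is_derive_cos (x * e + (al + pi / 2))))).
    by rewrite addrA sinD cos_pihalf sin_pihalf mulr0 mulr1 add0r mulrN.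
  apply: (is_derive_val (is_deriveZ_fun (-1) (is_deriveM_fun (smooth_is_derive e sp) dc))).
  by ring.
rewrite /Q !pL ?mul0r ?mulr0 ?subrr//.
  by rewrite normrN ger0_norm//; lra.
by rewrite ger0_norm//; lra.
Qed.

End fourier_integrals.

(** * Schwartz functions and their integrals *)

Section schwartz_functions.
Context {R : realType}.
Implicit Types (f g u phi : R -> R) (a b c x y t al L M : R) (n j k : nat).

Lemma measurable_affine a c f : measurable_fun setT f -> measurable_fun setT (fun t : R => f (a + c * t)).
Proof.
move=> mf; apply: measurableT_comp => //; apply: continuous_measurable_fun => t.
by apply: cvgD; [exact: cvg_cst|apply: cvgM; [exact: cvg_cst|exact: cvg_id]].
Qed.

Lemma intg_Borel f : measurable_fun setT f ->
  intg setT f <-> lebesgue_measure.-integrable setT (EFin \o f).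
Proof. by move=> mf; apply: integrable_leb => //; exact/measurable_EFinP. Qed.

Lemma Int_affine a c f : 0 < c -> continuous f -> intg setT f ->
  intg setT (fun t => f (a + c * t)) /\ Int setT (fun t => f (a + c * t)) = c^-1 * Int setT f.
Proof.
move=> c0 cf fi; have mf := continuous_measurable_fun cf.
have mg := measurable_affine a c mf.
have fi' : lebesgue_measure.-integrable setT (EFin \o f) by apply/intg_Borel.
have gi := integrable_affine a c0 fi'.
split; first by apply/intg_Borel.
rewrite /Int !Rintegral_leb//; rewrite /Rintegral (integral_affine a c0 fi').
by rewrite fineM//; exact: integrable_fin_num.
Qed.

Lemma Int_opp f : continuous f -> intg setT f ->
  intg setT (fun t => f (- t)) /\ Int setT (fun t => f (- t)) = Int setT f.
Proof.
move=> cf fi; have mf := continuous_measurable_fun cf.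
have mg : measurable_fun setT (fun t : R => f (- t)).
  apply: continuous_measurable_fun => t; apply: (@continuous_comp _ _ _ (fun t : R => - t) f); last exact: cf.
  by apply: cvgN; exact: cvg_id.
have fi' : lebesgue_measure.-integrable setT (EFin \o f) by apply/intg_Borel.
have gi := integrable_opp fi'.
split; first by apply/intg_Borel.
rewrite /Int !Rintegral_leb//; rewrite /Rintegral; congr fine.
by apply: (@integral_opp _ (EFin \o f)); exact: measurable_int fi'.
Qed.

Lemma Int_reflect x f : continuous f -> intg setT f ->
  intg setT (fun y => f (x - y)) /\ Int setT (fun y => f (x - y)) = Int setT f.
Proof.
move=> cf fi; have [gi gE] := Int_affine x ltr01 cf fi.
have cg : continuous (fun t => f (x + 1 * t)).
  move=> t; apply: (@continuous_comp _ _ _ (fun t : R => x + 1 * t) f); last exact: cf.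
  by apply: cvgD; [exact: cvg_cst|apply: cvgM; [exact: cvg_cst|exact: cvg_id]].
have [hi hE] := Int_opp cg gi.
have E : (fun y => f (x - y)) = fun t => f (x + 1 * - t) by apply/funext => y; rewrite mul1r.
by rewrite E hE gE invr1 mul1r.
Qed.

Lemma pk1_cont : continuous (pk (1 : R)).
Proof.
have -> : pk 1 = fun y => pk 1 (0 - y) :> R by apply/funext => y; rewrite /pk sub0r sqrrN.
exact: pk_cont.
Qed.

Lemma nd_centered_itv : nondecreasing_seq (fun n : nat => `[- n%:R, n%:R]%classic : set R).
Proof.
apply/nondecreasing_seqP => n; rewrite subsetEset => y /=; rewrite !in_itv/= -natr1 => /andP[h1 h2].
by apply/andP; split; lra.
Qed.

Lemma bigcup_centered_itv : \bigcup_n (`[- n%:R, n%:R]%classic : set R) = setT.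
Proof.
apply/seteqP; split => // y _; exists (Num.bound `|y|) => //=.
by rewrite in_itv/= -ler_norml; apply: ltW; exact: archi_boundP.
Qed.

Lemma pk1_intg : intg setT (pk (1 : R)).
Proof.
have pE y : pk 1 y = (1 + y ^+ 2)^-1 by rewrite /pk expr1n div1r.
have ub : forall n : nat, intg `[- n%:R, n%:R] (pk (1 : R)) /\ Int `[- n%:R, n%:R] (pk (1 : R)) <= pi.
  move=> n; split; first by apply: intg_itv; exact: pk1_cont.
  have n0 : 0 <= n%:R :> R by [].
  have -> : Int `[- n%:R, n%:R] (pk 1) = atan n%:R - atan (- n%:R) :> R.
    apply: Int_ftc; [lra|exact: pk1_cont|].
    by move=> y; rewrite pE; exact: is_derive1_atan.
  have := atan_ltpi2 (n%:R : R); have := atan_gtNpi2 (- n%:R : R); lra.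
have [//] := @intg_exhaust _ (fun n => `[- n%:R, n%:R]%classic) (pk 1) pi nd_centered_itv
  (fun n => measurable_itv_lebT _) bigcup_centered_itv (meas_cont pk1_cont)
  (fun x => ltW (pk_gt0 x ltr01)) (fun n => (ub n).1) (fun n => (ub n).2).
Qed.

Lemma pkE (H t : R) : 0 < H -> pk H t = H^-1 * pk 1 (0 + H^-1 * t).
Proof.
move=> H0; rewrite /pk add0r expr1n div1r.
have := pk_den t H0 => /lt0r_neq0 h; have := pk_den (H^-1 * t) ltr01 => /lt0r_neq0 h2.
rewrite expr1n in h2; field; rewrite gt_eqF// h.
Qed.

Lemma pk_intg (H x : R) : 0 < H -> intg setT (fun y => pk H (x - y)).
Proof.
move=> H0; have Hi : 0 < H^-1 by rewrite invr_gt0.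
have cpk : continuous (pk H).
  have -> : pk H = fun y => pk H (0 - y) by apply/funext => y; rewrite /pk sub0r sqrrN.
  exact: pk_cont.
have pi1 : intg setT (pk H).
  rewrite (_ : pk H = fun t => H^-1 * pk 1 (0 + H^-1 * t)); last by apply/funext => t; exact: pkE.
  by apply: intgZ => //; have [] := Int_affine 0 Hi pk1_cont pk1_intg.
by have [] := Int_reflect x cpk pi1.
Qed.

Definition rschwartz f := smooth f /\ forall j k, exists M, forall x, `|x| ^+ j * `|derive1n k f x| <= M.

Lemma rschwartz_derive1 f : rschwartz f -> rschwartz (derive1 f).
Proof.
move=> [sf fM]; split; first exact: smooth_derive1.
by move=> j k; have [M hM] := fM j k.+1; exists M => x; rewrite -derive1Sn.
Qed.

Lemma rschwartz_decay f : rschwartz f -> exists2 M, 0 <= M & forall x, (1 + x ^+ 2) ^+ 2 * `|f x| <= M.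
Proof.
move=> [sf fM]; have [M0 h0] := fM 0%N 0%N; have [M2 h2] := fM 2%N 0%N; have [M4 h4] := fM 4%N 0%N.
have H x : (1 + x ^+ 2) ^+ 2 * `|f x| <= M0 + 2 * M2 + M4.
  have := h0 x; have := h2 x; have := h4 x; rewrite /= expr0 mul1r.
  have -> : `|x| ^+ 4 = x ^+ 4 by rewrite (_ : 4 = 2 * 2)%N// exprM real_normK ?num_real// exprM.
  by rewrite real_normK ?num_real// => a b c; rewrite (_ : (1 + x ^+ 2) ^+ 2 = 1 + 2 * x ^+ 2 + x ^+ 4); [lra|ring].
exists (M0 + 2 * M2 + M4) => //; apply: le_trans (H 0).
by rewrite mulr_ge0// sqr_ge0.
Qed.

Lemma rschwartz_pk f : rschwartz f -> exists2 M, 0 <= M & forall x, `|f x| <= M * pk 1 x.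
Proof.
move=> /rschwartz_decay[M M0 hM]; exists M => // x.
have x2 := sqr_ge0 x; rewrite /pk expr1n mul1r ler_pdivlMr; last lra.
by apply: le_trans (hM x); rewrite mulrC ler_wpM2r//; nra.
Qed.

Lemma rschwartz_intg f : rschwartz f -> intg setT f.
Proof.
move=> sf; have [M M0 hM] := rschwartz_pk sf.
apply: (intg_le _ _ _ (intgZ M measurableT_lebT pk1_intg)) => //.
by apply: meas_cont; apply: smooth_cont; exact: sf.1.
Qed.

(** One integration by parts for each power of [x]. The bound is uniform in [al] because every step
    of the induction shifts the phase. *)
Lemma FT_decay L phi j : 0 <= L -> ctest L phi ->
  exists M, forall al x, `|x| ^+ j * `|FT al phi x| <= M.
Proof.
move=> L0; elim: j phi => [|j IH] phi cp.
  by exists (Int setT (fun e => `|phi e|)) => al x; rewrite mul1r; exact: FT_bound L0 cp.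
have [M hM] := IH _ (ctest_derive1 cp); exists M => al x.
rewrite exprSr -mulrA -normrM (FT_mulx al x L0 cp); exact: hM.
Qed.

Lemma FT_derive1n L phi al k : 0 <= L -> ctest L phi ->
  exists al' phi', ctest L phi' /\ derive1n k (FT al phi) = FT al' phi'.
Proof.
move=> L0; elim: k al phi => [|k IH] al phi cp; first by exists al, phi.
rewrite derive1Sn (derive1_eq (fun x => FT_is_derive al x L0 cp)).
exact: IH (ctestM cp smooth_id).
Qed.

Lemma smooth_FT L phi al : 0 <= L -> ctest L phi -> smooth (FT al phi).
Proof.
move=> L0 cp; apply: (@smooth_coind _ [set f | exists al phi, ctest L phi /\ f = FT al phi]); last by exists al, phi.
move=> _ [{cp}al [{}phi [cp ->]]]; exists (FT (al + pi / 2) (fun e => e * phi e)).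
  by exists (al + pi / 2), (fun e => e * phi e); split => //; exact: ctestM smooth_id.
by move=> x; exact: FT_is_derive L0 cp.
Qed.

Lemma FT_rschwartz L phi al : 0 <= L -> ctest L phi -> rschwartz (FT al phi).
Proof.
move=> L0 cp; split; first exact: smooth_FT L0 cp.
move=> j k; have [al' [phi' [cp' ->]]] := FT_derive1n al k L0 cp.
by have [M hM] := FT_decay j L0 cp'; exists M => x.
Qed.

(** The product-to-sum formula: multiplication by a cosine translates the spectrum by [y] and by
    [- y]. *)
Lemma FT_modulate L phi al b y x : 0 <= L -> ctest L phi ->
  cos (x * y + b) * FT al phi x =
  2^-1 * (FT (al + b) (fun e => phi (1 * e + (- y))) x + FT (al - b) (fun e => phi (1 * e + y)) x).
Proof.
move=> L0 cp; have [sp pL] := cp.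
have tr z c : Int setT (fun e => phi (1 * e + z) * cos (x * e + c)) =
    Int setT (fun e => phi e * cos (x * (e - z) + c)) /\ 
    intg setT (fun e => phi e * cos (x * (e - z) + c)).
  have cf : continuous (fun e => phi e * cos (x * (e - z) + c)).
    have -> : (fun e => phi e * cos (x * (e - z) + c)) = fun e => phi e * cos (x * e + (- x * z + c)).
      by apply/funext => e; congr (_ * cos _); ring.
    move=> e; apply: cvgM; first exact: smooth_cont.
    exact: (@cos_affine_cont _ x (- x * z + c) e).
  have fi : intg setT (fun e => phi e * cos (x * (e - z) + c)).
    by apply: (intg_supp L0) => // e /pL ->; rewrite mul0r.
  split => //; have [_] := Int_affine z ltr01 cf fi; rewrite invr1 mul1r => <-.
  by apply: eq_Int => e _; rewrite (addrC z) addrK mul1r.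
rewrite /FT; have [e1 i1] := tr (- y) (al + b); have [e2 i2] := tr y (al - b).
rewrite e1 e2 -IntD// -(IntZ 2^-1 measurableT_lebT (intgD measurableT_lebT i1 i2)).
rewrite -IntZ//; last exact: (FT_intg _ _ L0 cp).
apply: eq_Int => e _.
have -> : x * (e - - y) + (al + b) = (x * e + al) + (x * y + b) by ring.
have -> : x * (e - y) + (al - b) = (x * e + al) - (x * y + b) by ring.
move: (x * e + al) (x * y + b) => p q; rewrite cosD cosB.
by field.
Qed.

Lemma Int_derive_rschwartz f : rschwartz f -> Int setT (derive1 f) = 0.
Proof.
move=> rf; have rf' := rschwartz_derive1 rf; have [sf _] := rf; have [sf' _] := rf'.
have cf' := smooth_cont sf'.
pose I (n : nat) : set R := `[- n%:R, n%:R]%classic.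
have lim1 : Int setT (fun y => derive1 f y * \1_(I n) y) @[n --> \oo] --> Int setT (derive1 f).
  apply: (@Int_dct _ _ _ (fun y => `|derive1 f y|)).
  - move=> n; apply: measM; first exact: meas_cont.
    by apply: meas_indic; exact: measurable_itv_lebT.
  - exact: meas_cont.
  - apply: aeW => y; rewrite -[X in _ --> X]mulr1; apply: cvgM; first exact: cvg_cst.
    apply: (@cvg_trans _ ((fun=> 1 : R) @ \oo)); last exact: cvg_cst.
    apply: near_eq_cvg; near=> n; rewrite indicE mem_set// /I /= in_itv/= -ler_norml.
    have : (Num.bound `|y| <= n)%N by near: n; exact: nbhs_infty_ge.
    by rewrite -(ler_nat R) => h; apply: le_trans h; apply: ltW; exact: archi_boundP.
  - by move=> n y; rewrite normrM ler_piMr// indicE; case: (_ \in _); rewrite ?normr1 ?normr0.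
  - by apply: intg_norm => //; exact: rschwartz_intg.
have [M M0 hM] := rschwartz_pk rf.
have lim2 : Int setT (fun y => derive1 f y * \1_(I n) y) @[n --> \oo] --> (0 : R).
  have lim3 : 2 * M * harmonic n @[n --> \oo] --> (0 : R).
    by rewrite -[X in _ --> X](mulr0 (2 * M)); apply: cvgM; [exact: cvg_cst|exact: cvg_harmonic].
  apply: norm_cvg0; apply: (@squeeze_cvgr _ _ _ _ (fun=> 0) _ _ _ _ _ lim3); last exact: cvg_cst.
  near=> n; rewrite normr_ge0/= -Int_indic.
  have n0 : 0 <= n%:R :> R by [].
  have -> : Int (I n) (derive1 f) = f n%:R - f (- n%:R).
    by apply: Int_ftc; [lra|exact: cf'|move=> x; exact: smooth_is_derive].
  apply: (le_trans (ler_normB _ _)).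
  have hh y : `|y| = n%:R -> `|f y| <= M * harmonic n.
    move=> yn; apply: (le_trans (hM y)); rewrite ler_wpM2l// /pk /harmonic expr1n div1r.
    have y2 : y ^+ 2 = n%:R ^+ 2 by rewrite -yn real_normK// num_real.
    rewrite lef_pV2 ?posrE ?ltr0n//; last by rewrite ltr_wpDr ?sqr_ge0.
    rewrite y2 -natr1 addrC lerD2l -natrX ler_nat.
    by case: (n) => [//|m]; rewrite expnS expn1 leq_pmulr.
  have e : 2 * M * harmonic n = M * harmonic n + M * harmonic n by rewrite -mulrA mulr_natl mulr2n.
  by rewrite e; apply: lerD; apply: hh; rewrite ?normrN ger0_norm.
exact: (cvg_unique (@norm_hausdorff _ _) lim1 lim2).
Unshelve. all: by end_near.
Qed.

(** Functions psi(x) / x^n, with [psi] smooth and zero near 0, form a class closed under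
    differentiation; all of them vanish near 0. *)
Lemma smooth_vanish_div phi (d : R) : 0 < d -> smooth phi -> (forall x, `|x| < d -> phi x = 0) ->
  smooth (fun x => phi x * x^-1).
Proof.
move=> d0 sp p0; have cn : continuous (fun y : R => `|y|) by move=> y; exact: norm_continuous.
apply: (@smooth_coind _ [set f | exists psi n, [/\ smooth psi, forall x, `|x| < d -> psi x = 0 &
  f = fun x => psi x * x ^- n]]); last by exists phi, 1%N.
move=> _ [psi [n [spsi psi0 ->]]].
have dpsi0 x : `|x| < d -> derive1 psi x = 0.
  move=> xd; apply: is_derive_derive1; apply: (@is_derive_near _ _ (fun=> 0)).
  by near=> y; apply: psi0; near: y; exact: (cvgr_lt _ (cn x)).
exists (fun x => (x * derive1 psi x - n%:R * psi x) * x ^- n.+1).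
  exists (fun x => x * derive1 psi x - n%:R * psi x), n.+1; split; last by [].
    apply: smoothB; last by apply: smoothZ; exact: spsi.
    by apply: smoothM; [exact: smooth_id|exact: smooth_derive1 spsi].
  by move=> x xd; rewrite psi0// dpsi0// !mulr0 subrr.
move=> x; have [->|x0] := eqVneq x 0.
  rewrite psi0 ?normr0// dpsi0 ?normr0// !mulr0 subrr mul0r.
  apply: (@is_derive_near _ _ (fun=> 0)).
  have nd : \forall y \near (0 : R), `|y| < d by apply: (cvgr_lt _ (cn 0)); rewrite normr0.
  by apply: filterS nd => y yd; rewrite psi0 ?mul0r.
have xn0 : x ^+ n != 0 by rewrite expf_neq0.
have dX : is_derive x 1 (fun y : R => y ^+ n) (n%:R * x ^+ n.-1).
  have := @is_deriveX _ _ (@idfun R) n x 1 1 (is_derive_id x 1).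
  by rewrite exprfctE /= -[X in _ -> is_derive _ _ _ X]mulr1.
have D := is_deriveM_fun (smooth_is_derive x spsi) (@is_deriveV _ (fun y : R => y ^+ n) x _ 1 xn0 dX).
apply: (is_derive_val D).
rewrite -[_ *: _]/(_ * _); case: (n) => [|m] /=; first by field.
by rewrite !exprS; field; rewrite x0 expf_neq0.
Unshelve. all: by end_near.
Qed.

(** The integral of a transform is a multiple of phi(0). Here phi(e) = e z(e) with [z] smooth, so
    the transform is the derivative of a Schwartz function and its integral vanishes. *)
Lemma FT_mean0 L phi al (d : R) : 0 <= L -> 0 < d -> ctest L phi ->
  (forall x, `|x| < d -> phi x = 0) -> Int setT (FT al phi) = 0.
Proof.
move=> L0 d0 [sp pL] p0.
pose z x := phi x * x^-1.
have cz : ctest L z by split; [exact: smooth_vanish_div d0 sp p0|move=> x /pL h; rewrite /z h mul0r].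
have pz : phi = fun e => e * z e.
  apply/funext => e; rewrite /z; have [->|e0] := eqVneq e 0; first by rewrite mul0r p0 ?normr0.
  by rewrite mulrCA divff// mulr1.
have <- : derive1 (FT (al - pi / 2) z) = FT al phi.
  by rewrite (derive1_eq (fun x => FT_is_derive (al - pi / 2) x L0 cz)) subrK -pz.
apply: Int_derive_rschwartz; exact: FT_rschwartz L0 cz.
Qed.

End schwartz_functions.

(** * Fubini and the Fejer kernel *)

Section fubini.
Context {R : realType}.
Implicit Types (f g k phi : R -> R) (F : R -> R -> R) (x y al : R).

Definition meas2 F := measurable_fun (setT : set (lebT R * lebT R)) (fun p => F p.1 p.2).

Lemma meas2_fst f : meas f -> meas2 (fun x _ => f x).
Proof. by move=> mf; apply: (measurableT_comp mf); exact: measurable_fst. Qed.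

Lemma meas2_snd f : meas f -> meas2 (fun _ y => f y).
Proof. by move=> mf; apply: (measurableT_comp mf); exact: measurable_snd. Qed.

Lemma meas2M F G : meas2 F -> meas2 G -> meas2 (fun x y => F x y * G x y).
Proof. exact: measurable_funM. Qed.

Lemma meas_id : meas (@id R).
Proof. by apply: meas_cont => x; exact: cvg_id. Qed.

Lemma meas2_comp k F : continuous k -> meas2 F -> meas2 (fun x y => k (F x y)).
Proof.
move=> ck; apply: (@measurableT_comp _ _ _ _ (measurableTypeR R) _ k).
exact: continuous_measurable_fun.
Qed.

Lemma meas2_mul : meas2 (fun x y => x * y).
Proof. by apply: meas2M; [exact: meas2_fst meas_id|exact: meas2_snd meas_id]. Qed.

Lemma meas2_sub : meas2 (fun x y => x - y).
Proof. by apply: measurable_funB; [exact: meas2_fst meas_id|exact: meas2_snd meas_id]. Qed.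

Lemma EFin_IntT f : intg setT f -> (Int setT f)%:E = (\int[leb R]_x (f x)%:E)%E.
Proof. by move=> fi; rewrite EFin_Int. Qed.

(** Integrability of the second iterated integral is left as a premise; [Fubini_le] obtains it from
    the first conclusion with the variables exchanged. *)
Let fubini_aux F g1 g2 : meas2 F -> (forall x, 0 <= g1 x) -> (forall y, 0 <= g2 y) ->
  (forall x y, `|F x y| <= g1 x * g2 y) -> intg setT g1 -> intg setT g2 ->
  intg setT (fun x => Int setT (F x)) /\
  (intg setT (fun y => Int setT (F^~ y)) ->
  Int setT (fun x => Int setT (F x)) = Int setT (fun y => Int setT (F^~ y))).
Proof.
move=> mF g10 g20 Fg g1i g2i.
pose f (p : lebT R * lebT R) := (F p.1 p.2)%:E.
have mf : measurable_fun setT f by apply/measurable_EFinP.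
have mFx x : meas (F x) by exact: (measurableT_comp mF (pair1_measurable _)).
have mFy y : meas (F^~ y) by exact: (measurableT_comp mF (pair2_measurable _)).
have Fxi x : intg setT (F x).
  by apply: (intg_le _ _ _ (intgZ (g1 x) measurableT_lebT g2i)).
have Fyi y : intg setT (F^~ y).
  by apply: (intg_le _ _ _ (intgZ (g2 y) measurableT_lebT g1i)) => // x _; rewrite mulrC.
have fi : (leb R \x leb R)%E.-integrable setT f.
  apply/integrable12ltyP => //.
  apply: (@le_lt_trans _ _ (\int[leb R]_x (g1 x * Int setT g2)%:E)%E).
    apply: ge0_le_integral.
    - exact: measurableT_lebT.
    - by move=> x _; apply: integral_ge0 => y _; exact: abse_ge0.
    - apply: (@measurable_fun_fubini_tonelli_F _ _ _ _ _ (leb R) (abse \o f)).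
        by apply: measurableT_comp.
      by move=> z; exact: abse_ge0.
    - apply/measurable_EFinP; apply: measM; last exact: meas_cst.
      by apply/measurable_EFinP; exact: measurable_int g1i.
    - move=> x _; rewrite -(IntZ (g1 x) measurableT_lebT g2i) EFin_IntT; last exact: intgZ.
      apply: ge0_le_integral.
      + exact: measurableT_lebT.
      + by move=> y _; exact: abse_ge0.
      + by apply/measurable_EFinP; apply: meas_norm; exact: mFx.
      + apply/measurable_EFinP; apply: measM; first exact: meas_cst.
        by apply/measurable_EFinP; exact: measurable_int g2i.
      + by move=> y _; rewrite /f/= lee_fin.
  have gi : intg setT (fun x => g1 x * Int setT g2).
    rewrite (_ : (fun _ => _) = fun x => Int setT g2 * g1 x); first exact: intgZ.
    by apply/funext => x; rewrite mulrC.
  by rewrite -EFin_IntT// ltry.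
have FE : fubini_F (leb R) f = EFin \o (fun x => Int setT (F x)).
  by apply/funext => x; rewrite /fubini_F /= EFin_IntT.
have GE : fubini_G (leb R) f = EFin \o (fun y => Int setT (F^~ y)).
  by apply/funext => y; rewrite /fubini_G /= EFin_IntT.
have iF := integrable_fubini_F fi.
rewrite FE in iF; split; first exact: iF.
move=> iG; apply: EFin_inj; have := Fubini fi.
rewrite -/(fubini_F (leb R) f) -/(fubini_G (leb R) f) FE GE => h.
exact: etrans (EFin_IntT iF) (etrans h (esym (EFin_IntT iG))).
Qed.
Lemma meas2_swap F : meas2 F -> meas2 (fun x y => F y x).
Proof. by move=> mF; exact: (measurableT_comp mF (@measurable_swap _ _ (lebT R) (lebT R))). Qed.

Lemma Fubini_le F g1 g2 : meas2 F -> (forall x, 0 <= g1 x) -> (forall y, 0 <= g2 y) ->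
  (forall x y, `|F x y| <= g1 x * g2 y) -> intg setT g1 -> intg setT g2 ->
  intg setT (fun x => Int setT (F x)) /\
  Int setT (fun x => Int setT (F x)) = Int setT (fun y => Int setT (F^~ y)).
Proof.
move=> mF g10 g20 Fg g1i g2i; have [iF h] := fubini_aux mF g10 g20 Fg g1i g2i.
split; first exact: iF.
have Fg' y x : `|F x y| <= g2 y * g1 x by rewrite mulrC.
by apply: h; have [iG _] := fubini_aux (meas2_swap mF) g20 g10 Fg' g2i g1i; exact: iG.
Qed.

Lemma intg_mul_cos f al x : meas f -> intg setT f -> intg setT (fun y => f y * cos (x * y + al)).
Proof.
move=> mf fi; apply: (intg_le measurableT_lebT _ _ (intg_norm measurableT_lebT fi)).
  by apply: (measM mf); apply: meas_cont; exact: cos_affine_cont.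
by move=> y _; rewrite normrM ler_piMr ?normr_ge0// ler_norml cos_geN1 cos_le1.
Qed.

(** The multiplication formula for the cosine transform: both sides are the double integral of f(x)
    g(y) cos(x y + al). *)
Lemma FT_mult f g al : meas f -> meas g -> intg setT f -> intg setT g ->
  intg setT (fun x => f x * FT al g x) /\
  Int setT (fun x => f x * FT al g x) = Int setT (fun y => g y * FT al f y).
Proof.
move=> mf mg fi gi; pose F x y := f x * (g y * cos (x * y + al)).
have cc : continuous (fun t : R => cos (t + al)).
  by move=> t; have := @cos_affine_cont _ 1 al t; under eq_fun do rewrite mul1r.
have mF : meas2 F.
  apply: meas2M; first exact: meas2_fst.
  apply: meas2M; first exact: meas2_snd.
  exact: (meas2_comp cc meas2_mul).
have F1 x y : `|F x y| <= `|f x| * `|g y|.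
  by rewrite /F !normrM ler_wpM2l// ler_piMr// ler_norml cos_geN1 cos_le1.
have [i1 e1] := Fubini_le mF (fun x => normr_ge0 (f x)) (fun y => normr_ge0 (g y)) F1 (intg_norm measurableT_lebT fi) (intg_norm measurableT_lebT gi).
have E1 x : Int setT (F x) = f x * FT al g x.
  exact: (IntZ (f x) measurableT_lebT (intg_mul_cos al x mg gi)).
have E2 y : Int setT (F^~ y) = g y * FT al f y.
  rewrite -(IntZ (g y) measurableT_lebT (intg_mul_cos al y mf fi)).
  by apply: eq_Int => x _; rewrite /F mulrCA (mulrC x).
by split; [rewrite -(funext E1); exact: i1|rewrite -(funext E1) -(funext E2); exact: e1].
Qed.

End fubini.

(** * The Fejer kernel *)

Section fejer.
Context {R : realType}.
Implicit Types (f g k phi theta : R -> R) (x y al L : R).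

Definition tent L : R -> R := fun x => Num.max 0 (1 - `|x| / L).

Lemma tent_cont L : continuous (tent L).
Proof.
move=> x; apply: (@continuous_max _ _ (fun=> 0 : R) (fun x : R => 1 - `|x| / L)); first exact: cvg_cst.
apply: cvgB; first exact: cvg_cst.
by apply: cvgM; [exact: norm_continuous|exact: cvg_cst].
Qed.

Lemma tent_bound L x : 0 < L -> 0 <= tent L x <= 1.
Proof.
move=> L0; rewrite /tent le_max lexx/= ge_max ler01/= gerBl.
by rewrite divr_ge0 ?normr_ge0 ?ltW.
Qed.

Lemma tent_supp L : 0 < L -> supp L (tent L).
Proof.
move=> L0 x xL; rewrite /tent; apply/max_idPl.
by rewrite subr_le0 ler_pdivlMr// mul1r ltW.
Qed.

Lemma tentE L x : 0 < L -> `|x| <= L -> tent L x = 1 - `|x| / L.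
Proof.
by move=> L0 xL; rewrite /tent; apply/max_idPr; rewrite subr_ge0 ler_pdivrMr// mul1r.
Qed.

(** The tent is affine on each side of 0, where the primitive of (c x + 1) cos(y x) is explicit. *)
Lemma fejer L y : 0 < L -> y != 0 ->
  FT 0 (tent L) y = 2 * (1 - cos (L * y)) / (L * y ^+ 2).
Proof.
move=> L0 y0; have L0' := ltW L0; have Ln0 : L != 0 by rewrite gt_eqF.
have cc : continuous (fun e => tent L e * cos (y * e + 0)).
  by move=> e; apply: cvgM; [exact: tent_cont|exact: cos_affine_cont].
have sL : supp L (fun e => tent L e * cos (y * e + 0)).
  by move=> e eL; rewrite tent_supp ?mul0r.
have der (c x : R) : is_derive x 1
    (fun t => (c * t + 1) * (y^-1 * sin (y * t + 0)) + c * (y ^- 2 * cos (y * t + 0)))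
    ((c * x + 1) * cos (y * x + 0)).
  have d1 := @is_derive_affine _ id 1 c 1 x (is_derive_id _ _).
  have d2 := is_deriveZ_fun y^-1 (is_derive_affine (is_derive_sin (y * x + 0))).
  have d3 := is_deriveZ_fun c (is_deriveZ_fun (y ^- 2) (is_derive_affine (is_derive_cos (y * x + 0)))).
  apply: (is_derive_val (is_deriveD_fun (is_deriveM_fun d1 d2) d3)).
  by move: (sin _) (cos _) => p q; field.
have half (c a b : R) : a <= b -> Int `[a, b] (fun x => (c * x + 1) * cos (y * x + 0)) =
   ((c * b + 1) * (y^-1 * sin (y * b + 0)) + c * (y ^- 2 * cos (y * b + 0))) -
   ((c * a + 1) * (y^-1 * sin (y * a + 0)) + c * (y ^- 2 * cos (y * a + 0))).
  move=> ab; apply: (Int_ftc ab _ (der c)) => x.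
  apply: cvgM; last exact: cos_affine_cont.
  by apply: cvgD; [apply: cvgM; [exact: cvg_cst|exact: cvg_id]|exact: cvg_cst].
rewrite /FT (Int_supp L0' sL) (@Int_cat _ _ 0)//; [|lra].
have -> : Int `[- L, 0] (fun e => tent L e * cos (y * e + 0)) =
    Int `[- L, 0] (fun x => (L^-1 * x + 1) * cos (y * x + 0)).
  apply: eq_Int => x /=; rewrite in_itv/= => /andP[x1 x2]; congr (_ * _).
  rewrite tentE//; rewrite ler0_norm//; [|lra].
  by field.
have -> : Int `[0, L] (fun e => tent L e * cos (y * e + 0)) =
    Int `[0, L] (fun x => (- L^-1 * x + 1) * cos (y * x + 0)).
  apply: eq_Int => x /=; rewrite in_itv/= => /andP[x1 x2]; congr (_ * _).
  by rewrite tentE//; rewrite ger0_norm//; field.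
rewrite !half//; last lra.
rewrite !addr0 !mulr0 sin0 cos0 !mulrN sinN cosN (mulrC y L).
move: (sin _) (cos _) => p q; field.
by rewrite y0.
Qed.

(** On this range L y lies in [1/2, 1], so 1 - cos(L y) >= 1 - cos(1/2) and (L y)^2 <= 1. The range
    has length 1 / (2 L), hence carries a mass of at least 1 - cos(1/2) whatever [L] is. *)
Lemma fejer_ge L y : 0 < L -> (2 * L)^-1 <= y -> y <= L^-1 ->
  2 * L * (1 - cos (2^-1)) <= FT 0 (tent L) y.
Proof.
move=> L0 y1 y2; have L2 : 0 < 2 * L by rewrite mulr_gt0.
have y0 : 0 < y by apply: lt_le_trans y1; rewrite invr_gt0.
have t1 : 2^-1 <= L * y.
  by rewrite -(ler_pM2l L0) in y1; rewrite (le_trans _ y1)// invfM mulrCA divff ?gt_eqF// mulr1.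
have t2 : L * y <= 1 by rewrite -(ler_pM2l L0) divff ?gt_eqF// in y2.
rewrite fejer ?gt_eqF//; have p2 := pi_ge2 R.
have c1 : cos (L * y) <= cos (2^-1).
  move: t1; rewrite le_eqVlt => /predU1P[<-//|t1].
  by apply/ltW; rewrite ltr_cos// in_itv/=; apply/andP; split; lra.
have -> : 2 * (1 - cos (L * y)) / (L * y ^+ 2) = 2 * L * ((1 - cos (L * y)) / (L * y) ^+ 2).
  by field; rewrite !gt_eqF.
rewrite (ler_wpM2l (ltW L2))// ler_pdivlMr ?exprn_gt0 ?mulr_gt0//.
have c2 : cos (2^-1 : R) <= 1 by exact: cos_le1.
have : (L * y) ^+ 2 <= 1 by rewrite expr_le1// mulr_ge0 ?ltW.
have : 0 <= (L * y) ^+ 2 by exact: sqr_ge0.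
by move: ((L * y) ^+ 2) (cos (L * y)) (cos _) c1 c2 => a b c; nra.
Qed.

Lemma fejer_ge0 L y : 0 < L -> 0 <= FT 0 (tent L) y.
Proof.
move=> L0; have [->|y0] := eqVneq y 0.
  apply: Int_ge0 => x _; rewrite mul0r addr0 cos0 mulr1.
  by have /andP[] := tent_bound x L0.
rewrite (fejer L0 y0); apply: divr_ge0; first by rewrite mulr_ge0// subr_ge0 cos_le1.
by rewrite mulr_ge0 ?sqr_ge0// ltW.
Qed.

(* Fejer means: the integral of the transform is the limit of the pairings of
   [theta] with the nonnegative Fejer kernels, which are bounded below by their
   mass near the origin, where [theta = 1]. *)
Lemma FT_integral_gt0 theta : smooth theta -> (forall x, 0 <= theta x <= 1) ->
  (forall x, `|x| <= 2^-1 -> theta x = 1) -> (forall x, 1 <= `|x| -> theta x = 0) ->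
  0 < Int setT (FT 0 theta).
Proof.
move=> st t01 t1 t0.
have ct : ctest 1 theta by split => // x x1; apply: t0; exact: ltW.
have rt : rschwartz (FT 0 theta) := FT_rschwartz 0 ler01 ct.
have mF : meas (FT 0 theta) := meas_cont (smooth_cont rt.1).
(* L >= 2 keeps the interval [1 / (2 L), 1 / L] within [0, 1/2], where [theta] is 1. *)
pose L (n : nat) : R := 2 * n.+1%:R.
have L0 n : 0 < L n by rewrite mulr_gt0.
have lim1 : Int setT (fun x => tent (L n) x * FT 0 theta x) @[n --> \oo] --> Int setT (FT 0 theta).
  apply: (@Int_dct _ _ _ (fun x => `|FT 0 theta x|)).
  - by move=> n; apply: (measM _ mF); exact: meas_cont (@tent_cont (L n)).
  - exact: mF.
  - apply: aeW => x; rewrite -[X in _ --> X]mul1r; apply: cvgM; last exact: cvg_cst.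
    have h : 1 - `|x| * (2^-1 * harmonic n) @[n --> \oo] --> (1 : R).
      rewrite -[X in _ --> X]subr0; apply: cvgB; first exact: cvg_cst.
      rewrite -[X in _ --> X](mulr0 `|x|); apply: cvgM; first exact: cvg_cst.
      by rewrite -[X in _ --> X](mulr0 2^-1); apply: cvgM; [exact: cvg_cst|exact: cvg_harmonic].
    apply: cvg_trans h; apply: near_eq_cvg; near=> n.
    have : (Num.bound `|x| <= n)%N by near: n; exact: nbhs_infty_ge.
    rewrite -(ler_nat R) => h; have := archi_boundP (normr_ge0 x) => h2.
    rewrite tentE//; first by rewrite /L invfM.
    by rewrite /L -natr1; have n0 : 0 <= n%:R :> R by []; lra.
  - move=> n x; rewrite normrM ler_piMl ?normr_ge0// ger0_norm; have /andP[]// := tent_bound x (L0 n).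
  - by apply: intg_norm => //; exact: rschwartz_intg.
have c0 : 0 < 1 - cos (2^-1) :> R.
  rewrite subr_gt0 -[ltRHS]cos0 ltr_cos ?in_itv/= ?invr_gt0//; have p2 := pi_ge2 R; first by lra.
  by apply/andP; split; lra.
have low n : 1 - cos (2^-1) <= Int setT (fun x => tent (L n) x * FT 0 theta x).
  have Ln := ltW (L0 n).
  have mt := meas_cont (@tent_cont (L n)); have mth := meas_cont (smooth_cont st).
  have it : intg setT (tent (L n)) := intg_supp Ln (@tent_cont (L n)) (tent_supp (L0 n)).
  have ith : intg setT theta := intg_supp ler01 (smooth_cont st) ct.2.
  have [iF <-] := FT_mult 0 mth mt ith it.
  have ab : (2 * L n)^-1 <= (L n)^-1.
    by rewrite lef_pV2 ?posrE ?mulr_gt0//; have := L0 n; lra.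
  have sub := Int_subset (measurable_itv_lebT `[(2 * L n)^-1, (L n)^-1]) measurableT_lebT (@subsetT _ _) iF.
  apply: le_trans (sub _); last first.
    by move=> x _; rewrite mulr_ge0 ?fejer_ge0//; have /andP[] := t01 x.
  have -> : 1 - cos (2^-1) = Int `[(2 * L n)^-1, (L n)^-1] (fun=> 2 * L n * (1 - cos (2^-1))).
    by rewrite (Int_cst _ ab); field; rewrite gt_eqF.
  apply: le_Int.
  - exact: measurable_itv_lebT.
  - by apply: intg_itv => x; exact: cvg_cst.
  - exact: (intgS (measurable_itv_lebT _) measurableT_lebT (@subsetT _ _) iF).
  move=> x; rewrite /= in_itv/= => /andP[x1 x2]; rewrite t1 ?mul1r; first exact: fejer_ge.
  have x0 : 0 <= x by apply: le_trans x1; rewrite invr_ge0 mulr_ge0.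
  rewrite ger0_norm// (le_trans x2)// lef_pV2 ?posrE// /L -natr1.
  by have n0 : 0 <= n%:R :> R by []; lra.
apply: (lt_le_trans c0); rewrite -(cvg_lim _ lim1)//.
apply: limr_ge; first by apply/cvg_ex; exists (Int setT (FT 0 theta)).
by near=> n; exact: low.
Unshelve. all: by end_near.
Qed.

End fejer.

(** * Jackson's inequality *)

Section convolution.
Context {R : realType} (X : banach_lattice R).
Implicit Types (u v w q : R -> R) (c h x y t : R) (n s i : nat).
Local Notation rcar := (rcar X).
Local Notation rn := (rn X).
Local Notation nice := (nice X).
Context (C : R) (PC : poisson_bounded X C).

Let C0 : 0 < C. Proof. by case: PC. Qed.

Variables (H M : R) (V : R -> R).
Hypotheses (H0 : 0 < H) (M0 : 0 <= M) (cV : continuous V).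
(** Decay beyond the Poisson kernel: the extra factor absorbs the growth in [t] of the bound that
    [pois_itv] gives for u x - u (x - t). *)
Hypothesis V_le : forall t, (1 + (t / H) ^+ 2) * `|V t| <= M * pk H t.
Hypothesis V1 : Int setT V = 1.

Definition conv u : R -> R := fun x => Int setT (fun y => V (x - y) * u y).

Let V_pk t : `|V t| <= M * pk H t.
Proof.
apply: le_trans (V_le t); rewrite -[leLHS]mul1r ler_wpM2r ?normr_ge0//.
by rewrite lerDl sqr_ge0.
Qed.

Let pkH_intg : intg setT (pk H).
Proof.
by have := pk_intg 0 H0; congr intg; apply/funext => y; rewrite /pk sub0r sqrrN.
Qed.

Let Int_pkH : Int setT (pk H) = Int setT (pk (1 : R)).
Proof.
have Hi : 0 < H^-1 by rewrite invr_gt0.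
have i1 := @pk1_intg R; have [i2 e2] := Int_affine 0 Hi (@pk1_cont R) i1.
rewrite (_ : pk H = fun t => H^-1 * pk 1 (0 + H^-1 * t)); last by apply/funext => t; exact: pkE.
by rewrite (IntZ _ measurableT_lebT i2) e2 invrK mulrA mulVf ?mul1r// gt_eqF.
Qed.

Let P : R := Int setT (pk (1 : R)).

Let P0 : 0 <= P. Proof. by apply: Int_ge0 => t _; apply/ltW/pk_gt0. Qed.

Let V_intg : intg setT V.
Proof.
apply: (intg_le measurableT_lebT (meas_cont cV) _ (intgZ M measurableT_lebT pkH_intg)) => t _.
exact: V_pk.
Qed.

Let Int_normV : Int setT (fun t => `|V t|) <= M * P.
Proof.
rewrite /P -Int_pkH -(IntZ M measurableT_lebT pkH_intg).
apply: (le_Int measurableT_lebT (intg_norm measurableT_lebT V_intg) (intgZ M measurableT_lebT pkH_intg)) => t _.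
exact: V_pk.
Qed.

Let bounded_intg u (B : R) x : continuous u -> (forall y, `|u y| <= B) ->
  intg setT (fun t => V t * u (x - t)).
Proof.
move=> cu uB; apply: (intg_le measurableT_lebT _ _ (intgZ B measurableT_lebT (intg_norm measurableT_lebT V_intg))).
  apply: (measM (meas_cont cV)); apply: meas_cont => t.
  apply: (@continuous_comp _ _ _ (fun t : R => x - t) u); last exact: cu.
  by apply: cvgB; [exact: cvg_cst|exact: cvg_id].
by move=> t _; rewrite normrM mulrC ler_wpM2r.
Qed.

Lemma conv_shift u (B : R) x : continuous u -> (forall y, `|u y| <= B) ->
  conv u x = Int setT (fun t => V t * u (x - t)).
Proof.
move=> cu uB; have ci : continuous (fun t => V t * u (x - t)).
  move=> t; apply: cvgM; first exact: cV.
  apply: (@continuous_comp _ _ _ (fun t : R => x - t) u); last exact: cu.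
  by apply: cvgB; [exact: cvg_cst|exact: cvg_id].
have [_ <-] := Int_reflect x ci (bounded_intg x cu uB).
by apply: eq_Int => y _; rewrite subKr.
Qed.

Lemma conv_bound u (B : R) x : continuous u -> (forall y, `|u y| <= B) ->
  `|conv u x| <= B * (M * P).
Proof.
move=> cu uB; have B0 : 0 <= B := le_trans (normr_ge0 _) (uB 0).
rewrite (conv_shift x cu uB).
apply: (@le_trans _ _ (Int setT (fun t => B * `|V t|))).
  apply: norm_Int_le.
  - exact: measurableT_lebT.
  - by have /measurable_int/measurable_EFinP := bounded_intg x cu uB.
  - exact: (intgZ B measurableT_lebT (intg_norm measurableT_lebT V_intg)).
  by move=> t _; rewrite normrM mulrC ler_wpM2r.
rewrite (IntZ B measurableT_lebT (intg_norm measurableT_lebT V_intg)).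
exact: ler_wpM2l.
Qed.

Lemma convD u v x : rcar u -> rcar v -> conv (fun y => u y + v y) x = conv u x + conv v x.
Proof.
move=> uX vX; rewrite /conv.
have [i1 _] := pois_conv PC x H0 uX cV V_pk; have [i2 _] := pois_conv PC x H0 vX cV V_pk.
by rewrite -(IntD measurableT_lebT i1 i2); apply: eq_Int => y _; rewrite mulrDr.
Qed.

Lemma conv_is_derive u x : nice u -> is_derive x 1 (conv u) (conv (derive1 u) x).
Proof.
move=> nu; have [su un] := nu.
have [_ [B0 hB0]] := un 0%N; have [_ [B1 hB1]] := un 1%N; have [_ [B2 hB2]] := un 2%N.
have cu := smooth_cont su; have cu' := smooth_cont (smooth_derive1 su).
apply: (@is_derive_quad _ _ _ _ (B2 * (M * P)) 1 ltr01) => s _.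
rewrite (conv_shift _ cu hB0) (conv_shift x cu hB0) (conv_shift x cu' hB1).
have ia := bounded_intg (x + s) cu hB0; have ib := bounded_intg x cu hB0.
have ic := intgZ s measurableT_lebT (bounded_intg x cu' hB1).
rewrite (mulrC _ s) -(IntZ s measurableT_lebT (bounded_intg x cu' hB1)).
rewrite -(IntB measurableT_lebT ia ib) -(IntB measurableT_lebT (intgB measurableT_lebT ia ib) ic).
have ig := intgZ (B2 * s ^+ 2) measurableT_lebT (intg_norm measurableT_lebT V_intg).
have B20 : 0 <= B2 * s ^+ 2 by rewrite mulr_ge0 ?sqr_ge0// (le_trans _ (hB2 0))// normr_ge0.
apply: (@le_trans _ _ (Int setT (fun t => B2 * s ^+ 2 * `|V t|))); last first.
  rewrite (IntZ _ measurableT_lebT (intg_norm measurableT_lebT V_intg)).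
  apply: (le_trans (ler_wpM2l B20 Int_normV)).
  by rewrite mulrAC.
apply: (norm_Int_le measurableT_lebT _ ig).
  by have /measurable_int/measurable_EFinP := intgB measurableT_lebT (intgB measurableT_lebT ia ib) ic.
move=> t _.
have -> : V t * u (x + s - t) - V t * u (x - t) - s * (V t * derive1 u (x - t)) =
  V t * (u ((x - t) + s) - u (x - t) - derive1 u (x - t) * s).
  by rewrite (_ : x + s - t = x - t + s); [ring|ring].
rewrite normrM mulrC ler_wpM2r ?normr_ge0//.
by apply: taylor2 => // y _; exact: hB2.
Qed.

Lemma conv_smooth u : nice u -> smooth (conv u).
Proof.
move=> nu; apply: (@smooth_coind _ [set f | exists2 u, nice u & f = conv u]); last by exists u.
move=> _ [{nu}u nu ->]; exists (conv (derive1 u)); first by exists (derive1 u) => //; exact: nice_derive1.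
by move=> x; exact: conv_is_derive.
Qed.

Lemma derive1n_conv n u : nice u -> derive1n n (conv u) = conv (derive1n n u).
Proof.
elim: n u => [//|n IH] u nu; rewrite !derive1Sn -(IH _ (nice_derive1 nu)); congr derive1n.
by apply: derive1_eq => x; exact: conv_is_derive.
Qed.

Lemma conv_X u : nice u -> rcar (conv u) /\ rn (conv u) <= M * C * rn u.
Proof.
move=> nu; apply: (pois_X PC H0 (nice_rcar nu) M0).
  exact: meas_cont (smooth_cont (conv_smooth nu)).
by move=> x; have [] := pois_conv PC x H0 (nice_rcar nu) cV V_pk.
Qed.

Lemma nice_conv u : nice u -> nice (conv u).
Proof.
move=> nu; split; first exact: conv_smooth.
move=> n; rewrite derive1n_conv//; have nun := nice_derive1n n nu.
split; first by have [] := conv_X nun.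
have [sn /(_ 0%N)[_ [B hB]]] := nun.
by exists (B * (M * P)) => x; apply: conv_bound => //; exact: smooth_cont.
Qed.

(** As V has integral 1, the error is the integral of V(t) (u(x) - u(x - t)); this difference is at
    most the integral of |u'| over an interval of length |t|, hence at most (1 + (t / H)^2) H times
    the majorant of u'. *)
Lemma conv_error u x : nice u ->
  `|u x - conv u x| <= M * P * H * pois H (derive1 u) x.
Proof.
move=> nu; have [su un] := nu; have [_ [B hB]] := un 0%N; have cu := smooth_cont su.
have u'X := nice_rcar (nice_derive1 nu).
have ib := bounded_intg x cu hB; have ia := intgZ (u x) measurableT_lebT V_intg.
rewrite (conv_shift x cu hB) -[X in `|X - _|]mulr1 -V1 -(IntZ (u x) measurableT_lebT V_intg).
rewrite -(IntB measurableT_lebT ia ib).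
have ig := intgZ (M * H * pois H (derive1 u) x) measurableT_lebT pkH_intg.
have -> : M * P * H * pois H (derive1 u) x = Int setT (fun t => M * H * pois H (derive1 u) x * pk H t).
  by rewrite (IntZ _ measurableT_lebT pkH_intg) Int_pkH -/P; ring.
apply: (norm_Int_le measurableT_lebT _ ig).
  by have /measurable_int/measurable_EFinP := intgB measurableT_lebT ia ib.
move=> t _; rewrite (mulrC (u x)) -mulrBr normrM.
have D : `|u x - u (x - t)| <= (1 + (t / H) ^+ 2) * H * pois H (derive1 u) x.
  have tH : `|t| / H * H = `|t| by rewrite divfK// gt_eqF.
  have e : (1 + (t / H) ^+ 2) = 1 + (`|t| / H) ^+ 2.
    by rewrite !expr_div_n real_normK ?num_real.
  have c0 : 0 <= `|t| / H by rewrite divr_ge0// ltW.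
  rewrite e; have [t0|t0] := leP 0 t.
    have xt : x - t <= x by rewrite gerBl.
    apply: (le_trans (smooth_diff_le su xt)); apply: (pois_itv PC H0 u'X c0); rewrite tH ger0_norm//.
    by rewrite lerDl.
  have xt : x <= x - t by rewrite lerDl oppr_ge0 ltW.
  rewrite distrC; apply: (le_trans (smooth_diff_le su xt)).
  by apply: (pois_itv PC H0 u'X c0); rewrite tH ltr0_norm// opprK gerDl ltW.
apply: (le_trans (ler_wpM2l (normr_ge0 _) D)).
have p0 : 0 <= H * pois H (derive1 u) x by rewrite mulr_ge0 ?pois_ge0// ltW.
have -> : `|V t| * ((1 + (t / H) ^+ 2) * H * pois H (derive1 u) x) =
  (1 + (t / H) ^+ 2) * `|V t| * (H * pois H (derive1 u) x) by ring.
apply: (le_trans (ler_wpM2r p0 (V_le t))).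
by rewrite le_eqVlt; apply/orP; left; apply/eqP; ring.
Qed.

Let D u : R -> R := fun x => u x - conv u x.

Let nice_D u : nice u -> nice (D u).
Proof. by move=> nu; apply: niceB => //; exact: nice_conv. Qed.

Let D_rn u : nice u -> rn (D u) <= M * P * H * C * rn (derive1 u).
Proof.
move=> nu; have [] // := @pois_X _ _ _ PC H (derive1 u) (D u) (M * P * H) H0.
- exact: nice_rcar (nice_derive1 nu).
- by rewrite !mulr_ge0// ltW.
- exact: meas_cont (nice_cont (nice_D nu)).
- by move=> x; exact: conv_error.
Qed.

Let derive1n_D n u : nice u -> derive1n n (D u) = D (derive1n n u).
Proof.
move=> nu; rewrite /D derive1nB; [|exact: nice_smooth nu|exact: conv_smooth].
by rewrite derive1n_conv.
Qed.

(* With [D u = u - V * u], the approximation is [F - D ^ s F = V * q]. *)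
Lemma jackson s F : nice F -> exists q, [/\ nice q,
  rn (fun x => F x - conv q x) <= (M * P * C * H) ^+ s * rn (derive1n s F) &
  rn (derive1n s (conv q)) <= (1 + (1 + M * C) ^+ s) * rn (derive1n s F)].
Proof.
move=> nF.
have nDi i u : nice u -> nice (iter i D u).
  by move=> nu; elim: i => [//|i IH]; rewrite iterS; exact: nice_D.
have d1 i u : nice u -> rn (iter i D u) <= (M * P * C * H) ^+ i * rn (derive1n i u).
  elim: i u => [|i IH] u nu; first by rewrite expr0 mul1r.
  rewrite iterSr; apply: (le_trans (IH _ (nice_D nu))).
  have b0 : 0 <= M * P * C * H by rewrite !mulr_ge0// ltW.
  rewrite exprSr -[leRHS]mulrA; apply: (ler_wpM2l (exprn_ge0 i b0)).
  rewrite (derive1n_D i nu) derive1nS; apply: (le_trans (D_rn (nice_derive1n i nu))).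
  by rewrite le_eqVlt; apply/orP; left; apply/eqP; ring.
have d2 i u : nice u -> rn (iter i D u) <= (1 + M * C) ^+ i * rn u.
  move=> nu; elim: i => [|i IH]; first by rewrite expr0 mul1r.
  have nDiu := nDi i u nu; have [cX cle] := conv_X nDiu.
  rewrite iterS; apply: (le_trans (rnB (nice_rcar nDiu) cX)).
  apply: (@le_trans _ _ ((1 + M * C) * rn (iter i D u))); first by rewrite mulrDl mul1r lerD2l.
  by rewrite exprS -[leRHS]mulrA; apply: ler_wpM2l => //; rewrite addr_ge0 ?mulr_ge0// ltW.
have d3 i n u : nice u -> derive1n n (iter i D u) = iter i D (derive1n n u).
  by move=> nu; elim: i => [//|i IH]; rewrite !iterS (derive1n_D n (nDi i u nu)) IH.
have n0 : nice (fun=> 0).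
  by have := niceB nF nF; congr nice; apply/funext => x; rewrite subrr.
(* [q] is the sum of the iterates D^i F over i < s. *)
have [q nq qE] : exists2 q, nice q & forall x, F x - conv q x = iter s D F x.
  elim: s => [|i [q nq qE]].
    exists (fun=> 0) => // x; rewrite /conv (_ : (fun y => _) = fun=> 0 * 0); last first.
      by apply/funext => y; rewrite !mulr0.
    rewrite (IntZ 0 measurableT_lebT); first by rewrite mul0r subr0.
    by have := intgZ 0 measurableT_lebT V_intg; congr intg; apply/funext => y; rewrite mul0r.
  exists (fun x => q x + iter i D F x); first by apply: niceD => //; exact: nDi.
  move=> x; rewrite convD; [|exact: nice_rcar nq|exact: nice_rcar (nDi i F nF)].
  by rewrite opprD addrA qE.
have E : conv q = fun x => F x - iter s D F x.
  by apply/funext => x; rewrite -qE subKr.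
exists q; split => //; first by rewrite (funext qE); exact: d1.
rewrite E derive1nB; [|exact: nice_smooth nF|exact: nice_smooth (nDi s F nF)].
rewrite d3//; have nFs := nice_derive1n s nF.
apply: (le_trans (rnB (nice_rcar nFs) (nice_rcar (nDi s _ nFs)))).
by rewrite mulrDl mul1r lerD2l; exact: d2.
Qed.

End convolution.

(** * Kernels with compactly supported transform *)

Section reproducing_kernel.
Context {R : realType}.
Implicit Types (f g q u phi : R -> R) (s t x y e al L : R).

Definition cutoff (theta : R -> R) := [/\ smooth theta, forall x, 0 <= theta x <= 1,
  forall x, theta (- x) = theta x, forall x, `|x| <= 2^-1 -> theta x = 1 &
  forall x, 1 <= `|x| -> theta x = 0].

Variables (theta : R -> R) (ctheta : cutoff theta).

(** The normalising constant of the kernels below. Fourier inversion would give 2 pi; its positivity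
    comes from Fejer means. *)
Definition kap : R := Int setT (FT 0 theta).
Definition dil s : R -> R := fun e => theta (s^-1 * e + 0).
(* A kernel of de la Vallee-Poussin type: its transform is 1 on [[- s / 2, s / 2]]
   and 0 off [[- s, s]]. *)
Definition vp s : R -> R := fun t => kap^-1 * FT 0 (dil s) t.

Let ct1 : ctest 1 theta.
Proof. by have [st _ _ _ t0] := ctheta; split => // x x1; apply: t0; exact: ltW. Qed.

Let rFT : rschwartz (FT 0 theta) := FT_rschwartz 0 ler01 ct1.

Let kap_gt0 : 0 < kap.
Proof. by have [st t01 _ t1 t0] := ctheta; exact: FT_integral_gt0. Qed.

Lemma dil_supp s e : 0 < s -> s <= `|e| -> dil s e = 0.
Proof.
move=> s0 se; have [_ _ _ _ t0] := ctheta; apply: t0.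
by rewrite addr0 normrM gtr0_norm ?invr_gt0// ler_pdivlMl// mulr1.
Qed.

Lemma dil_ctest s : 0 < s -> ctest s (dil s).
Proof.
move=> s0; split; first by apply: smooth_affine; case: ctheta.
by move=> e /ltW; exact: dil_supp.
Qed.

Lemma dil_eq1 s e : 0 < s -> `|e| <= 2^-1 * s -> dil s e = 1.
Proof.
move=> s0 es; have [_ _ _ t1 _] := ctheta; apply: t1.
by rewrite addr0 normrM gtr0_norm ?invr_gt0// ler_pdivrMl// mulrC.
Qed.

Lemma vpE s t : 0 < s -> vp s t = kap^-1 * (s * FT 0 theta (s * t)).
Proof.
move=> s0; have si : 0 < s^-1 by rewrite invr_gt0.
have cf : continuous (fun y => theta y * cos (s * t * y + 0)).
  by move=> y; apply: cvgM; [exact: (smooth_cont ct1.1)|exact: cos_affine_cont].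
have fi := intg_mul_cos 0 (s * t) (meas_cont (smooth_cont ct1.1)) (intg_supp ler01 (smooth_cont ct1.1) ct1.2).
have [_] := Int_affine 0 si cf fi; rewrite invrK => e.
rewrite /vp /FT -e; congr (_ * _); apply: eq_Int => y _.
rewrite /dil addr0 add0r; congr (_ * cos _).
by rewrite addr0 [s * t]mulrC -mulrA mulVKf ?gt_eqF ?addr0.
Qed.

Lemma vp_rschwartz s : 0 < s -> rschwartz (FT 0 (dil s)).
Proof. by move=> s0; exact: FT_rschwartz 0 (ltW s0) (dil_ctest s0). Qed.

Lemma vp_cont s : 0 < s -> continuous (vp s).
Proof.
move=> s0 t; apply: cvgM; first exact: cvg_cst.
exact: (smooth_cont (vp_rschwartz s0).1).
Qed.

Lemma Int_vp s : 0 < s -> Int setT (vp s) = 1.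
Proof.
move=> s0; have cF := smooth_cont rFT.1; have iF := rschwartz_intg rFT.
have [i1 e1] := Int_affine 0 s0 cF iF.
have -> : vp s = fun t => kap^-1 * s * FT 0 theta (0 + s * t).
  by apply/funext => t; rewrite vpE// add0r mulrA.
rewrite (IntZ _ measurableT_lebT i1) e1 -/kap.
by field; rewrite !gt_eqF.
Qed.

Lemma vp_le : exists2 M, 0 <= M & forall s t, 0 < s ->
  (1 + (t / s^-1) ^+ 2) * `|vp s t| <= M * pk s^-1 t.
Proof.
have [M M0 hM] := rschwartz_decay rFT; have k0 : 0 < kap^-1 by rewrite invr_gt0.
exists (kap^-1 * M); first by rewrite mulr_ge0// ltW.
move=> s t s0; have sn : s != 0 by rewrite gt_eqF.
rewrite vpE// normrM (gtr0_norm k0) normrM (gtr0_norm s0).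
have d0 : 0 < 1 + (s * t) ^+ 2 by rewrite ltr_pwDl// sqr_ge0.
have -> : pk s^-1 t = s / (1 + (s * t) ^+ 2).
  rewrite /pk; have -> : s^-1 ^+ 2 + t ^+ 2 = (1 + (s * t) ^+ 2) / s ^+ 2 by field.
  by field; rewrite sn gt_eqF.
have -> : kap^-1 * M * (s / (1 + (s * t) ^+ 2)) = kap^-1 * s * (M / (1 + (s * t) ^+ 2)) by ring.
have h : (1 + (s * t) ^+ 2) * `|FT 0 theta (s * t)| <= M / (1 + (s * t) ^+ 2).
  by rewrite ler_pdivlMr// mulrAC -expr2; exact: hM.
have -> : (1 + (t / s^-1) ^+ 2) * (kap^-1 * (s * `|FT 0 theta (s * t)|)) =
  kap^-1 * s * ((1 + (s * t) ^+ 2) * `|FT 0 theta (s * t)|) by rewrite invrK; ring.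
by rewrite ler_wpM2l// mulr_ge0// ltW.
Qed.

Lemma ctest_shift L phi z : ctest L phi -> ctest (L + `|z|) (fun x => phi (1 * x + z)).
Proof.
move=> [sp pL]; split; first exact: smooth_affine.
move=> x xL; rewrite mul1r; apply: pL.
have := ler_normD (x + z) (- z); rewrite addrK normrN => h.
by rewrite -(ltrD2r `|z|) (lt_le_trans xL).
Qed.

(** Modulation by [e] moves [phi] by |e| < s, so both translates still vanish near 0 and [FT_mean0]
    applies to them. *)
Lemma FT_modulate_mean0 s L phi al b e : 0 <= L -> ctest L phi ->
  (forall x, `|x| < s -> phi x = 0) -> `|e| < s ->
  Int setT (fun x => cos (x * e + b) * FT al phi x) = 0.
Proof.
move=> L0 cp p0 es; have Le : 0 <= L + `|e| by rewrite addr_ge0.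
have d0 : 0 < s - `|e| by rewrite subr_gt0.
have z0 z x : `|z| <= `|e| -> `|x| < s - `|e| -> phi (1 * x + z) = 0.
  move=> ze xs; apply: p0; rewrite mul1r (le_lt_trans (ler_normD _ _))//.
  by rewrite -ltrBrDr (lt_le_trans xs)// lerD2l lerN2.
have c2 := ctest_shift e cp; have c1 := ctest_shift (- e) cp; rewrite normrN in c1.
have h0 : `|- e| <= `|e| by rewrite normrN.
have m1 := FT_mean0 (al + b) Le d0 c1 (fun x => z0 (- e) x h0).
have m2 := FT_mean0 (al - b) Le d0 c2 (fun x => z0 e x (lexx _)).
have i1 := rschwartz_intg (FT_rschwartz (al + b) Le c1).
have i2 := rschwartz_intg (FT_rschwartz (al - b) Le c2).
rewrite (eq_Int (g := fun x => 2^-1 * (FT (al + b) (fun z => phi (1 * z + - e)) x +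
   FT (al - b) (fun z => phi (1 * z + e)) x))); last by move=> x _; exact: FT_modulate L0 cp.
by rewrite (IntZ _ measurableT_lebT (intgD measurableT_lebT i1 i2)) (IntD measurableT_lebT i1 i2) m1 m2 addr0 mulr0.
Qed.

(* The transform of [dil s] against that of [phi], translated by [y], is an
   average of integrals of [cos (x e - y e) * FT al phi x], which vanish as
   the spectra of both factors are disjoint. *)
Lemma FT_orth s L phi al y : 0 < s -> 0 <= L -> ctest L phi ->
  (forall x, `|x| < s -> phi x = 0) ->
  Int setT (fun x => vp s (x - y) * FT al phi x) = 0.
Proof.
move=> s0 L0 cp p0; have rf := FT_rschwartz al L0 cp.
have cf := smooth_cont rf.1; have fi := rschwartz_intg rf.
have [sd dL] := dil_ctest s0; have di := intg_supp (ltW s0) (smooth_cont sd) dL.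
pose F x e := FT al phi x * (dil s e * cos ((x - y) * e + 0)).
have cc : continuous (fun t : R => cos (t + 0)).
  by move=> t; have := @cos_affine_cont _ 1 0 t; under eq_fun do rewrite mul1r.
have mF : meas2 F.
  apply: meas2M; first exact: meas2_fst (meas_cont cf).
  apply: meas2M; first exact: meas2_snd (meas_cont (smooth_cont sd)).
  apply: (meas2_comp cc); apply: meas2M; last exact: meas2_snd (@meas_id R).
  apply: (@meas2_fst _ (fun x => x - y)); apply: meas_cont => t.
  by apply: cvgB; [exact: cvg_id|exact: cvg_cst].
have F1 x e : `|F x e| <= `|FT al phi x| * `|dil s e|.
  by rewrite /F !normrM ler_wpM2l ?normr_ge0// ler_piMr ?normr_ge0// ler_norml cos_geN1 cos_le1.
have [iF e1] := Fubini_le mF (fun x => normr_ge0 _) (fun y => normr_ge0 _) F1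
  (intg_norm measurableT_lebT fi) (intg_norm measurableT_lebT di).
have E1 x : Int setT (F x) = FT al phi x * FT 0 (dil s) (x - y).
  exact: (IntZ _ measurableT_lebT (intg_mul_cos 0 _ (meas_cont (smooth_cont sd)) di)).
have E2 e : Int setT (F^~ e) = 0.
  have [es|es] := leP s `|e|.
    rewrite -(@Int0 _ setT); apply: eq_Int => x _; rewrite /F (dil_supp s0 es).
    by rewrite mul0r mulr0.
  have m0 := FT_modulate_mean0 al (- y * e) L0 cp p0 es.
  have i0 : intg setT (fun x => cos (x * e + - y * e) * FT al phi x).
    have := intg_mul_cos (- y * e) e (meas_cont cf) fi; congr intg.
    by apply/funext => x; rewrite mulrC (mulrC e).
  rewrite -(mulr0 (dil s e)) -m0 -(IntZ _ measurableT_lebT i0); apply: eq_Int => x _.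
  have -> : x * e + - y * e = (x - y) * e + 0 by ring.
  by rewrite /F mulrCA [X in _ = _ * X]mulrC.
have -> : (fun x => vp s (x - y) * FT al phi x) = fun x => kap^-1 * Int setT (F x).
  by apply/funext => x; rewrite E1 /vp -mulrA [X in _ * X = _]mulrC.
rewrite (IntZ _ measurableT_lebT iF) e1 (funext E2) Int0.
exact: mulr0.
Qed.
End reproducing_kernel.

(** * Band-limited functions *)


Section complex_integral.
Import ComplexField.Normc.
Local Open Scope complex_scope.
Context {R : realType}.
Implicit Types (f g phi : R -> R[i]) (G : R -> R) (a : R[i]).

Definition cintg f := intg setT (re f) /\ intg setT (im f).

Lemma cintegralD f g : cintg f -> cintg g ->
  cintegral setT (f \+ g)%R = cintegral setT f + cintegral setT g.
Proof.
move=> [f1 f2] [g1 g2]; rewrite /cintegral.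
have -> : re (f \+ g)%R = fun x => re f x + re g x by apply/funext => x; rewrite /re raddfD.
have -> : im (f \+ g)%R = fun x => im f x + im g x by apply/funext => x; rewrite /im raddfD.
by have := IntD measurableT_lebT f1 g1; have := IntD measurableT_lebT f2 g2; rewrite /Int => -> ->.
Qed.

Lemma cintegralZ a f : cintg f -> cintegral setT (fun x => a * f x) = a * cintegral setT f.
Proof.
move=> [f1 f2]; case: a => a b; rewrite /cintegral.
have a1 := intgZ a measurableT_lebT f1; have a2 := intgZ a measurableT_lebT f2.
have b1 := intgZ b measurableT_lebT f1; have b2 := intgZ b measurableT_lebT f2.
have -> : re (fun x => (a +i* b) * f x) = fun x => a * re f x - b * im f x.
  by apply/funext => x; rewrite /re /im; case: (f x).
have -> : im (fun x => (a +i* b) * f x) = fun x => a * im f x + b * re f x.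
  by apply/funext => x; rewrite /re /im; case: (f x).
have := IntB measurableT_lebT a1 b2; have := IntD measurableT_lebT a2 b1.
rewrite !IntZ //; rewrite /Int => -> ->.
by [].
Qed.

Lemma cintg_le f G : ccontinuous f -> intg setT G -> (forall x, normc (f x) <= G x) -> cintg f.
Proof.
move=> [c1 c2] Gi fG; split.
  apply: (intg_le measurableT_lebT (meas_cont c1) _ Gi) => x _.
  exact: le_trans (normc_ge_re _) (fG x).
apply: (intg_le measurableT_lebT (meas_cont c2) _ Gi) => x _.
exact: le_trans (normc_ge_im _) (fG x).
Qed.

Lemma norm_cintegral f G : ccontinuous f -> intg setT G -> (forall x, normc (f x) <= G x) ->
  normc (cintegral setT f) <= 2 * Int setT G.
Proof.
move=> [c1 c2] Gi fG; apply: (le_trans (normc_le _ _)).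
rewrite (mulrDl 1 1) mul1r; apply: lerD.
  apply: (norm_Int_le measurableT_lebT (meas_cont c1) Gi) => x _.
  exact: le_trans (normc_ge_re _) (fG x).
apply: (norm_Int_le measurableT_lebT (meas_cont c2) Gi) => x _.
exact: le_trans (normc_ge_im _) (fG x).
Qed.

Lemma ccontinuousM f g : ccontinuous f -> ccontinuous g -> ccontinuous (fun x => f x * g x).
Proof.
move=> [f1 f2] [g1 g2]; split.
  have -> : re (fun x => f x * g x) = fun x => re f x * re g x - im f x * im g x.
    by apply/funext => x; rewrite /re /im; case: (f x); case: (g x).
  by move=> x; apply: cvgB; apply: cvgM; [exact: f1|exact: g1|exact: f2|exact: g2].
have -> : im (fun x => f x * g x) = fun x => re f x * im g x + im f x * re g x.
  by apply/funext => x; rewrite /re /im; case: (f x); case: (g x).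
by move=> x; apply: cvgD; apply: cvgM; [exact: f1|exact: g2|exact: f2|exact: g1].
Qed.

Lemma schwartz_smooth phi : schwartz phi -> smooth (re phi) /\ smooth (im phi).
Proof. by move=> [cs _]; split => n x; have [] := cs n x. Qed.

Lemma schwartz_cont phi : schwartz phi -> ccontinuous phi.
Proof. by move=> /schwartz_smooth[s1 s2]; split; exact: smooth_cont. Qed.

Lemma cderiv0 phi : cderiv 0 phi = phi.
Proof. by apply/funext => x; rewrite /cderiv /= /re /im; case: (phi x). Qed.

Lemma schwartz_pk phi M : schwartz_le phi 0 0 M -> schwartz_le phi 2 0 M ->
  forall x, normc (phi x) <= 2 * M * pk 1 x.
Proof.
move=> h0 h2 x; have := h0 x; have := h2 x; rewrite cderiv0 expr0 mul1r.
rewrite real_normK ?num_real// => a b; rewrite /pk expr1n mul1r ler_pdivlMr ?ltr_pwDl ?sqr_ge0//.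
by rewrite mulrDr mulr1 mulrC; lra.
Qed.

Lemma re_fourier L phi xi : 0 <= L -> ctest L (re phi) -> ctest L (im phi) ->
  re (fourier phi) xi = FT 0 (re phi) xi + FT (- (pi / 2)) (im phi) xi.
Proof.
move=> L0 c1 c2; rewrite /FT -(IntD measurableT_lebT (FT_intg 0 xi L0 c1) (FT_intg _ xi L0 c2)).
rewrite /re /fourier /cintegral /=; apply: eq_Int => x _.
rewrite /re /im addr0 (cosB (xi * x)) cos_pihalf sin_pihalf.
by case: (phi x) => a b /=; ring.
Qed.

Lemma im_fourier L phi xi : 0 <= L -> ctest L (re phi) -> ctest L (im phi) ->
  im (fourier phi) xi = FT 0 (im phi) xi - FT (- (pi / 2)) (re phi) xi.
Proof.
move=> L0 c1 c2; rewrite /FT -(IntB measurableT_lebT (FT_intg 0 xi L0 c2) (FT_intg _ xi L0 c1)).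
rewrite /im /fourier /cintegral /=; apply: eq_Int => x _.
rewrite /re /im addr0 (cosB (xi * x)) cos_pihalf sin_pihalf.
by case: (phi x) => a b /=; ring.
Qed.

Lemma test_functionP U phi : test_function U phi ->
  exists2 L, 0 <= L & [/\ ctest L (re phi), ctest L (im phi) & forall x, ~ U x -> phi x = 0].
Proof.
move=> [cs [K [cK KU K0]]].
have [L0 hL] : exists L0, forall x, K x -> `|x| <= L0.
  have [M [_ hM]] := compact_bounded cK; exists (M + 1) => x Kx.
  by apply: hM => //; rewrite ltrDl.
have L0L : L0 <= Num.max 0 L0 by rewrite le_max lexx orbT.
have z x : Num.max 0 L0 < `|x| -> phi x = 0.
  move=> xL; apply: K0 => /hL; apply/negP; rewrite -ltNge.
  exact: le_lt_trans xL.
exists (Num.max 0 L0); first by rewrite le_max lexx.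
split; [split|split|].
- by move=> n x; have [] := cs n x.
- by move=> x /z; rewrite /re => ->.
- by move=> n x; have [] := cs n x.
- by move=> x /z; rewrite /im => ->.
by move=> x Ux; apply: K0 => /KU.
Qed.

End complex_integral.

(** * Convolutions with [vp] are band-limited *)

Section bandlimited_convolution.
Import ComplexField.Normc.
Local Open Scope complex_scope.
Context {R : realType} (theta : R -> R) (ctheta : cutoff theta).
Implicit Types (f q u w : R -> R) (s x y al L B : R).
Local Notation vp := (vp theta).

Lemma vp_pk s : 0 < s -> exists2 M, 0 <= M & forall t, `|vp s t| <= M * pk 1 t.
Proof.
move=> s0; have [M M0 hM] := rschwartz_pk (vp_rschwartz ctheta s0).
exists (`|(kap theta)^-1| * M); first by rewrite mulr_ge0.
by move=> t; rewrite normrM -mulrA ler_wpM2l.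
Qed.

(** Peetre's inequality for this kernel; the weight 1 + x^2 is absorbed in [conv_orth] by the decay
    of a Schwartz function. *)
Lemma pk_translate x y : pk 1 (x - y) <= 2 * (1 + x ^+ 2) * pk 1 y :> R.
Proof.
rewrite /pk expr1n !mul1r.
have d1 : 0 < 1 + (x - y) ^+ 2 by rewrite ltr_pwDl ?sqr_ge0.
have d2 : 0 < 1 + y ^+ 2 by rewrite ltr_pwDl ?sqr_ge0.
rewrite ler_pdivlMr// ler_pdivrMl//.
by have := sqr_ge0 (x * (x - y)); have := sqr_ge0 (y - 2 * x); rewrite !expr2; nra.
Qed.

Lemma vp_sub_cont s x : 0 < s -> continuous (fun y => vp s (x - y)).
Proof.
move=> s0 t; apply: (@continuous_comp _ _ _ (fun t : R => x - t) (vp s)); last exact: (vp_cont ctheta s0).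
by apply: cvgB; [exact: cvg_cst|exact: cvg_id].
Qed.

(** After Fubini the inner integral over [x] vanishes for each [y] by [FT_orth], since [phi] lives
    on frequencies |x| >= s and the kernel on [- s, s]. *)
Lemma conv_orth s q B L al phi : 0 < s -> continuous q -> (forall y, `|q y| <= B) ->
  0 <= L -> ctest L phi -> (forall x, `|x| < s -> phi x = 0) ->
  intg setT (fun x => FT al phi x * conv (vp s) q x) /\
  Int setT (fun x => FT al phi x * conv (vp s) q x) = 0.
Proof.
move=> s0 cq qB L0 cp p0; have rf := FT_rschwartz al L0 cp.
have B0 : 0 <= B := le_trans (normr_ge0 _) (qB 0).
have [M1 M10 h1] := rschwartz_decay rf; have [M2 M20 h2] := vp_pk s0.
have cf := smooth_cont rf.1; have fi := rschwartz_intg rf.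
have mV : meas2 (fun x y => vp s (x - y)) := meas2_comp (vp_cont ctheta s0) (@meas2_sub R).
pose F x y := FT al phi x * (q y * vp s (x - y)).
have mF : meas2 F.
  apply: meas2M; first exact: meas2_fst (meas_cont cf).
  by apply: meas2M; first exact: meas2_snd (meas_cont cq).
have pk0 z : 0 <= pk 1 z :> R by exact/ltW/pk_gt0.
have F1 x y : `|F x y| <= (M1 * pk 1 x) * (B * (M2 * 2) * pk 1 y).
  rewrite /F normrM [`|q y * _|]normrM.
  have d1 : 0 < 1 + x ^+ 2 by rewrite ltr_pwDl ?sqr_ge0.
  have a1 : `|FT al phi x| * (1 + x ^+ 2) <= M1 * pk 1 x.
    rewrite /pk expr1n mul1r ler_pdivlMr// -mulrA -expr2 mulrC; exact: h1.
  have a2 : `|q y| * `|vp s (x - y)| <= B * (M2 * (2 * (1 + x ^+ 2) * pk 1 y)).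
    apply: ler_pM => //; apply: (le_trans (h2 _)); rewrite ler_wpM2l//.
    exact: pk_translate.
  apply: (le_trans (ler_wpM2l (normr_ge0 (FT al phi x)) a2)).
  have e : `|FT al phi x| * (B * (M2 * (2 * (1 + x ^+ 2) * pk 1 y))) =
    `|FT al phi x| * (1 + x ^+ 2) * (B * (M2 * 2) * pk 1 y) by ring.
  by rewrite e; apply: (ler_wpM2r _ a1); rewrite mulr_ge0 ?pk0// mulr_ge0// mulr_ge0.
have i1 := intgZ M1 measurableT_lebT (@pk1_intg R).
have i2 := intgZ (B * (M2 * 2)) measurableT_lebT (@pk1_intg R).
have [iF eF] := Fubini_le mF (fun x => mulr_ge0 M10 (pk0 x))
  (fun y => mulr_ge0 (mulr_ge0 B0 (mulr_ge0 M20 (ler0n _ 2))) (pk0 y)) F1 i1 i2.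
have iqv x : intg setT (fun y => q y * vp s (x - y)).
  apply: (intg_le measurableT_lebT _ _ (intgZ (B * M2) measurableT_lebT (pk_intg x ltr01))).
    by apply: (measM (meas_cont cq)); apply: meas_cont; exact: vp_sub_cont.
  by move=> y _; rewrite normrM -mulrA; apply: ler_pM.
have E1 x : Int setT (F x) = FT al phi x * conv (vp s) q x.
  rewrite /F (IntZ _ measurableT_lebT (iqv x)); congr (_ * _).
  by apply: eq_Int => y _; rewrite mulrC.
have ifv y : intg setT (fun x => vp s (x - y) * FT al phi x).
  have B1 := intgZ M2 measurableT_lebT (intg_norm measurableT_lebT fi).
  apply: (intg_le measurableT_lebT _ _ B1).
    apply: measM; last exact: meas_cont cf.
    apply: meas_cont => t; apply: (@continuous_comp _ _ _ (fun t : R => t - y) (vp s)); last exact: (vp_cont ctheta s0).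
    by apply: cvgB; [exact: cvg_id|exact: cvg_cst].
  move=> x _; rewrite normrM; apply: (ler_wpM2r (normr_ge0 _)).
  apply: (le_trans (h2 _)); apply: (ler_piMr M20).
  have d1 : 0 < 1 + (x - y) ^+ 2 by rewrite ltr_pwDl ?sqr_ge0.
  by rewrite /pk expr1n mul1r (invf_le1 d1) lerDl sqr_ge0.
have E2 y : Int setT (F^~ y) = 0.
  rewrite -(mulr0 (q y)) -(FT_orth ctheta al y s0 L0 cp p0) -(IntZ _ measurableT_lebT (ifv y)).
  by apply: eq_Int => x _; rewrite /F mulrCA [X in _ = _ * X]mulrC.
split; first by rewrite -(funext E1).
by rewrite -(funext E1) eF (funext E2) Int0.
Qed.

(** The functional is integration against [g], tempered because [g] is bounded. For a test function
    supported off [- s, s], the pairing is split into real and imaginary parts and [conv_orth]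
    annihilates every product. *)
Lemma bandlimited_conv (X : banach_lattice R) C s q1 q2 : poisson_bounded X C -> 0 < s ->
  nice X q1 -> nice X q2 ->
  bandlimited X s (fun x => conv (vp s) q1 x +i* conv (vp s) q2 x).
Proof.
move=> PC s0 n1 n2; have si : 0 < s^-1 by rewrite invr_gt0.
have cV := vp_cont ctheta s0; have [M M0 hM] := vp_le ctheta.
have VM t := hM s t s0.
have c1 := nice_conv PC si M0 cV VM n1; have c2 := nice_conv PC si M0 cV VM n2.
set u1 := conv _ q1 in c1 *; set u2 := conv _ q2 in c2 *.
set g := fun x => u1 x +i* u2 x.
have cg : ccontinuous g by split; [exact: (nice_cont c1)|exact: (nice_cont c2)].
split => //.
  by have [] := car_reim (nice_rcar c1) (nice_rcar c2).
exists (fun phi => cintegral setT (fun x => g x * phi x)); split => //.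
  have [_ /(_ 0%N)[_ [B1 hB1]]] := c1; have [_ /(_ 0%N)[_ [B2 hB2]]] := c2.
  have gB x : normc (g x) <= B1 + B2 by apply: (le_trans (normc_le _ _)); apply: lerD; [exact: hB1|exact: hB2].
  have gphi phi N : schwartz phi -> schwartz_le phi 0 0 N -> schwartz_le phi 2 0 N ->
      forall x, normc (g x * phi x) <= (B1 + B2) * (2 * N) * pk 1 x.
    move=> sp p0 p2 x; rewrite normcM -[leRHS]mulrA; apply: ler_pM; rewrite ?normc_ge0//.
    exact: schwartz_pk.
  have cc phi : schwartz phi -> ccontinuous (fun x => g x * phi x).
    by move=> sp; apply: ccontinuousM => //; exact: schwartz_cont.
  have ci phi : schwartz phi -> cintg (fun x => g x * phi x).
    move=> sp; have [_ ps] := sp; have [N0 h0] := ps 0%N 0%N; have [N2 h2] := ps 2%N 0%N.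
    pose N := Num.max N0 N2.
    have h0' : schwartz_le phi 0 0 N by move=> x; apply: (le_trans (h0 x)); rewrite le_max lexx.
    have h2' : schwartz_le phi 2 0 N by move=> x; apply: (le_trans (h2 x)); rewrite le_max lexx orbT.
    exact: (cintg_le (cc phi sp) (intgZ _ measurableT_lebT (@pk1_intg R)) (gphi phi N sp h0' h2')).
  split.
  - move=> phi psi sp sq; rewrite -cintegralD; [|exact: ci|exact: ci].
    by congr cintegral; apply/funext => x /=; rewrite mulrDr.
  - move=> a phi sp; rewrite -cintegralZ; last exact: ci.
    by congr cintegral; apply/funext => x /=; rewrite mulrCA.
  exists 2%N, (2 * ((B1 + B2) * 2 * Int setT (pk (1 : R)))) => phi N sp hN.
  have := norm_cintegral (cc phi sp) (intgZ _ measurableT_lebT (@pk1_intg R)) (gphi phi N sp (hN _ _ _ _) (hN _ _ _ _)).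
  move=> /(_ isT isT isT isT)/le_trans; apply; rewrite (IntZ _ measurableT_lebT (@pk1_intg R)).
  by rewrite le_eqVlt; apply/orP; left; apply/eqP; ring.
move=> x xs; apply: contrapT => xns.
pose U : set R := ~` `[- s, s]%classic.
have oU : open U by apply: closed_openC; exact: itv_closed.
apply: (xs U oU xns) => phi /test_functionP[L L0 [p1 p2 pU]].
have z y : `|y| < s -> phi y = 0.
  move=> ys; apply: pU; rewrite /U /= in_itv/=; apply.
  by move: ys; rewrite ltr_norml => /andP[/ltW-> /ltW->].
have z1 y : `|y| < s -> re phi y = 0 by move=> /z; rewrite /re => ->.
have z2 y : `|y| < s -> im phi y = 0 by move=> /z; rewrite /im => ->.
have [_ /(_ 0%N)[_ [Q1 hQ1]]] := n1; have [_ /(_ 0%N)[_ [Q2 hQ2]]] := n2.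
have o1 al f : ctest L f -> (forall y, `|y| < s -> f y = 0) ->
    intg setT (fun x => FT al f x * u1 x) /\ Int setT (fun x => FT al f x * u1 x) = 0.
  by move=> cf f0; exact: (conv_orth al s0 (nice_cont n1) hQ1 L0 cf f0).
have o2 al f : ctest L f -> (forall y, `|y| < s -> f y = 0) ->
    intg setT (fun x => FT al f x * u2 x) /\ Int setT (fun x => FT al f x * u2 x) = 0.
  by move=> cf f0; exact: (conv_orth al s0 (nice_cont n2) hQ2 L0 cf f0).
rewrite /dist_fourier /cintegral.
have reE : re (fun x => g x * fourier phi x) = fun x =>
    (FT 0 (re phi) x * u1 x + FT (- (pi / 2)) (im phi) x * u1 x) -
    (FT 0 (im phi) x * u2 x - FT (- (pi / 2)) (re phi) x * u2 x).
  apply/funext => y; rewrite -mulrDl -mulrBl -(re_fourier _ L0 p1 p2) -(im_fourier _ L0 p1 p2).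
  by rewrite /re /im /g; case: (fourier phi y) => a b /=; ring.
have imE : im (fun x => g x * fourier phi x) = fun x =>
    (FT 0 (im phi) x * u1 x - FT (- (pi / 2)) (re phi) x * u1 x) +
    (FT 0 (re phi) x * u2 x + FT (- (pi / 2)) (im phi) x * u2 x).
  apply/funext => y; rewrite -mulrDl -mulrBl -(re_fourier _ L0 p1 p2) -(im_fourier _ L0 p1 p2).
  by rewrite /re /im /g; case: (fourier phi y) => a b /=; ring.
have [a1 b1] := o1 0 _ p1 z1; have [a2 b2] := o1 (- (pi / 2)) _ p2 z2.
have [a3 b3] := o2 0 _ p2 z2; have [a4 b4] := o2 (- (pi / 2)) _ p1 z1.
have [a5 b5] := o1 0 _ p2 z2; have [a6 b6] := o1 (- (pi / 2)) _ p1 z1.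
have [a7 b7] := o2 0 _ p1 z1; have [a8 b8] := o2 (- (pi / 2)) _ p2 z2.
have mT := @measurableT_lebT R.
have r0 := IntB mT (intgD mT a1 a2) (intgB mT a3 a4).
have i0 := IntD mT (intgB mT a5 a6) (intgD mT a7 a8).
rewrite (IntD mT a1 a2) (IntB mT a3 a4) b1 b2 b3 b4 addr0 subrr in r0.
rewrite (IntB mT a5 a6) (IntD mT a7 a8) b5 b6 b7 b8 addr0 subrr addr0 in i0.
rewrite reE imE; move: r0 i0; rewrite /Int => -> ->.
by rewrite subrr.
Qed.

End bandlimited_convolution.

(** * From test functions to Schwartz functions *)

Section schwartz_cutoff.
Import ComplexField.Normc.
Local Open Scope complex_scope.
Context {R : realType} (theta : R -> R) (ctheta : cutoff theta).
Implicit Types (a b f : R -> R) (g psi : R -> R[i]) (x L A B M : R) (j k i n N : nat).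

Lemma leibniz_le a b x k A B : smooth a -> smooth b ->
  (forall i, (i <= k)%N -> `|derive1n i a x| <= A) ->
  (forall i, (i <= k)%N -> `|derive1n i b x| <= B) ->
  `|derive1n k (fun y => a y * b y) x| <= 2 ^+ k * (A * B).
Proof.
elim: k a b => [|k IH] a b sa sb hA hB.
  by rewrite expr0 mul1r normrM; apply: ler_pM => //; [exact: (hA 0%N)|exact: (hB 0%N)].
have sa' := smooth_derive1 sa; have sb' := smooth_derive1 sb.
have -> : derive1n k.+1 (fun y => a y * b y) =
    fun y => derive1n k (fun y => derive1 a y * b y) y + derive1n k (fun y => a y * derive1 b y) y.
  rewrite derive1Sn -derive1nD; [|exact: smoothM|exact: smoothM]; congr derive1n.
  apply: derive1_eq => y; apply: is_deriveM_fun; exact: smooth_is_derive.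
rewrite exprS -mulrA (mulrDl 1 1) mul1r; apply: (le_trans (ler_normD _ _)); apply: lerD.
  apply: IH => // i ik; last exact/hB/ltnW.
  by rewrite -derive1Sn; exact: hA.
apply: IH => // i ik; first exact/hA/ltnW.
by rewrite -derive1Sn; exact: hB.
Qed.

Lemma ctest_derive1n L n f : ctest L f -> ctest L (derive1n n f).
Proof. by elim: n f => [//|n IH] f cf; rewrite derive1Sn; apply: IH; exact: ctest_derive1. Qed.

Lemma ctest_bounded L f : 0 <= L -> ctest L f -> exists M, forall x, `|f x| <= M.
Proof.
move=> L0 cf; have [sf fL] := cf; have cf' := ctest_derive1 cf.
have i' := intg_supp L0 (smooth_cont cf'.1) cf'.2.
exists (Int setT (fun x => `|derive1 f x|)) => x.
have [xL|xL] := leP (- (L + 1)) x; last first.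
  rewrite fL ?normr0; first by apply: Int_ge0.
  by rewrite ltr0_norm; lra.
have f0 : f (- (L + 1)) = 0 by apply: fL; rewrite normrN ger0_norm; lra.
rewrite -[f x]subr0 -f0; apply: (le_trans (smooth_diff_le sf xL)).
exact: (Int_subset (measurable_itv_lebT _) (measurableT_lebT) (@subsetT _ _) (intg_norm measurableT_lebT i')).
Qed.

Definition rsn N f M := forall j k, (j <= N)%N -> (k <= N)%N ->
  forall x, `|x| ^+ j * `|derive1n k f x| <= M.

Lemma ex_rsn N f : rschwartz f -> exists2 M, 0 <= M & rsn N f M.
Proof.
move=> [sf fM]; pose m j k : R := projT1 (cid (fM j k)).
have mP j k x : `|x| ^+ j * `|derive1n k f x| <= m j k.
  by rewrite /m; case: (cid _) => /=.
have m0 j k : 0 <= m j k by apply: le_trans (mP j k 0); rewrite mulr_ge0// exprn_ge0.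
exists (\sum_(j < N.+1) \sum_(k < N.+1) m j k).
  by apply: sumr_ge0 => j _; apply: sumr_ge0.
move=> j k jN kN x; apply: (le_trans (mP j k x)).
rewrite (bigD1 (Ordinal (jN : (j < N.+1)%N)))//= (bigD1 (Ordinal (kN : (k < N.+1)%N)))//= -addrA lerDl.
by rewrite addr_ge0// sumr_ge0// => i _; rewrite sumr_ge0.
Qed.

Lemma cut_derive_bound N : exists2 A, 0 <= A & forall s k x, 1 <= s -> (k <= N)%N ->
  `|derive1n k (dil theta s) x| <= A.
Proof.
have [st _ _ _ t0] := ctheta.
have ct : ctest 1 theta by split => // x x1; apply: t0; exact: ltW.
have hk k : exists A, forall x, `|derive1n k theta x| <= A by apply: (ctest_bounded ler01); exact: ctest_derive1n.
pose m k : R := projT1 (cid (hk k)).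
have mP k x : `|derive1n k theta x| <= m k by rewrite /m; case: (cid _) => /=.
have m0 k : 0 <= m k := le_trans (normr_ge0 _) (mP k 0).
exists (\sum_(k < N.+1) m k); first exact: sumr_ge0.
move=> s k x s1 kN; have s0 : 0 < s := lt_le_trans ltr01 s1.
rewrite /dil derive1n_affine// normrM.
rewrite (bigD1 (Ordinal (kN : (k < N.+1)%N)))//=; apply: (@le_trans _ _ (m k)); last first.
  by rewrite lerDl sumr_ge0.
apply: le_trans (mP k (s^-1 * x + 0)); rewrite ler_piMl//.
by rewrite normrX exprn_ile1// gtr0_norm ?invr_gt0// invf_le1.
Qed.

Lemma derive1n_cst_le k (c x : R) : `|derive1n k (fun=> c) x| <= `|c|.
Proof.
have z i : derive1n i (fun=> 0 : R) = fun=> 0.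
  elim: i => [//|i IH]; rewrite derive1Sn (derive1_eq (fun x => is_derive_cst 0 x 1)).
  exact: IH.
case: k => [//|k]; rewrite derive1Sn (derive1_eq (fun x => is_derive_cst c x 1)) z normr0.
exact: normr_ge0.
Qed.

(** 1 - [dil theta s] lives on |x| >= s / 2, where a further power of |x|, taken from the next
    seminorm of [f], is worth a factor 2 / s. *)
Lemma cut_seminorm N f : rschwartz f -> exists D, forall s, 1 <= s ->
  rsn N (fun x => (1 - dil theta s x) * f x) (D / s).
Proof.
move=> rf; have [A A0 hA] := cut_derive_bound N; have [M M0 hM] := ex_rsn N.+1 rf.
exists (2 * (2 ^+ N * ((1 + A) * M))) => s s1 j k jN kN x.
have s0 : 0 < s := lt_le_trans ltr01 s1; have [sd _] := dil_ctest ctheta s0.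
have s1d : smooth (fun x => 1 - dil theta s x) by apply: smoothB; [exact: smooth_cst|exact: sd].
have D0 : 0 <= 2 * (2 ^+ N * ((1 + A) * M)) / s.
  by rewrite divr_ge0 ?(ltW s0)// !mulr_ge0// ?exprn_ge0// addr_ge0.
have [xs|xs] := ltP `|x| (2^-1 * s).
  have -> : derive1n k (fun x => (1 - dil theta s x) * f x) x = 0; last by rewrite normr0 mulr0.
  have z i y : `|y| < 2^-1 * s -> derive1n i (fun x => (1 - dil theta s x) * f x) y = 0.
    elim: i y => [|i IH] y ys; first by rewrite /= dil_eq1 ?ltW// subrr mul0r.
    rewrite derive1nS; apply: is_derive_derive1; apply: (@is_derive_near _ _ (fun=> 0)).
    have cn : continuous (fun y : R => `|y|) by move=> z; exact: norm_continuous.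
    have nd : \forall z \near y, `|z| < 2^-1 * s by exact: (cvgr_lt _ (cn y)).
    by apply: filterS nd => z zs; exact: IH.
  exact: z.
have x0 : 0 < `|x| by apply: lt_le_trans xs; rewrite mulr_gt0.
have hd i : (i <= k)%N -> `|derive1n i (fun x => 1 - dil theta s x) x| <= 1 + A.
  move=> ik; rewrite derive1nB; [|exact: smooth_cst|exact: sd].
  apply: (le_trans (ler_normB _ _)); apply: lerD; last exact/hA/(leq_trans ik kN).
  by apply: (le_trans (derive1n_cst_le _ _ _)); rewrite normr1.
have hf i : (i <= k)%N -> `|derive1n i f x| <= M / `|x| ^+ j.+1.
  move=> ik; rewrite ler_pdivlMr ?exprn_gt0// mulrC; apply: hM => //.
  exact: leqW (leq_trans ik kN).
have h := leibniz_le s1d rf.1 hd hf.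
apply: (le_trans (ler_wpM2l (exprn_ge0 j (normr_ge0 x)) h)).
have -> : `|x| ^+ j * (2 ^+ k * ((1 + A) * (M / `|x| ^+ j.+1))) = 2 ^+ k * ((1 + A) * M) / `|x|.
  by rewrite exprS; field; rewrite gt_eqF//= expf_neq0// gt_eqF.
have k2 : 2 ^+ k <= 2 ^+ N :> R by rewrite ler_eXn2l// ltr1n.
have AM : 0 <= (1 + A) * M by rewrite mulr_ge0// addr_ge0.
apply: (@le_trans _ _ (2 ^+ N * ((1 + A) * M) / `|x|)).
  by rewrite ler_wpM2r ?invr_ge0// ler_wpM2r.
set P := 2 ^+ N * ((1 + A) * M).
have P0 : 0 <= P by rewrite mulr_ge0// exprn_ge0.
have h1 : 1 <= 2 * `|x| / s by rewrite ler_pdivlMr//; lra.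
rewrite ler_pdivrMr// (_ : 2 * P / s * `|x| = P * (2 * `|x| / s)); last by ring.
by rewrite ler_peMr.
Qed.

Lemma rschwartzM_bounded a f : smooth a -> (forall N, exists A, forall k x, (k <= N)%N -> `|derive1n k a x| <= A) ->
  rschwartz f -> rschwartz (fun x => a x * f x).
Proof.
move=> sa ha rf; split; first exact: smoothM rf.1.
move=> j k; have [A hA] := ha k; have [M M0 hM] := ex_rsn (maxn j k) rf.
exists (2 ^+ k * (A * M)) => x; have [->|x0] := eqVneq (`|x| ^+ j) 0.
  have A0 := le_trans (normr_ge0 _) (hA 0%N 0 isT).
  by rewrite mul0r !mulr_ge0// exprn_ge0.
have xj : 0 < `|x| ^+ j by rewrite lt_def x0 exprn_ge0.
have hf i : (i <= k)%N -> `|derive1n i f x| <= M / `|x| ^+ j.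
  move=> ik; rewrite ler_pdivlMr// mulrC; apply: hM; first exact: leq_maxl.
  exact: leq_trans ik (leq_maxr _ _).
have h := leibniz_le sa rf.1 (fun i => hA i x) hf.
rewrite mulrC -ler_pdivlMr//; apply: (le_trans h).
by rewrite !mulrA.
Qed.

Lemma rschwartzD f b : rschwartz f -> rschwartz b -> rschwartz (fun x => f x + b x).
Proof.
move=> [sf hf] [sg hg]; split; first exact: smoothD.
move=> j k; have [M hM] := hf j k; have [M' hM'] := hg j k; exists (M + M') => x.
rewrite derive1nD//; apply: le_trans (lerD (hM x) (hM' x)).
by rewrite -mulrDr ler_wpM2l ?exprn_ge0// ler_normD.
Qed.

Lemma rschwartzB f b : rschwartz f -> rschwartz b -> rschwartz (fun x => f x - b x).
Proof.
move=> [sf hf] [sg hg]; split; first exact: smoothB.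
move=> j k; have [M hM] := hf j k; have [M' hM'] := hg j k; exists (M + M') => x.
rewrite derive1nB//; apply: le_trans (lerD (hM x) (hM' x)).
by rewrite -mulrDr ler_wpM2l ?exprn_ge0// ler_normB.
Qed.

Lemma schwartz_le_parts psi j k M M' : (forall x, `|x| ^+ j * `|derive1n k (re psi) x| <= M) ->
  (forall x, `|x| ^+ j * `|derive1n k (im psi) x| <= M') -> schwartz_le psi j k (M + M').
Proof.
move=> h1 h2 x; apply: le_trans (lerD (h1 x) (h2 x)).
by rewrite -mulrDr ler_wpM2l ?exprn_ge0// normc_le.
Qed.

Lemma schwartz_parts psi : rschwartz (re psi) -> rschwartz (im psi) -> schwartz psi.
Proof.
move=> [s1 h1] [s2 h2]; split; first by move=> n x; split; [exact: s1|exact: s2].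
move=> j k; have [M hM] := h1 j k; have [M' hM'] := h2 j k; exists (M + M').
exact: schwartz_le_parts.
Qed.

Lemma rschwartz_parts psi : schwartz psi -> rschwartz (re psi) /\ rschwartz (im psi).
Proof.
move=> sp; have [s1 s2] := schwartz_smooth sp; have [_ h] := sp.
split; split => // j k; have [M hM] := h j k; exists M => x; apply: le_trans (hM x).
  by apply: ler_wpM2l; [exact: exprn_ge0|exact: normc_ge_re (cderiv k psi x)].
by apply: ler_wpM2l; [exact: exprn_ge0|exact: normc_ge_im (cderiv k psi x)].
Qed.

(* Cut-offs [dil theta s * psi] are test functions tending to [psi] in every
   Schwartz seminorm, so a tempered functional represented by [g] on test
   functions is still given by integration against [g] on Schwartz functions. *)
Lemma represented_schwartz (T : (R -> R[i]) -> R[i]) g psi : tempered T ->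
  represented_by T g -> ccontinuous g ->
  intg setT (fun y => pk 1 y * `|re g y|) -> intg setT (fun y => pk 1 y * `|im g y|) ->
  schwartz psi -> T psi = cintegral setT (fun x => g x * psi x).
Proof.
move=> [TD TZ [N [C TN]]] Tg cg g1 g2 sp; have [r1 r2] := rschwartz_parts sp.
pose N2 := maxn N 2; have [D1 hD1] := cut_seminorm N2 r1; have [D2 hD2] := cut_seminorm N2 r2.
have mT := @measurableT_lebT R.
pose G x := pk 1 x * `|re g x| + pk 1 x * `|im g x|.
have iG : intg setT G := intgD mT g1 g2.
(* A bound by a constant over [s], valid for every s >= 1, forces equality. *)
suff key s : 1 <= s -> normc (T psi - cintegral setT (fun x => g x * psi x)) <=
    (C * (D1 + D2) + 2 * (2 * (D1 + D2) * Int setT G)) / s.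
  apply/eqP; rewrite -subr_eq0; apply/eqP; apply: eq0_normc.
  move: key; set a := normc _; set K := (_ + _ : R) => key.
  have a0 : 0 <= a by exact: normc_ge0.
  apply/eqP; rewrite eq_le a0 andbT leNgt; apply/negP => ap.
  have s1 : 1 <= 1 + `|K| / a by rewrite lerDl divr_ge0.
  have := key _ s1; rewrite ler_pdivlMr; last exact: lt_le_trans s1.
  rewrite mulrDr mulr1 mulrCA divff ?gt_eqF// mulr1 => h.
  by have := ler_norm K; lra.
move=> s1; have s0 : 0 < s := lt_le_trans ltr01 s1.
have [sd sL] := dil_ctest ctheta s0.
pose psi1 x := (dil theta s x)%:C * psi x; pose psi2 x := (1 - dil theta s x)%:C * psi x.
have re1 : re psi1 = fun x => dil theta s x * re psi x.
  by apply/funext => x; rewrite /re /psi1; case: (psi x) => a b /=; rewrite mul0r subr0.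
have im1 : im psi1 = fun x => dil theta s x * im psi x.
  by apply/funext => x; rewrite /im /psi1; case: (psi x) => a b /=; rewrite mul0r addr0.
have re2 : re psi2 = fun x => (1 - dil theta s x) * re psi x.
  by apply/funext => x; rewrite /re /psi2; case: (psi x) => a b /=; rewrite mul0r subr0.
have im2 : im psi2 = fun x => (1 - dil theta s x) * im psi x.
  by apply/funext => x; rewrite /im /psi2; case: (psi x) => a b /=; rewrite mul0r addr0.
have bd n : exists A, forall k x, (k <= n)%N -> `|derive1n k (dil theta s) x| <= A.
  by have [A _ hA] := cut_derive_bound n; exists A => k x kn; exact: hA.
have sp1 : schwartz psi1.
  by apply: schwartz_parts; rewrite ?re1 ?im1; exact: rschwartzM_bounded.
have psiE : psi = (psi1 \+ psi2)%R.
  apply/funext => x; rewrite /= /psi1 /psi2 -mulrDl -rmorphD.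
  by rewrite addrC subrK mul1r.
have sp2 : schwartz psi2.
  have E f : (fun x => (1 - dil theta s x) * f x) = fun x => f x - dil theta s x * f x.
    by apply/funext => x; rewrite mulrBl mul1r.
  by apply: schwartz_parts; rewrite ?re2 ?im2 E; apply: rschwartzB; [exact: r1|exact: rschwartzM_bounded|exact: r2|exact: rschwartzM_bounded].
have t1 : test_function setT psi1.
  split; first by case: sp1.
  exists `[- s, s]%classic; split => //; first exact: segment_compact.
  move=> x xs; rewrite /psi1 sL ?mul0r//; apply: supp_itv => //; exact: ltW.
have le2 j k : (j <= N2)%N -> (k <= N2)%N -> schwartz_le psi2 j k ((D1 + D2) / s).
  move=> jN kN; rewrite mulrDl; apply: schwartz_le_parts => x.
    by rewrite re2; exact: hD1.
  by rewrite im2; exact: hD2.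
have b2 := schwartz_pk (le2 _ _ (leq0n _) (leq0n _)) (le2 _ _ (leq_maxr N 2) (leq0n _)).
have gb x : normc (g x * psi2 x) <= 2 * ((D1 + D2) / s) * G x.
  rewrite normcM; apply: (le_trans (ler_pM (normc_ge0 _) (normc_ge0 _) (lexx _) (b2 x))).
  have gle : normc (g x) <= `|re g x| + `|im g x|.
    by rewrite /re /im; case: (g x) => a b; exact: normc_le.
  have b0 := le_trans (normc_ge0 _) (b2 x).
  by apply: (le_trans (ler_wpM2r b0 gle)); rewrite /G -mulrDr [leLHS]mulrC [leRHS]mulrA.
have c2 : ccontinuous (fun x => g x * psi2 x) by apply: ccontinuousM => //; exact: schwartz_cont.
have iG2 := intgZ (2 * ((D1 + D2) / s)) mT iG.
have i2 := cintg_le c2 iG2 gb; have n2 := norm_cintegral c2 iG2 gb.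
have i1 : cintg (fun x => g x * psi1 x).
  have [N0 h0] := sp1.2 0%N 0%N; have [N3 h3] := sp1.2 2%N 0%N; pose M := Num.max N0 N3.
  have h0' : schwartz_le psi1 0 0 M by move=> x; apply: (le_trans (h0 x)); rewrite le_max lexx.
  have h3' : schwartz_le psi1 2 0 M by move=> x; apply: (le_trans (h3 x)); rewrite le_max lexx orbT.
  have b1 := schwartz_pk h0' h3'.
  apply: (cintg_le _ (intgZ (2 * M) mT iG)); first by apply: ccontinuousM => //; exact: schwartz_cont.
  move=> x; rewrite normcM; apply: (le_trans (ler_pM (normc_ge0 _) (normc_ge0 _) (lexx _) (b1 x))).
  have gle : normc (g x) <= `|re g x| + `|im g x|.
    by rewrite /re /im; case: (g x) => a b; exact: normc_le.
  have b0 := le_trans (normc_ge0 _) (b1 x).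
  by apply: (le_trans (ler_wpM2r b0 gle)); rewrite /G -mulrDr [leLHS]mulrC [leRHS]mulrA.
have IE : cintegral setT (fun x => g x * psi x) =
    cintegral setT (fun x => g x * psi1 x) + cintegral setT (fun x => g x * psi2 x).
  rewrite -cintegralD//; congr cintegral; apply/funext => x /=.
  by rewrite [in LHS]psiE /= mulrDr.
have TE : T psi = T psi1 + T psi2 by rewrite [in LHS]psiE TD.
have TN2 : normc (T psi2) <= C * ((D1 + D2) / s).
  apply: TN => // j k jN kN; apply: le2; exact: leq_trans (leq_maxl N 2).
rewrite TE IE (Tg _ t1) opprD addrACA subrr add0r.
apply: (le_trans (le_normcD _ _)); rewrite normcN.
apply: (le_trans (lerD TN2 n2)); rewrite (IntZ _ mT iG).
by rewrite le_eqVlt; apply/orP; left; apply/eqP; ring.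
Qed.

End schwartz_cutoff.

(** * Functionals vanishing off the spectrum *)

Section spectral_vanishing.
Import ComplexField.Normc.
Local Open Scope complex_scope.
Context {R : realType}.
Implicit Types (f : R -> R) (phi psi : R -> R[i]) (a b t x d s L : R).

Definition ctst phi := smooth (re phi) /\ smooth (im phi).

Definition van a t phi := forall x, x <= a \/ t <= x -> phi x = 0.

Lemma ctst_mul f phi : smooth f -> ctst phi -> ctst (fun x => (f x)%:C * phi x).
Proof.
move=> sf [s1 s2]; split.
  have -> : re (fun x => (f x)%:C * phi x) = fun x => f x * re phi x.
    by apply/funext => x; rewrite /re; case: (phi x) => p q /=; rewrite mul0r subr0.
  exact: smoothM.
have -> : im (fun x => (f x)%:C * phi x) = fun x => f x * im phi x.
  by apply/funext => x; rewrite /im; case: (phi x) => p q /=; rewrite mul0r addr0.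
exact: smoothM.
Qed.

Lemma ex_step a b : a < b -> exists f, [/\ smooth f, forall x, x <= a -> f x = 0 & forall x, b <= x -> f x = 1].
Proof.
move=> ab; have [S [sS _ S0 S1]] := @ex_smooth_step R; have ba : 0 < b - a by rewrite subr_gt0.
exists (fun x => S ((b - a)^-1 * x + - ((b - a)^-1 * a))); split; first exact: smooth_affine.
  move=> x xa; apply: S0; rewrite -mulrBr; apply: mulr_ge0_le0; last by rewrite subr_le0.
  by rewrite invr_ge0 ltW.
by move=> x bx; apply: S1; rewrite -mulrBr mulrC ler_pdivlMr// mul1r lerB.
Qed.

(** A supremum argument in place of a partition of unity: a function reaching slightly beyond sup E
    is split by a smooth step into one handled by [E] and one handled by the local hypothesis at sup
    E, so the supremum is [b]. *)
Lemma local_vanishing (Q : (R -> R[i]) -> Prop) a b : a <= b ->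
  Q (fun=> 0) -> (forall phi psi, ctst phi -> ctst psi -> van a b phi -> van a b psi ->
    Q phi -> Q psi -> Q (phi \+ psi)%R) ->
  (forall x, a <= x <= b -> exists2 d, 0 < d & forall phi, ctst phi -> van (x - d) (x + d) phi -> Q phi) ->
  forall phi, ctst phi -> van a b phi -> Q phi.
Proof.
move=> ab Q0 QD Ql.
pose E : set R := [set t | a <= t <= b /\ forall phi, ctst phi -> van a t phi -> Q phi].
have Ea : E a.
  split; first by rewrite lexx.
  move=> phi _ pv; rewrite (_ : phi = fun=> 0)//; apply/funext => x; apply: pv.
  by have [xa|xa] := leP x a; [left|right; exact: ltW].
have hE : has_sup E by split; [exists a|exists b => t [/andP[]]].
have sa : a <= sup E by apply: sup_upper_bound.
have sb : sup E <= b by apply: ge_sup; [exists a|move=> t [/andP[]]].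
have [d d0 hd] := Ql (sup E) (introT andP (conj sa sb)).
have [t Et ts] := sup_adherent d0 hE.
have ts' : t <= sup E by apply: sup_upper_bound.
pose t' := Num.min b (sup E + d / 2).
have [/andP[at_ tb] Pt] := Et.
(* This point lies strictly between sup E - d and [t]; a step rising from it to [t] leaves one piece
   supported in [a, t] and the other in the neighbourhood of sup E. *)
have al : (2 * (sup E - d) + t) / 3 < t by lra.
have [S [sS S0 S1]] := ex_step al.
have Et' : E t'.
  split; first by rewrite /t' le_min ab ge_min lexx/= andbT; lra.
  move=> phi cphi vphi.
  have s1S : smooth (fun x => 1 - S x) by apply: smoothB; [exact: smooth_cst|exact: sS].
  have t'b : t' <= b by rewrite /t' ge_min lexx.
  have -> : phi = ((fun x => (1 - S x)%:C * phi x) \+ (fun x => (S x)%:C * phi x))%R.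
    apply/funext => x /=; rewrite -mulrDl -rmorphD.
    by rewrite subrK mul1r.
  apply: QD.
  - exact: ctst_mul.
  - exact: ctst_mul.
  - move=> x [xa|xb]; rewrite (vphi x) ?mulr0//; [by left|right; exact: le_trans t'b xb].
  - move=> x [xa|xb]; rewrite (vphi x) ?mulr0//; [by left|right; exact: le_trans t'b xb].
  - apply: Pt; first exact: ctst_mul.
    move=> x [xa|xt]; first by rewrite (vphi x) ?mulr0//; left.
    by rewrite (S1 _ xt) subrr mul0r.
  apply: hd; first exact: ctst_mul.
  move=> x [xa|xt]; first by rewrite S0 ?mul0r//; lra.
  rewrite (vphi x) ?mulr0//; right; apply: le_trans xt.
  by rewrite /t' ge_min; apply/orP; right; lra.
have t's : t' <= sup E by apply: sup_upper_bound.
have eb : t' = b.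
  move: t's; rewrite /t' minEle; case: ifP => // _ h; exfalso; lra.
by move: Et'; rewrite eb => -[].
Qed.

Lemma schwartz_fourier L phi : 0 <= L -> ctest L (re phi) -> ctest L (im phi) ->
  schwartz (fourier phi).
Proof.
move=> L0 c1 c2; apply: schwartz_parts.
  rewrite (_ : re (fourier phi) = fun xi => FT 0 (re phi) xi + FT (- (pi / 2)) (im phi) xi).
    by apply: rschwartzD; [exact: FT_rschwartz L0 c1|exact: FT_rschwartz L0 c2].
  by apply/funext => xi; exact: re_fourier L0 c1 c2.
rewrite (_ : im (fourier phi) = fun xi => FT 0 (im phi) xi - FT (- (pi / 2)) (re phi) xi).
  by apply: rschwartzB; [exact: FT_rschwartz L0 c2|exact: FT_rschwartz L0 c1].
by apply/funext => xi; exact: im_fourier L0 c1 c2.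
Qed.

Lemma fourierD L phi psi : 0 <= L -> ctest L (re phi) -> ctest L (im phi) ->
  ctest L (re psi) -> ctest L (im psi) -> fourier (phi \+ psi)%R = (fourier phi \+ fourier psi)%R.
Proof.
move=> L0 p1 p2 q1 q2; apply/funext => xi /=; rewrite /fourier -cintegralD.
- by congr cintegral; apply/funext => x /=; rewrite mulrDr.
- split.
    have -> : re (fun x => (cos (xi * x) -i* sin (xi * x)) * phi x) =
      fun x => re phi x * cos (xi * x + 0) + im phi x * cos (xi * x + (- (pi / 2))).
      apply/funext => x; rewrite /re /im addr0 (cosB (xi * x)) cos_pihalf sin_pihalf.
      by case: (phi x) => a b /=; ring.
    exact: (intgD measurableT_lebT (FT_intg _ _ L0 p1) (FT_intg _ _ L0 p2)).
  have -> : im (fun x => (cos (xi * x) -i* sin (xi * x)) * phi x) =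
    fun x => im phi x * cos (xi * x + 0) - re phi x * cos (xi * x + (- (pi / 2))).
    apply/funext => x; rewrite /re /im addr0 (cosB (xi * x)) cos_pihalf sin_pihalf.
    by case: (phi x) => a b /=; ring.
  exact: (intgB measurableT_lebT (FT_intg _ _ L0 p2) (FT_intg _ _ L0 p1)).
- split.
    have -> : re (fun x => (cos (xi * x) -i* sin (xi * x)) * psi x) =
      fun x => re psi x * cos (xi * x + 0) + im psi x * cos (xi * x + (- (pi / 2))).
      apply/funext => x; rewrite /re /im addr0 (cosB (xi * x)) cos_pihalf sin_pihalf.
      by case: (psi x) => a b /=; ring.
    exact: (intgD measurableT_lebT (FT_intg _ _ L0 q1) (FT_intg _ _ L0 q2)).
  have -> : im (fun x => (cos (xi * x) -i* sin (xi * x)) * psi x) =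
    fun x => im psi x * cos (xi * x + 0) - re psi x * cos (xi * x + (- (pi / 2))).
    apply/funext => x; rewrite /re /im addr0 (cosB (xi * x)) cos_pihalf sin_pihalf.
    by case: (psi x) => a b /=; ring.
  exact: (intgB measurableT_lebT (FT_intg _ _ L0 q2) (FT_intg _ _ L0 q1)).
Qed.

Lemma van_ctest a b phi : ctst phi -> van a b phi ->
  ctest (`|a| + `|b|) (re phi) /\ ctest (`|a| + `|b|) (im phi).
Proof.
move=> [s1 s2] v; have z x : `|a| + `|b| < `|x| -> phi x = 0.
  move=> xl; apply: v; have [xa|xa] := leP x a; first by left.
  right; have [x0|x0] := leP 0 x.
    rewrite (ger0_norm x0) in xl; have := ler_norm b; have := normr_ge0 a; lra.
  rewrite (ltr0_norm x0) in xl; have := ler_norm (- a); rewrite normrN; have := normr_ge0 b; lra.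
by split; split => // x /z h; rewrite /re /im h.
Qed.

(* [phi] is split at the origin into two pieces supported in intervals on
   which the transform vanishes locally, hence globally. *)
Lemma dist_fourier_vanish (T : (R -> R[i]) -> R[i]) s s' L phi : tempered T ->
  dist_supp (dist_fourier T) `<=` `[- s, s] -> 0 <= s -> s < s' -> 0 <= L ->
  ctest L (re phi) -> ctest L (im phi) -> (forall x, `|x| <= s' -> phi x = 0) ->
  T (fourier phi) = 0.
Proof.
move=> [TD TZ _] Ts s0 ss L0 c1 c2 p0.
pose Q psi := T (fourier psi) = 0.
have T0 : T (fun=> 0) = 0.
  have sz : schwartz (fun=> 0 : R[i]).
    have z : ctest 0 (fun=> 0 : R) by split; [exact: smooth_cst|].
    by apply: schwartz_parts; split; rewrite /re /im /=; try exact: smooth_cst;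
      move=> j k; exists 0 => x; rewrite (le_trans (ler_wpM2l (exprn_ge0 _ (normr_ge0 _)) (derive1n_cst_le _ _ _)))// normr0 mulr0.
  have h := TZ 0 _ sz; rewrite [RHS]mul0r in h; rewrite -[RHS]h.
  by congr T; apply/funext => x; rewrite mul0r.
have F0 : fourier (fun=> 0 : R[i]) = fun=> 0.
  apply/funext => xi; rewrite /fourier /cintegral.
  rewrite (_ : re _ = fun=> 0); last by apply/funext => x; rewrite /re mulr0.
  rewrite (_ : im _ = fun=> 0); last by apply/funext => x; rewrite /im mulr0.
  by have := @Int0 R setT; rewrite /Int => ->.
have Q0 : Q (fun=> 0) by rewrite /Q F0.
have QD a b p q : ctst p -> ctst q -> van a b p -> van a b q -> Q p -> Q q -> Q (p \+ q)%R.
  move=> cp cq vp vq Qp Qq; have [p1 p2] := van_ctest cp vp; have [q1 q2] := van_ctest cq vq.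
  have L' : 0 <= `|a| + `|b| by rewrite addr_ge0.
  rewrite /Q (fourierD L' p1 p2 q1 q2) TD; [|exact: schwartz_fourier L' p1 p2|exact: schwartz_fourier L' q1 q2].
  by rewrite Qp Qq addr0.
have loc x : s < `|x| -> exists2 d, 0 < d & forall p, ctst p -> van (x - d) (x + d) p -> Q p.
  move=> xs; have xn : ~ `[- s, s]%classic x.
    rewrite /= in_itv/= -ler_norml => h; lra.
  have [U [oU Ux vU]] : exists U : set R, [/\ open U, U x & vanishes_on (dist_fourier T) U].
    apply: contrapT => hn; apply: xn; apply: Ts => U oU Ux vU; apply: hn.
    by exists U.
  have [d /= d0 hd] : exists2 d : R, 0 < d & forall y, `|x - y| < d -> U y.
    by have /nbhs_ballP[d d0 hd] := open_nbhs_nbhs (conj oU Ux); exists d.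
  exists (d / 2) => [|p cp vp]; first by rewrite divr_gt0.
  apply: vU; split; first by move=> n y; split; [exact: cp.1|exact: cp.2].
  exists `[x - d / 2, x + d / 2]%classic; split; first exact: segment_compact.
    by move=> y /=; rewrite in_itv/= => /andP[y1 y2]; apply: hd; rewrite ltr_norml; apply/andP; split; lra.
  move=> y /=; rewrite in_itv/= => yn; apply: vp.
  have [h|h] := leP y (x - d / 2); first by left.
  right; rewrite leNgt; apply/negP => h2; apply: yn.
  by apply/andP; split; exact: ltW.
have cphi : ctst phi by split; [exact: c1.1|exact: c2.1].
have ssN : - s' < s' by lra.
have [S [sS S0 S1]] := ex_step ssN.
have s1S : smooth (fun x => 1 - S x) by apply: smoothB; [exact: smooth_cst|exact: sS].
have zL x : L < `|x| -> phi x = 0.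
  move=> xL; have := c1.2 x xL; have := c2.2 x xL; rewrite /re /im.
  by case: (phi x) => p q /= -> ->.
pose b := Num.max s' (L + 1).
have sb : s' <= b by rewrite /b le_max lexx.
have Lb : L < b by rewrite /b lt_max; apply/orP; right; lra.
have zb x : b <= `|x| -> phi x = 0 by move=> xb; apply: zL; exact: lt_le_trans xb.
have -> : phi = ((fun x => (1 - S x)%:C * phi x) \+ (fun x => (S x)%:C * phi x))%R.
  by apply/funext => x /=; rewrite -mulrDl -rmorphD subrK mul1r.
have v1 : van (- b) (- s') (fun x => (1 - S x)%:C * phi x).
  move=> x [xb|xs]; first by rewrite zb ?mulr0// ler0_norm; lra.
  have [xs'|xs'] := leP x s'; first by rewrite p0 ?mulr0// ler_norml; apply/andP; split; lra.
  by rewrite S1 ?ltW// subrr mul0r.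
have v2 : van s' b (fun x => (S x)%:C * phi x).
  move=> x [xs|xb]; last by rewrite zb ?mulr0// ger0_norm; lra.
  have [xs'|xs'] := leP (- s') x; first by rewrite p0 ?mulr0// ler_norml; apply/andP; split; lra.
  by rewrite S0 ?ltW// mul0r.
apply: (QD (- b) b).
- exact: ctst_mul.
- exact: ctst_mul.
- by move=> x [xb|xb]; apply: v1; [left|right; lra].
- by move=> x [xb|xb]; apply: v2; [left; lra|right].
- apply: (local_vanishing _ Q0 (QD (- b) (- s')) _ _ v1); [lra| |exact: ctst_mul].
  by move=> x /andP[x1 x2]; apply: loc; rewrite ler0_norm; lra.
apply: (local_vanishing _ Q0 (QD s' b) _ _ v2); [lra| |exact: ctst_mul].
by move=> x /andP[x1 x2]; apply: loc; rewrite ger0_norm; lra.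
Qed.

End spectral_vanishing.

(** * The reproducing formula *)


Section reproducing_formula.
Import ComplexField.Normc.
Local Open Scope complex_scope.
Context {R : realType} (theta : R -> R) (ctheta : cutoff theta).
Context (X : banach_lattice R) (C : R) (PC : poisson_bounded X C).
Implicit Types (f u K : R -> R) (g : R -> R[i]) (s t x y N M d e : R).
Local Notation vp := (vp theta).
Local Notation rcar := (rcar X).

Let mT := @measurableT_lebT R.

Lemma kernel_intg K M u x : continuous K -> (forall t, `|K t| <= M * pk 1 t) -> rcar u ->
  intg setT (fun y => K (x - y) * u y) /\ `|conv K u x| <= M * pois 1 u x.
Proof. by move=> cK KM uX; exact: (pois_conv PC x ltr01 uX cK KM). Qed.

Lemma pk1_intg_car u : rcar u -> intg setT (fun y => pk 1 y * `|u y|).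
Proof.
move=> uX; have := pois_intg PC 0 ltr01 uX; congr intg.
by apply/funext => y; rewrite /pk sub0r sqrrN.
Qed.

Lemma rschwartzZ (k : R) f : rschwartz f -> rschwartz (fun x => k * f x).
Proof.
move=> [sf hf]; split; first exact: smoothZ.
move=> j i; have [M hM] := hf j i; exists (`|k| * M) => x.
by rewrite derive1nZ// normrM mulrCA ler_wpM2l.
Qed.

Lemma rschwartz_vp s : 0 < s -> rschwartz (vp s).
Proof. by move=> s0; apply: rschwartzZ; exact: vp_rschwartz. Qed.

(** The derivative falls on the kernel because [u] is only an element of X. The remainder is
    dominated since [pk 1] grows by a factor of at most 4 under shifts of length at most 1. *)
Lemma kernel_is_derive K u x : rschwartz K -> rcar u ->
  is_derive x 1 (conv K u) (conv (derive1 K) u x).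
Proof.
move=> rK uX; have rK' := rschwartz_derive1 rK; have rK'' := rschwartz_derive1 rK'.
have [M0 _ h0] := rschwartz_pk rK; have [M1 _ h1] := rschwartz_pk rK'.
have [M M0' h2] := rschwartz_pk rK''.
have cK := smooth_cont rK.1; have cK' := smooth_cont rK'.1.
apply: (@is_derive_quad _ _ _ _ (M * 4 * pois 1 u x) 1 ltr01) => t t1.
have [ia _] := kernel_intg (x + t) cK h0 uX; have [ib _] := kernel_intg x cK h0 uX.
have [ic _] := kernel_intg x cK' h1 uX; have ict := intgZ t mT ic.
rewrite (mulrC _ t) -(IntZ t mT ic) -(IntB mT ia ib) -(IntB mT (intgB mT ia ib) ict).
have ip := intgZ (M * 4 * t ^+ 2) mT (pois_intg PC x ltr01 uX).
have -> : M * 4 * pois 1 u x * t ^+ 2 = Int setT (fun y => M * 4 * t ^+ 2 * (pk 1 (x - y) * `|u y|)).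
  by rewrite (IntZ _ mT (pois_intg PC x ltr01 uX)) mulrAC.
apply: (norm_Int_le mT _ ip).
  by have /measurable_int/measurable_EFinP := intgB mT (intgB mT ia ib) ict.
move=> y _.
have -> : K (x + t - y) * u y - K (x - y) * u y - t * (derive1 K (x - y) * u y) =
    (K (x - y + t) - K (x - y) - derive1 K (x - y) * t) * u y.
  by rewrite (_ : x + t - y = x - y + t); ring.
rewrite normrM mulrA; apply: (ler_wpM2r (normr_ge0 _)).
have -> : M * 4 * t ^+ 2 * pk 1 (x - y) = M * (4 * pk 1 (x - y)) * t ^+ 2 by ring.
apply: (taylor2 rK.1) => z zt; apply: (le_trans (h2 z)); apply: (ler_wpM2l M0').
have := pk_translate (z - (x - y)) (- (x - y)).
rewrite opprK subrK => h; apply: (le_trans h).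
have e : pk 1 (- (x - y)) = pk 1 (x - y) by rewrite /pk sqrrN.
rewrite e; apply: ler_wpM2r; first exact/ltW/pk_gt0.
have v1 : `|z - (x - y)| <= 1 := le_trans zt (ltW t1).
have : (z - (x - y)) ^+ 2 <= 1 by rewrite -real_normK ?num_real// expr_le1.
by move: (_ ^+ 2) => w; lra.
Qed.

Lemma kernel_smooth K u : rschwartz K -> rcar u -> smooth (conv K u).
Proof.
move=> rK uX; apply: (@smooth_coind _ [set f | exists2 K, rschwartz K & f = conv K u]); last by exists K.
move=> _ [{rK}K rK ->]; exists (conv (derive1 K) u).
  by exists (derive1 K) => //; exact: rschwartz_derive1.
by move=> x; exact: kernel_is_derive.
Qed.

(* [u] need not be bounded: away from [x] the kernel is [O (1 / N)] times the
   Poisson kernel, against which [u] is integrable. *)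
Lemma conv_vp_error u x e : continuous u -> rcar u -> 0 < e ->
  exists c, forall N, 1 <= N -> `|conv (vp N) u x - u x| <= e + c / N.
Proof.
move=> cu uX e0; have [M M0 hM] := vp_le ctheta.
set P := Int setT (pk (1 : R)); have P0 : 0 <= P by apply: Int_ge0 => t _; exact/ltW/pk_gt0.
pose e' := e / (M * P + 1); have MP : 0 < M * P + 1 by rewrite ltr_wpDl// mulr_ge0.
have e'0 : 0 < e' by rewrite divr_gt0.
have [d /= d0 hd] : exists2 d : R, 0 < d & forall y, `|x - y| < d -> `|u x - u y| < e'.
  have near_x : \forall y \near x, `|u x - u y| < e' by exact: (@cvgr_dist_lt _ _ _ _ _ u (u x) (cu x) e' e'0).
  by have /nbhs_ballP[d d0 hd] := near_x; exists d => // y xy; exact: (hd y).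
(* [k] bounds H^2 (1 + t^2) / (H^2 + t^2)^2 for |t| >= d and H <= 1: the quotient is at most (1 +
   t^2) / t^4, which decreases in |t|. *)
pose k := (1 + d ^+ 2) / d ^+ 4.
have k0 : 0 <= k by rewrite divr_ge0 ?exprn_ge0 ?(ltW d0)// addr_ge0 ?sqr_ge0.
exists (M * k * (pois 1 u x + `|u x| * P)) => N N1; have N0 : 0 < N := lt_le_trans ltr01 N1.
have H0 : 0 < N^-1 by rewrite invr_gt0.
have H1 : N^-1 <= 1 by rewrite invf_le1.
have cV := vp_cont ctheta N0; have [M' M'0 hM'] := vp_pk ctheta N0.
have [iu _] := kernel_intg x cV hM' uX.
have iV0 : intg setT (vp N).
  exact: (intg_le mT (meas_cont cV) (fun t _ => hM' t) (intgZ M' mT (@pk1_intg R))).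
have [iV eV] := Int_reflect x cV iV0; rewrite Int_vp// in eV.
have iux := intgZ (u x) mT iV.
have -> : conv (vp N) u x - u x = Int setT (fun y => vp N (x - y) * u y - u x * vp N (x - y)).
  by rewrite (IntB mT iu iux) (IntZ _ mT iV) eV mulr1.
have ip := pois_intg PC x ltr01 uX.
have ipk1 := pk_intg x (@ltr01 R); have ipkH := pk_intg x H0.
have ig1 := intgZ (e' * M) mT ipkH; have ig2 := intgZ (M * k * N^-1) mT (intgD mT ip (intgZ `|u x| mT ipk1)).
have PE H : 0 < H -> Int setT (fun y => pk H (x - y)) = P.
  move=> Hp; have Hi : 0 < H^-1 by rewrite invr_gt0.
  have ck : continuous (pk H).
    rewrite (_ : pk H = fun y => pk H (0 - y)); first exact: pk_cont.
    by apply/funext => y; rewrite /pk sub0r sqrrN.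
  have ik : intg setT (pk H).
    by have := pk_intg 0 Hp; congr intg; apply/funext => y; rewrite /pk sub0r sqrrN.
  have [_ ->] := Int_reflect x ck ik.
  have [i2 e2] := Int_affine 0 Hi (@pk1_cont R) (@pk1_intg R).
  rewrite (_ : pk H = fun t => H^-1 * pk 1 (0 + H^-1 * t)); last by apply/funext => t; exact: pkE.
  by rewrite (IntZ _ mT i2) e2 invrK mulrA mulVf ?mul1r// gt_eqF.
apply: (@le_trans _ _ (Int setT (fun y => e' * M * pk N^-1 (x - y) +
    M * k * N^-1 * (pk 1 (x - y) * `|u y| + `|u x| * pk 1 (x - y))))); last first.
  rewrite (IntD mT ig1 ig2) (IntZ _ mT ipkH) (IntZ _ mT (intgD mT ip (intgZ `|u x| mT ipk1))).
  rewrite (IntD mT ip (intgZ `|u x| mT ipk1)) (IntZ _ mT ipk1) (PE _ H0) (PE _ ltr01).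
  rewrite -/(pois 1 u x); apply: lerD; last by rewrite mulrAC.
  by rewrite /e' -mulrA mulrAC ler_pdivrMr// ler_wpM2l ?(ltW e0)// lerDl.
apply: (norm_Int_le mT _ (intgD mT ig1 ig2)).
  by have /measurable_int/measurable_EFinP := intgB mT iu iux.
move=> y _; rewrite (mulrC (u x)) -mulrBr normrM.
have pkH0 : 0 <= pk N^-1 (x - y) by exact/ltW/pk_gt0.
have pk10 : 0 <= pk 1 (x - y) by exact/ltW/pk_gt0.
have VN := hM N (x - y) N0.
have VM : `|vp N (x - y)| <= M * pk N^-1 (x - y).
  apply: le_trans VN; rewrite -[leLHS]mul1r; apply: ler_wpM2r; first exact: normr_ge0.
  by rewrite lerDl sqr_ge0.
have [xy|xy] := ltP `|x - y| d.
  have := ltW (hd y xy); rewrite distrC => h.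
  have z0 : 0 <= M * k * N^-1 * (pk 1 (x - y) * `|u y| + `|u x| * pk 1 (x - y)).
    apply: mulr_ge0; first by rewrite mulr_ge0 ?(ltW H0)// mulr_ge0.
    by rewrite addr_ge0// mulr_ge0.
  apply: (le_trans (ler_pM (normr_ge0 _) (normr_ge0 _) VM h)).
  have -> : M * pk N^-1 (x - y) * e' = e' * M * pk N^-1 (x - y) by ring.
  by rewrite lerDl.
have Vk : `|vp N (x - y)| <= M * k * N^-1 * pk 1 (x - y).
  set t := x - y in xy VN *.
  have t2 : d ^+ 2 <= t ^+ 2 by rewrite -[leRHS]real_normK ?num_real// ler_pXn2r ?nnegrE// ltW.
  have d2 : 0 < d ^+ 2 by rewrite exprn_gt0.
  have D : 0 < 1 + (t / N^-1) ^+ 2 by rewrite ltr_pwDl ?sqr_ge0.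
  have VN' : `|vp N t| <= M * pk N^-1 t / (1 + (t / N^-1) ^+ 2) by rewrite ler_pdivlMr// mulrC.
  apply: (le_trans VN').
  set H := N^-1 in H0 H1 VN VN' *; have NH : N = H^-1 by rewrite invrK.
  have a0 : 0 < t ^+ 2 := lt_le_trans d2 t2.
  have b0 : 0 < H ^+ 2 + t ^+ 2 by rewrite ltr_wpDl ?sqr_ge0.
  have c0 : 0 < 1 + t ^+ 2 by rewrite ltr_pwDl ?sqr_ge0.
  have -> : M * pk H t / (1 + (t / H) ^+ 2) = M * (H * (H ^+ 2 / (H ^+ 2 + t ^+ 2) ^+ 2)).
    rewrite /pk; have -> : 1 + (t / H) ^+ 2 = (H ^+ 2 + t ^+ 2) / H ^+ 2 by field; rewrite gt_eqF.
    by field; rewrite !gt_eqF.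
  have -> : M * k * H * pk 1 t = M * (H * ((1 + d ^+ 2) / d ^+ 4 / (1 + t ^+ 2))).
    by rewrite /k /pk expr1n mul1r; ring.
  apply: (ler_wpM2l M0); apply: (ler_wpM2l (ltW H0)).
  rewrite ler_pdivlMr// mulrAC ler_pdivrMr ?exprn_gt0//.
  have d4 : d ^+ 4 = (d ^+ 2) ^+ 2 by rewrite -exprM.
  have -> : (1 + d ^+ 2) / d ^+ 4 * (H ^+ 2 + t ^+ 2) ^+ 2 = ((1 + d ^+ 2) * (H ^+ 2 + t ^+ 2) ^+ 2) / d ^+ 4 by ring.
  rewrite ler_pdivlMr ?exprn_gt0// d4.
  have h2 : H ^+ 2 <= 1 by rewrite expr_le1// ltW.
  move: (d ^+ 2) (t ^+ 2) (H ^+ 2) (sqr_ge0 H) d2 a0 t2 h2 => p q w w0 p0 q0 pq w1.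
  have s1 : w * (1 + q) * p ^+ 2 <= (1 + q) * p ^+ 2.
    by rewrite -mulrA ler_piMl// mulr_ge0 ?sqr_ge0//; lra.
  apply: (le_trans s1).
  have s2 : (1 + q) * p ^+ 2 <= (1 + p) * q ^+ 2.
    have i1 : p ^+ 2 <= q ^+ 2 by rewrite ler_pXn2r ?nnegrE// ltW.
    have i2 : q * p * p <= q * p * q by apply: ler_wpM2l => //; rewrite mulr_ge0// ltW.
    have -> : (1 + q) * p ^+ 2 = p ^+ 2 + q * p * p by ring.
    have -> : (1 + p) * q ^+ 2 = q ^+ 2 + q * p * q by ring.
    exact: lerD.
  apply: (le_trans s2); apply: ler_wpM2l; first lra.
  have [w0q qwq] : 0 <= q /\ q <= w + q by lra.
  by rewrite ler_pXn2r ?nnegrE// addr_ge0.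
apply: (@le_trans _ _ (M * k * N^-1 * (pk 1 (x - y) * `|u y| + `|u x| * pk 1 (x - y)))); last first.
  by rewrite lerDr; apply: mulr_ge0 => //; exact: mulr_ge0 (ltW e'0) M0.
apply: (le_trans (ler_pM (normr_ge0 _) (normr_ge0 _) Vk (ler_normB _ _))).
by rewrite le_eqVlt; apply/orP; left; apply/eqP; ring.
Qed.

End reproducing_formula.

(** * Reproduction of band-limited functions *)

Section bandlimited_functions.
Import ComplexField.Normc.
Local Open Scope complex_scope.
Context {R : realType} (theta : R -> R) (ctheta : cutoff theta).
Context (X : banach_lattice R) (C : R) (PC : poisson_bounded X C).
Implicit Types (f u K : R -> R) (g : R -> R[i]) (s t x y N M d e : R).
Local Notation vp := (vp theta).
Local Notation rcar := (rcar X).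

Let mT := @measurableT_lebT R.

Lemma Int_odd f : continuous f -> intg setT f -> (forall x, f (- x) = - f x) -> Int setT f = 0.
Proof.
move=> cf fi fo; have [_] := Int_opp cf fi; rewrite (funext fo) => h.
have := IntZ (-1) mT fi; rewrite (eq_Int (g := fun x => - f x)) ?h; first by lra.
by move=> x _; rewrite mulN1r.
Qed.

Lemma re_mul_real g (psi : R -> R) : re (fun y => g y * (psi y)%:C) = fun y => re g y * psi y.
Proof. by apply/funext => y; rewrite /re; case: (g y) => a b /=; rewrite mulr0 subr0. Qed.

Lemma im_mul_real g (psi : R -> R) : im (fun y => g y * (psi y)%:C) = fun y => im g y * psi y.
Proof. by apply/funext => y; rewrite /im; case: (g y) => a b /=; rewrite mulr0 add0r. Qed.

(** This is c(xi) exp(i x xi), a sine being a cosine of phase - pi / 2; for even [c] its Fourier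
    transform is the cosine transform of [c] recentred at [x]. *)
Let phase (c : R -> R) x : R -> R[i] := fun xi =>
  (c xi * cos (x * xi + 0)) +i* (c xi * cos (x * xi + (- (pi / 2)))).

Lemma fourier_phase L (c : R -> R) x y : 0 <= L -> ctest L c -> (forall e, c (- e) = c e) ->
  [/\ ctest L (re (phase c x)), ctest L (im (phase c x)) & fourier (phase c x) y = (FT 0 c (x - y))%:C].
Proof.
move=> L0 cc ce; have scos b : smooth (fun e => cos (x * e + b)).
  rewrite (_ : (fun e => _) = fun e => 1 * cos (x * e + b)); first exact: smooth_cosin.
  by apply/funext => e; rewrite mul1r.
have c1 : ctest L (re (phase c x)).
  rewrite (_ : re _ = fun e => cos (x * e + 0) * c e); first exact: ctestM cc (scos 0).
  by apply/funext => e; rewrite /re /= mulrC.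
have c2 : ctest L (im (phase c x)).
  rewrite (_ : im _ = fun e => cos (x * e + (- (pi / 2))) * c e); first exact: ctestM cc (scos _).
  by apply/funext => e; rewrite /im /= mulrC.
have E1 : re (fourier (phase c x)) y = FT 0 c (x - y).
  rewrite (re_fourier y L0 c1 c2) /FT.
  rewrite -(IntD mT (FT_intg _ _ L0 c1) (FT_intg _ _ L0 c2)); apply: eq_Int => e _.
  rewrite /re /im /= !addr0 !(cosB (_ * _)) cos_pihalf sin_pihalf mulrBl cosB; ring.
have E2 : im (fourier (phase c x)) y = 0.
  rewrite (im_fourier y L0 c1 c2).
  rewrite /FT -(IntB mT (FT_intg _ _ L0 c2) (FT_intg _ _ L0 c1)); apply: Int_odd.
  - move=> e; apply: cvgB; apply: cvgM; try exact: cos_affine_cont.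
      exact: (smooth_cont c2.1).
    exact: (smooth_cont c1.1).
  - exact: (intgB mT (FT_intg _ _ L0 c2) (FT_intg _ _ L0 c1)).
  move=> e; rewrite /re /im /= ce !addr0 !mulrN !(cosB (- _)) !(cosB (_ * _)) !cosN !sinN cos_pihalf sin_pihalf.
  ring.
split; [exact: c1|exact: c2|].
by move: E1 E2; rewrite /re /im; case: (fourier _ y) => a b /= -> ->.
Qed.

(** Both cutoffs are 1 on |xi| <= 3 s / 2, so the transform of vp N - vp M vanishes on a
    neighbourhood of the spectrum of [g]. Any factor above 2 would do in place of 3:
    [dist_fourier_vanish] asks for room beyond [s]. *)
Lemma conv_const s g N M x : bandlimited X s g -> 0 < s -> 3 * s <= N -> 3 * s <= M ->
  conv (vp N) (re g) x = conv (vp M) (re g) x /\ conv (vp N) (im g) x = conv (vp M) (im g) x.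
Proof.
move=> [gX cg [T [tT Tg Ts]]] s0 sN sM.
have [g1 _] := car_re gX; have [g2 _] := car_im gX.
have N0 : 0 < N by lra. have M0 : 0 < M by lra.
pose c e := (kap theta)^-1 * (dil theta N e - dil theta M e).
pose L := Num.max N M; have L0 : 0 <= L by rewrite le_max (ltW N0).
have NL : N <= L by rewrite le_max lexx.
have ML : M <= L by rewrite le_max lexx orbT.
have [cN zN] := dil_ctest ctheta N0; have [cM zM] := dil_ctest ctheta M0.
have zN' := suppW NL zN; have zM' := suppW ML zM.
have cc : ctest L c.
  split; first by apply: smoothZ; exact: smoothB.
  by move=> e eL; rewrite /c zN' ?zM'// subrr mulr0.
have ce e : c (- e) = c e.
  have [_ _ ev _ _] := ctheta; rewrite /c /dil !addr0 !mulrN !ev//.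
have FE y : FT 0 c (x - y) = vp N (x - y) - vp M (x - y).
  have iN := FT_intg 0 (x - y) L0 (conj cN zN'); have iM := FT_intg 0 (x - y) L0 (conj cM zM').
  rewrite /vp -mulrBr /FT -(IntB mT iN iM) -(IntZ _ mT (intgB mT iN iM)); apply: eq_Int => e _.
  by rewrite /c -mulrA mulrBl.
have [c1 c2 _] := fourier_phase x 0 L0 cc ce.
have ss : s < 3 * s / 2 by lra.
have z : T (fourier (phase c x)) = 0.
  apply: (dist_fourier_vanish tT Ts (ltW s0) ss L0 c1 c2) => xi xs.
  have z0 : c xi = 0 by rewrite /c !dil_eq1 ?subrr ?mulr0//; lra.
  by rewrite /phase z0 !mul0r.
have FP : fourier (phase c x) = fun y => (vp N (x - y) - vp M (x - y))%:C.
  by apply/funext => y; have [_ _ ->] := fourier_phase x y L0 cc ce; rewrite FE.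
have sF := schwartz_fourier L0 c1 c2.
have := represented_schwartz ctheta tT Tg cg (pk1_intg_car PC g1) (pk1_intg_car PC g2) sF.
rewrite z FP /cintegral re_mul_real im_mul_real => /esym/eqP.
rewrite eq_complex /= => /andP[/eqP e1 /eqP e2].
have [B1 _ h1] := vp_pk ctheta N0; have [B2 _ h2] := vp_pk ctheta M0.
have cvN := vp_cont ctheta N0; have cvM := vp_cont ctheta M0.
have E u : rcar u -> Rintegral (leb R) setT (fun y => u y * (vp N (x - y) - vp M (x - y))) = 0 ->
    conv (vp N) u x = conv (vp M) u x.
  move=> uX h; have [i1 _] := kernel_intg PC x cvN h1 uX; have [i2 _] := kernel_intg PC x cvM h2 uX.
  apply/eqP; rewrite -subr_eq0 /conv -(IntB mT i1 i2); apply/eqP; rewrite -[RHS]h.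
  by apply: eq_Int => y _; rewrite mulrBr !(mulrC (u y)).
by split; [exact: E g1 e1|exact: E g2 e2].
Qed.

(** By [conv_const] the convolution no longer depends on N once N >= 3 s, while by [conv_vp_error]
    it tends to [g] pointwise. *)
Lemma reproducing s g : bandlimited X s g -> 0 < s ->
  re g = conv (vp (3 * s)) (re g) /\ im g = conv (vp (3 * s)) (im g).
Proof.
move=> bg s0; have [gX [cg1 cg2] _] := bg.
have [g1 _] := car_re gX; have [g2 _] := car_im gX.
have lim u x : continuous u -> rcar u ->
    (forall N, 3 * s <= N -> conv (vp N) u x = conv (vp (3 * s)) u x) -> u x = conv (vp (3 * s)) u x.
  move=> cu uX h; apply/eqP; rewrite eq_sym -subr_eq0 -normr_eq0; apply/eqP.
  set a := `|_|; have a0 : 0 <= a by exact: normr_ge0.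
  apply/eqP; rewrite eq_le a0 andbT leNgt; apply/negP => ap.
  have e0 : 0 < a / 2 by rewrite divr_gt0.
  have [c hc] := conv_vp_error ctheta PC x cu uX e0.
  pose N := Num.max (3 * s) (1 + `|c| * 4 / a).
  have N1 : 1 <= N by rewrite le_max; apply/orP; right; rewrite lerDl divr_ge0 ?(ltW ap)// mulr_ge0.
  have sN : 3 * s <= N by rewrite le_max lexx.
  have := hc N N1; rewrite h// -/a => ha.
  have N0 : 0 < N := lt_le_trans ltr01 N1.
  have cN : c / N <= a / 4.
    rewrite ler_pdivrMr//; apply: (le_trans (ler_norm c)).
    have : 1 + `|c| * 4 / a <= N by rewrite le_max lexx orbT.
    move=> /(ler_wpM2l (ltW ap)); rewrite mulrDr mulr1 mulrCA divff ?gt_eqF// mulr1 => h4.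
    lra.
  lra.
split; apply/funext => x.
  by apply: (lim _ _ cg1 g1) => N sN; have [e _] := conv_const x bg s0 sN (lexx _); exact: e.
by apply: (lim _ _ cg2 g2) => N sN; have [_ e] := conv_const x bg s0 sN (lexx _); exact: e.
Qed.

Lemma bandlimited_smooth s g : bandlimited X s g -> 0 < s -> smooth (re g) /\ smooth (im g).
Proof.
move=> bg s0; have [e1 e2] := reproducing bg s0; have [gX _ _] := bg.
have s3 : 0 < 3 * s by rewrite mulr_gt0.
have [g1 _] := car_re gX; have [g2 _] := car_im gX; rewrite e1 e2.
split; apply: (kernel_smooth PC) => //; exact: rschwartz_vp.
Qed.

Lemma conv_vp_pois : exists2 M, 0 <= M & forall s u x, 0 < s -> rcar u ->
  `|conv (vp s) u x| <= M * pois s^-1 u x.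
Proof.
have [M M0 hM] := vp_le ctheta; exists M => // s u x s0 uX.
have si : 0 < s^-1 by rewrite invr_gt0.
have VM t : `|vp s t| <= M * pk s^-1 t.
  apply: le_trans (hM s t s0); rewrite -[leLHS]mul1r; apply: ler_wpM2r; first exact: normr_ge0.
  by rewrite lerDl sqr_ge0.
by have [] := pois_conv PC x si uX (vp_cont ctheta s0) VM.
Qed.

End bandlimited_functions.

(** * Sampled norms *)


Section sampling_steps.
Import ComplexField.Normc.
Local Open Scope complex_scope.
Context {R : realType} (x : int -> R) (al be : R).
Hypotheses (al0 : 0 < al) (gap : forall k, al <= x (k + 1) - x k <= be).
Implicit Types (f g : R -> R[i]) (t c H : R) (k l : int) (n m : nat).

Local Notation I k := (`[x k, x (k + 1)[%classic).

Lemma node_ge k n : x k <= x (k + n%:Z).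
Proof.
elim: n => [|n IH]; first by rewrite addr0.
apply: (le_trans IH); have /andP[h _] := gap (k + n%:Z).
by rewrite intS (addrC 1) addrA -subr_ge0; exact: le_trans (ltW al0) h.
Qed.

Lemma node_inj k l t : x k <= t -> t < x (k + 1) -> x l <= t -> t < x (l + 1) -> k = l.
Proof.
have H a b : t < x (a + 1) -> x b <= t -> ~ (a < b).
  move=> a2 b1; rewrite -lezD1 => ab; have := node_ge (a + 1) (absz (b - (a + 1))%R).
  have -> : a + 1 + Posz (absz (b - (a + 1))%R) = b by rewrite gez0_abs ?subr_ge0// [LHS]addrC subrK.
  by move=> h; lra.
move=> k1 k2 l1 l2; case: (ltgtP k l) => //.
  by move=> /(H k l k2 l1).
by move=> /(H l k l2 k1).
Qed.

Lemma sample_step_in f k t : x k <= t -> t < x (k + 1) -> sample_step x f t = normc (f (x k)).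
Proof.
move=> k1 k2; rewrite /sample_step -(@fsbig_widen _ _ _ _ [set k])//.
  rewrite fsbig_set1 indicE mem_set ?mulr1//.
  by rewrite /= in_itv/= k1 k2.
move=> l [_ lk]; rewrite /= indicE memNset ?mulr0//.
rewrite /= in_itv/= => /andP[l1 l2]; apply: lk.
exact: (node_inj l1 l2 k1 k2).
Qed.

Lemma sample_step_out f t : (forall k, ~ (x k <= t < x (k + 1))) -> sample_step x f t = 0.
Proof.
move=> h; apply: fsbig1 => k _; rewrite indicE memNset ?mulr0//.
by rewrite /= in_itv/=; exact: h.
Qed.

(** Reduces pointwise estimates of step functions to single nodes; the second alternative spares a
    proof that the cells cover the line. *)
Lemma sample_stepP t : (exists2 k, x k <= t < x (k + 1) & forall f, sample_step x f t = normc (f (x k))) \/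
  (forall f, sample_step x f t = 0).
Proof.
have [[k kt]|h] := pselect (exists k, x k <= t < x (k + 1)).
  by left; exists k => // f; have /andP[k1 k2] := kt; exact: sample_step_in.
by right=> f; apply: sample_step_out => k kt; apply: h; exists k.
Qed.

Lemma sample_step_ge0 f t : 0 <= sample_step x f t.
Proof. by have [[k _ ->]|->//] := sample_stepP t; exact: normc_ge0. Qed.

Lemma meas_sample_step f : meas (sample_step x f).
Proof.
pose J n (i : nat) : int := i%:Z - n%:Z.
pose h n t := \sum_(0 <= i < n.*2.+1) normc (f (x (J n i))) * \1_(I (J n i)) t.
apply: (@measurable_fun_cvg _ (lebT R) R setT h).
  move=> n; apply: measurable_sum => i; apply: measM; first exact: meas_cst.
  by apply: meas_indic; exact: measurable_itv_lebT.
move=> t _; have [[k /andP[k1 k2] ->]|h0] := pselect (exists2 k, x k <= t < x (k + 1) & sample_step x f t = normc (f (x k))).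
  apply: (@cvg_trans _ ((fun=> normc (f (x k)) : R) @ \oo)); last exact: cvg_cst.
  apply: near_eq_cvg; near=> n; rewrite /h.
  have kn : (absz k <= n)%N by near: n; exact: nbhs_infty_ge.
  have kJ : k = J n (absz (k + n%:Z)%R) by rewrite /J gez0_abs ?addrK//; lia.
  have hm : absz (k + n%:Z)%R \in index_iota 0 n.*2.+1 by rewrite mem_index_iota; lia.
  rewrite (bigD1_seq _ hm (iota_uniq _ _)).
  have kI : I k t by rewrite /= in_itv/= k1 k2.
  rewrite /= -kJ indicE (mem_set kI) mulr1 big1 ?addr0// => i ik.
  rewrite indicE memNset ?mulr0// => /=; rewrite in_itv/= => /andP[i1 i2].
  by have e := node_inj i1 i2 k1 k2; move: ik; rewrite -e /J subrK absz_nat eqxx.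
have hs : sample_step x f t = 0.
  by have [[k kt e]|->//] := sample_stepP t; exfalso; apply: h0; exists k.
rewrite hs; apply: (@cvg_trans _ ((fun=> 0 : R) @ \oo)); last exact: cvg_cst.
apply: near_eq_cvg; near=> n; rewrite /h big1// => i _.
rewrite indicE memNset ?mulr0// => /=; rewrite in_itv/= => /andP[i1 i2].
by apply: h0; exists (J n i); [rewrite i1|exact: sample_step_in].
Unshelve. all: by end_near.
Qed.

Context (X : banach_lattice R).
Local Notation rcar := (rcar X).
Local Notation rn := (rn X).

Definition sfin f := rcar (sample_step x f).
Definition sn f := rn (sample_step x f).

Lemma sample_enormE f : sfin f -> sample_enorm X x f = (sn f)%:E.
Proof. by move=> h; rewrite /sample_enorm /bl_enorm asboolT. Qed.

Lemma sample_enorm_fin f : (sample_enorm X x f < +oo)%E -> sfin f.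
Proof. by rewrite /sample_enorm /bl_enorm; case: asboolP => // _; rewrite ltxx. Qed.

Lemma sample_dom f (v : R -> R) : rcar v -> (forall t, sample_step x f t <= v t) ->
  sfin f /\ sn f <= rn v.
Proof.
move=> vX h; apply: rideal => //; first exact: meas_sample_step.
move=> t; rewrite ger0_norm ?sample_step_ge0//.
exact: le_trans (h t) (ler_norm _).
Qed.

Lemma sample_dom2 f g h : sfin g -> sfin h ->
  (forall k, normc (f (x k)) <= normc (g (x k)) + normc (h (x k))) ->
  sfin f /\ sn f <= sn g + sn h.
Proof.
move=> gX hX H; have [] := @sample_dom f (fun t => sample_step x g t + sample_step x h t).
- exact: rcarD.
- by move=> t; have [[k _ E]|E] := sample_stepP t; rewrite !E ?addr0.
move=> fX fle; split => //; apply: (le_trans fle); exact: rnD.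
Qed.

(** A bound at the nodes spreads over each cell by [pois_shift], the cells having length at most
    [b * H]; the step function is then itself below a majorant, which controls its norm. *)
Lemma sample_pois C H (w : R -> R) f c b : poisson_bounded X C -> 0 < H -> rcar w -> 0 <= c ->
  0 <= b -> be <= b * H -> (forall k, normc (f (x k)) <= c * pois H w (x k)) ->
  sfin f /\ sn f <= c * (2 * (1 + b ^+ 2)) * C * rn w.
Proof.
move=> PC H0 wX c0 b0 beb hf.
have c0' : 0 <= c * (2 * (1 + b ^+ 2)) by rewrite mulr_ge0// mulr_ge0// addr_ge0// sqr_ge0.
apply: (pois_X PC H0 wX c0' (meas_sample_step f)) => t.
have [[k /andP[k1 k2] ->]|->] := sample_stepP t; last by rewrite normr0 mulr_ge0// pois_ge0.
rewrite ger0_norm ?normc_ge0//; apply: (le_trans (hf k)); rewrite -mulrA ler_wpM2l//.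
apply: (pois_shift PC H0 wX b0); rewrite ger0_norm ?subr_ge0//; apply: le_trans beb.
by have /andP[_] := gap k; lra.
Qed.

End sampling_steps.

(** * Complex-valued functions and their moduli *)

Section complex_lattice.
Import ComplexField.Normc.
Local Open Scope complex_scope.
Context {R : realType} (X : banach_lattice R).
Implicit Types (f g : R -> R[i]) (u v w : R -> R) (h a c x : R) (m : nat).
Local Notation rcar := (rcar X).
Local Notation rn := (rn X).
Local Notation car := (bl_car X).
Local Notation N := (bl_norm X).

Lemma cpartsE f : f = fun x => re f x +i* im f x.
Proof. by apply/funext => x; rewrite /re /im; case: (f x). Qed.

Lemma reB f g : re (f \- g)%R = fun x => re f x - re g x.
Proof. by apply/funext => x; rewrite /re /= raddfB. Qed.

Lemma imB f g : im (f \- g)%R = fun x => im f x - im g x.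
Proof. by apply/funext => x; rewrite /im /= raddfB. Qed.

Lemma carB f g : car f -> car g -> car (f \- g)%R /\ N (f \- g)%R <= N f + N g.
Proof.
move=> fX gX; have -> : (f \- g)%R = (f \+ (fun x => -1 * g x))%R.
  by apply/funext => x /=; rewrite mulN1r.
have gX' := bl_carZ (-1) gX; split; first exact: bl_carD.
apply: (le_trans (bl_normD fX gX')); rewrite bl_normZ// normcN.
by rewrite [normc 1]/normc /= expr1n expr0n addr0 sqrtr1 mul1r.
Qed.

Lemma normCB f g : car f -> car g -> N (f \- g)%R = N (g \- f)%R.
Proof.
move=> fX gX; have [gfX _] := carB gX fX; have := bl_normZ (-1) gfX.
rewrite normcN [normc 1]/normc /= expr1n expr0n addr0 sqrtr1 mul1r => <-.
by congr N; apply/funext => x /=; rewrite mulN1r opprB.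
Qed.

Lemma norm_triangle f g k : car f -> car g -> car k ->
  N (f \- k)%R <= N (f \- g)%R + N (g \- k)%R.
Proof.
move=> fX gX kX; have [X1 _] := carB fX gX; have [X2 _] := carB gX kX.
apply: le_trans (bl_normD X1 X2); rewrite le_eqVlt; apply/orP; left; apply/eqP.
by congr N; apply/funext => x /=; rewrite addrA subrK.
Qed.

Lemma norm_le_sub f g : car f -> car g -> N f <= N g + N (f \- g)%R.
Proof.
move=> fX gX; have [X1 _] := carB fX gX; apply: le_trans (bl_normD gX X1).
rewrite le_eqVlt; apply/orP; left; apply/eqP; congr N.
by apply/funext => x /=; rewrite addrC subrK.
Qed.

(** One real element dominating both parts, so that a single Poisson majorant serves a complex
    function. *)
Definition csum f : R -> R := fun x => `|re f x| + `|im f x|.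

Lemma csum_car f : car f -> rcar (csum f) /\ rn (csum f) <= 2 * N f.
Proof.
move=> fX; have [f1 l1] := car_re fX; have [f2 l2] := car_im fX.
have [a1 b1] := rcar_norm f1; have [a2 b2] := rcar_norm f2.
split; first exact: rcarD.
apply: (le_trans (rnD a1 a2)); rewrite (mulrDl 1 1) mul1r.
by apply: lerD; [exact: le_trans b1 l1|exact: le_trans b2 l2].
Qed.

Definition csteklov h a f : R -> R[i] := fun x => St h a (re f) x +i* St h a (im f) x.

Lemma steklov_csteklov h : steklov h = csteklov h (- (h / 2)).
Proof. by apply/funext => f; apply/funext => x; rewrite steklovE /csteklov !rst_St. Qed.

Lemma dsteklov_csteklov h : dsteklov h = csteklov h 0.
Proof. by apply/funext => f; apply/funext => x; rewrite /dsteklov steklovE /csteklov !rst_St0. Qed.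

Lemma defect0 (A : (R -> R[i]) -> R -> R[i]) f : defect A 0 f = f.
Proof. by []. Qed.

Lemma defectS (A : (R -> R[i]) -> R -> R[i]) m f : defect A m.+1 f = (defect A m f \- A (defect A m f))%R.
Proof. by []. Qed.

Lemma defect_parts h a m f :
  defect (csteklov h a) m f = fun x => rdef h a m (re f) x +i* rdef h a m (im f) x.
Proof.
elim: m => [|m IH]; first exact: cpartsE.
by rewrite defectS IH; apply/funext => x.
Qed.

Context (C : R) (PC : poisson_bounded X C).
Let C0 : 0 < C. Proof. by case: PC. Qed.

Lemma pois_mono h u v x : 0 < h -> rcar u -> rcar v -> (forall y, `|u y| <= `|v y|) ->
  pois h u x <= pois h v x.
Proof.
move=> h0 uX vX uv; apply: le_Int; [exact: measurableT_lebT|exact: (pois_intg PC)|exact: (pois_intg PC)|].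
by move=> y _; apply: ler_wpM2l => //; exact/ltW/pk_gt0.
Qed.

Lemma csum_ge f y : `|re f y| <= `|csum f y| /\ `|im f y| <= `|csum f y|.
Proof.
have -> : `|csum f y| = csum f y by rewrite ger0_norm// addr_ge0.
by rewrite /csum lerDl lerDr !normr_ge0.
Qed.

Lemma normc_csum f y : normc (f y) <= csum f y.
Proof. by rewrite /csum /re /im; case: (f y) => a b; exact: normc_le. Qed.

Lemma defect_car h a m f : 0 < h -> - h <= a -> a <= 0 -> car f ->
  car (defect (csteklov h a) m f) /\ N (defect (csteklov h a) m f) <= 2 * (1 + 2 * C) ^+ m * N f.
Proof.
move=> h0 ha a0 fX; have [f1 l1] := car_re fX; have [f2 l2] := car_im fX.
have [d1 e1] := rdef_X PC m h0 ha a0 f1; have [d2 e2] := rdef_X PC m h0 ha a0 f2.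
have [dX dle] := car_reim d1 d2; rewrite defect_parts; split => //.
apply: (le_trans dle); have c0 : 0 <= (1 + 2 * C) ^+ m by rewrite exprn_ge0// addr_ge0// mulr_ge0// ltW.
have := le_trans e1 (ler_wpM2l c0 l1); have := le_trans e2 (ler_wpM2l c0 l2).
by rewrite -mulrA; lra.
Qed.

Lemma defectB h a m f g : 0 < h -> - h <= a -> a <= 0 -> car f -> car g ->
  defect (csteklov h a) m (f \- g)%R = (defect (csteklov h a) m f \- defect (csteklov h a) m g)%R.
Proof.
move=> h0 ha a0 fX gX; have [f1 _] := car_re fX; have [f2 _] := car_im fX.
have [g1 _] := car_re gX; have [g2 _] := car_im gX.
rewrite !defect_parts reB imB (rdef_B PC m h0 ha a0 f1 g1) (rdef_B PC m h0 ha a0 f2 g2).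
by apply/funext => x.
Qed.

Lemma defect_smooth h m g : 0 < h -> car (cderiv m g) -> smooth (re g) -> smooth (im g) ->
  N (defect (csteklov h 0) m g) <= 2 * (2 * h * C) ^+ m * N (cderiv m g).
Proof.
move=> h0 dX s1 s2; have [d1 l1] := car_re dX; have [d2 l2] := car_im dX.
have ha : - h <= 0 by rewrite oppr_le0 ltW.
have [X1 e1] := rdef_smooth_X PC h0 ha (lexx 0) s1 d1.
have [X2 e2] := rdef_smooth_X PC h0 ha (lexx 0) s2 d2.
rewrite defect_parts; have [_ dle] := car_reim X1 X2; apply: (le_trans dle).
have c0 : 0 <= (2 * h * C) ^+ m by rewrite exprn_ge0// !mulr_ge0// ltW.
have := le_trans e1 (ler_wpM2l c0 l1); have := le_trans e2 (ler_wpM2l c0 l2).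
by rewrite -mulrA; lra.
Qed.

End complex_lattice.

(** * Bounds for sampled norms *)

Section sampled_estimates.
Import ComplexField.Normc.
Local Open Scope complex_scope.
Context {R : realType} (X : banach_lattice R) (C : R) (PC : poisson_bounded X C).
Variables (ga ga' : R).
Hypotheses (ga0 : 0 < ga) (ga0' : 0 < ga').
Implicit Types (f g : R -> R[i]) (u v w : R -> R) (x : int -> R) (s c H : R) (m r : nat).
Local Notation rcar := (rcar X).
Local Notation rn := (rn X).
Local Notation car := (bl_car X).
Local Notation N := (bl_norm X).

Let C0 : 0 < C. Proof. by case: PC. Qed.

Definition nodes s x := forall k, ga / s <= x (k + 1) - x k <= ga' / s.

Let step_gt0 s : 1 <= s -> 0 < ga / s.
Proof. by move=> s1; rewrite divr_gt0// (lt_le_trans ltr01 s1). Qed.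

Lemma sample_cpois s x H c b f w : 1 <= s -> nodes s x -> 0 < H -> 0 <= c -> 0 <= b ->
  ga' / s <= b * H -> rcar w ->
  (forall k, normc (f (x k)) <= c * pois H w (x k)) ->
  sfin x X f /\ sn x X f <= c * (2 * (1 + b ^+ 2)) * C * rn w.
Proof. by move=> s1 xn H0 c0 b0 gb wX hf; exact: (sample_pois (step_gt0 s1) xn PC H0 wX c0 b0 gb hf). Qed.

Lemma sfinB s x f g : 1 <= s -> nodes s x -> sfin x X f -> sfin x X g ->
  sfin x X (f \- g)%R /\ sn x X (f \- g)%R <= sn x X f + sn x X g.
Proof.
move=> s1 xn fX gX; apply: (sample_dom2 (step_gt0 s1) xn fX gX) => k /=.
by apply: (le_trans (le_normcD _ _)); rewrite normcN.
Qed.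

Lemma sn_triangle s x f g k : 1 <= s -> nodes s x -> sfin x X (f \- g)%R -> sfin x X (g \- k)%R ->
  sfin x X (f \- k)%R /\ sn x X (f \- k)%R <= sn x X (f \- g)%R + sn x X (g \- k)%R.
Proof.
move=> s1 xn fX gX; apply: (sample_dom2 (step_gt0 s1) xn fX gX) => i /=.
have -> : f (x i) - k (x i) = (f (x i) - g (x i)) + (g (x i) - k (x i)) by rewrite addrA subrK.
exact: le_normcD.
Qed.

Lemma snC s x f g : 1 <= s -> nodes s x -> sfin x X (f \- g)%R ->
  sfin x X (g \- f)%R /\ sn x X (g \- f)%R = sn x X (f \- g)%R.
Proof.
move=> s1 xn; rewrite /sfin /sn.
suff -> : sample_step x (g \- f)%R = sample_step x (f \- g)%R by [].
apply/funext => t; have [[k _ E]|E] := sample_stepP (step_gt0 s1) xn t; rewrite !E//=.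
by rewrite -normcN opprB.
Qed.

(** Values of [f] at the nodes are not controlled by its norm, but those of its averages are, being
    below a majorant. *)
Lemma steklov_sample : exists2 K, 0 <= K & forall s x f, 1 <= s -> nodes s x -> car f ->
  sfin x X (steklov (ga / s) f) /\ sn x X (steklov (ga / s) f) <= K * N f.
Proof.
pose b := ga' / ga; have b0 : 0 <= b by rewrite divr_ge0// ltW.
exists (4 * (2 * (1 + b ^+ 2)) * C * 2).
  by rewrite !mulr_ge0 ?(ltW C0)// addr_ge0// sqr_ge0.
move=> s x f s1 xn fX; have h0 := step_gt0 s1; set h := ga / s in h0 *.
have [f1 l1] := car_re fX; have [f2 l2] := car_im fX; have [wX wl] := csum_car fX.
have ha : - h <= - (h / 2) by lra.
have a0 : - (h / 2) <= 0 by lra.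
have bh : ga' / s <= b * h.
  by rewrite /b /h mulrA divfK ?gt_eqF.
have H k : normc (steklov h f (x k)) <= 4 * pois h (csum f) (x k).
  rewrite steklov_csteklov; apply: (le_trans (normc_le _ _)).
  have p1 := pois_mono PC (x k) h0 f1 wX (fun y => (csum_ge f y).1).
  have p2 := pois_mono PC (x k) h0 f2 wX (fun y => (csum_ge f y).2).
  have := St_pois PC (x k) h0 ha a0 f1; have := St_pois PC (x k) h0 ha a0 f2; lra.
have [fX' fle] := sample_cpois s1 xn h0 (ler0n _ 4) b0 bh wX H; split => //.
apply: (le_trans fle); rewrite -[leRHS]mulrA; apply: ler_wpM2l wl.
by rewrite !mulr_ge0 ?(ltW C0)// addr_ge0// sqr_ge0.
Qed.

(** Each factor I - A changes the sampled norm by at most that of an average, hence by a multiple of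
    N f. Thus [f] can be exchanged for its defect at the nodes, in both directions. *)
Lemma defect_sample r : exists2 K, 0 <= K & forall s x f, 1 <= s -> nodes s x -> car f -> sfin x X f ->
  [/\ sfin x X (defect (steklov (ga / s)) r f),
    sn x X (defect (steklov (ga / s)) r f) <= sn x X f + K * N f &
    sn x X f <= sn x X (defect (steklov (ga / s)) r f) + K * N f].
Proof.
have [K K0 HK] := steklov_sample.
exists (\sum_(i < r) K * (2 * (1 + 2 * C) ^+ i)).
  apply: sumr_ge0 => i _; rewrite !mulr_ge0// exprn_ge0// addr_ge0// mulr_ge0// ltW//.
move=> s x f s1 xn fX fs; elim: r => [|r [d1 d2 d3]].
  by rewrite big_ord0 mul0r !addr0 defect0; split; [exact: fs|exact: lexx|exact: lexx].
rewrite big_ord_recr defectS; set d := defect _ r f in d1 d2 d3 *.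
have h0 := step_gt0 s1; have ha : - (ga / s) <= - (ga / s / 2) by lra.
have a0 : - (ga / s / 2) <= 0 by lra.
have [dX dle] : car d /\ N d <= 2 * (1 + 2 * C) ^+ r * N f.
  by rewrite /d steklov_csteklov; exact: (defect_car PC r h0 ha a0 fX).
have [aS ale] := HK s x d s1 xn dX.
have ale' : sn x X (steklov (ga / s) d) <= K * (2 * (1 + 2 * C) ^+ r) * N f.
  by apply: (le_trans ale); rewrite -mulrA; exact: ler_wpM2l.
have [eS ele] := sfinB s1 xn d1 aS; rewrite mulrDl; split => //; first by lra.
have [_ le3] : sfin x X d /\ sn x X d <= sn x X (d \- steklov (ga / s) d)%R + sn x X (steklov (ga / s) d).
  apply: (sample_dom2 h0 xn eS aS) => k /=.
  by rewrite -[X in normc X <= _](subrK (steklov (ga / s) d (x k))); exact: le_normcD.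
lra.
Qed.

Lemma defect_sample_smooth r m : (0 < m <= 2 * r)%N -> exists2 K, 0 <= K & forall s x g, 1 <= s -> nodes s x ->
  smooth (re g) -> smooth (im g) -> car (cderiv m g) ->
  sfin x X (defect (steklov (ga / s)) r g) /\
  sn x X (defect (steklov (ga / s)) r g) <= K * (s ^- m * N (cderiv m g)).
Proof.
move=> mr; have [K K0 HK] := rdef_sym_pois PC mr.
pose b := ga' / ga; have b0 : 0 <= b by rewrite divr_ge0// ltW.
have B0 : 0 <= 2 * (2 * (1 + b ^+ 2)) * C by rewrite !mulr_ge0 ?(ltW C0)// addr_ge0// sqr_ge0.
exists (2 * (2 * (1 + b ^+ 2)) * C * (2 * (K * ga ^+ m))).
  by rewrite mulr_ge0// !mulr_ge0// exprn_ge0// ltW.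
move=> s x g s1 xn s1' s2' dX; have h0 := step_gt0 s1; set h := ga / s in h0 *.
have [d1 l1] := car_re dX; have [d2 l2] := car_im dX.
have [w1 [w1X w1l hw1]] := HK h (re g) h0 s1' d1; have [w2 [w2X w2l hw2]] := HK h (im g) h0 s2' d2.
have [wX wl] := car_reim w1X w2X; set w := (fun t : R => w1 t +i* w2 t) in wX wl.
have bh : ga' / s <= b * h by rewrite /b /h mulrA divfK ?gt_eqF.
have [n1X n1l] := rcar_norm w1X; have [n2X n2l] := rcar_norm w2X.
have cX : rcar (csum w) by exact: rcarD.
have cl : rn (csum w) <= rn w1 + rn w2.
  by apply: (le_trans (rnD n1X n2X)); exact: lerD.
have H k : normc (defect (steklov h) r g (x k)) <= 2 * pois h (csum w) (x k).
  rewrite steklov_csteklov defect_parts; apply: (le_trans (normc_le _ _)).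
  have p1 := pois_mono PC (x k) h0 w1X cX (fun y => (csum_ge w y).1).
  have p2 := pois_mono PC (x k) h0 w2X cX (fun y => (csum_ge w y).2).
  have := hw1 (x k); have := hw2 (x k); lra.
have [fX' fle] := sample_cpois s1 xn h0 (ler0n _ 2) b0 bh cX H; split => //.
apply: (le_trans fle); rewrite -[leRHS]mulrA; apply: (ler_wpM2l B0).
apply: (le_trans cl); have hm : h ^+ m = ga ^+ m * s ^- m by rewrite /h expr_div_n.
have k0 : 0 <= K * h ^+ m by rewrite mulr_ge0// exprn_ge0// ltW.
have := le_trans w1l (ler_wpM2l k0 l1); have := le_trans w2l (ler_wpM2l k0 l2).
have -> : 2 * (K * ga ^+ m) * (s ^- m * N (cderiv m g)) = K * h ^+ m * N (cderiv m g) + K * h ^+ m * N (cderiv m g).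
  by rewrite hm; ring.
by move=> a b'; apply: lerD.
Qed.

Context (theta : R -> R) (ctheta : cutoff theta).
Local Notation vp := (vp theta).

(** All that Nikolskii's inequality uses of band-limitedness; unlike [bandlimited], it passes to
    differences without handling a functional. *)
Definition reproduced s f := [/\ car f, re f = conv (vp (3 * s)) (re f) & im f = conv (vp (3 * s)) (im f)].

Lemma bandlimited_reproduced s f : 1 <= s -> bandlimited X s f -> reproduced s f.
Proof.
move=> s1 bf; have s0 : 0 < s := lt_le_trans ltr01 s1.
by have [e1 e2] := reproducing ctheta PC bf s0; split => //; case: bf.
Qed.

Lemma convB s u v (y : R) : 0 < s -> rcar u -> rcar v ->
  conv (vp s) (fun t => u t - v t) y = conv (vp s) u y - conv (vp s) v y.
Proof.
move=> s0 uX vX; have [M _ hM] := vp_pk ctheta s0; have cv := vp_cont ctheta s0.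
have [i1 _] := kernel_intg PC y cv hM uX; have [i2 _] := kernel_intg PC y cv hM vX.
by rewrite /conv -(IntB measurableT_lebT i1 i2); apply: eq_Int => t _; rewrite mulrBr.
Qed.

Lemma reproducedB s f g : 1 <= s -> reproduced s f -> reproduced s g -> reproduced s (f \- g)%R.
Proof.
move=> s1 [fX f1 f2] [gX g1 g2]; have s3 : 0 < 3 * s by lra.
have [c1 _] := car_re fX; have [c2 _] := car_im fX; have [d1 _] := car_re gX; have [d2 _] := car_im gX.
split; first by have [] := carB fX gX.
  by rewrite reB; apply/funext => x; rewrite convB// -f1 -g1.
by rewrite imB; apply/funext => x; rewrite convB// -f2 -g2.
Qed.

Lemma reproduced_sample : exists2 K, 0 <= K & forall s x f, 1 <= s -> nodes s x -> reproduced s f ->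
  sfin x X f /\ sn x X f <= K * N f.
Proof.
(* The majorant has height H = 1 / (3 s), so gaps of at most ga' / s are b H with b = 3 ga'. *)
have [M M0 hM] := conv_vp_pois ctheta PC; pose b := 3 * ga'.
have b0 : 0 <= b by rewrite mulr_ge0// ltW.
have B0 : 0 <= 2 * M * (2 * (1 + b ^+ 2)) * C by rewrite !mulr_ge0 ?(ltW C0)// addr_ge0// sqr_ge0.
exists (2 * M * (2 * (1 + b ^+ 2)) * C * 2); first exact: mulr_ge0.
move=> s x f s1 xn [fX f1 f2]; have s3 : 0 < 3 * s by lra.
have sn0 : s != 0 by rewrite gt_eqF//; lra.
have H0 : 0 < (3 * s)^-1 by rewrite invr_gt0.
have [c1 _] := car_re fX; have [c2 _] := car_im fX; have [wX wl] := csum_car fX.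
have bh : ga' / s <= b * (3 * s)^-1.
  by rewrite le_eqVlt; apply/orP; left; apply/eqP; rewrite /b; field.
have H k : normc (f (x k)) <= 2 * M * pois (3 * s)^-1 (csum f) (x k).
  apply: (le_trans (normc_csum f (x k))); rewrite [csum _ _]/csum.
  have p1 := pois_mono PC (x k) H0 c1 wX (fun y => (csum_ge f y).1).
  have p2 := pois_mono PC (x k) H0 c2 wX (fun y => (csum_ge f y).2).
  rewrite {1}f1 {1}f2; have := hM _ _ (x k) s3 c1; have := hM _ _ (x k) s3 c2.
  have := ler_wpM2l M0 p1; have := ler_wpM2l M0 p2.
  by move=> q1 q2 q3 q4; rewrite -mulrA; lra.
have c0 : 0 <= 2 * M by rewrite mulr_ge0.
have [fS fle] := sample_cpois s1 xn H0 c0 b0 bh wX H; split => //.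
by apply: (le_trans fle); rewrite -[leRHS]mulrA; exact: ler_wpM2l.
Qed.

End sampled_estimates.

(** * Approximation by band-limited functions *)

Section bandlimited_approximation.
Import ComplexField.Normc.
Local Open Scope complex_scope.
Context {R : realType} (X : banach_lattice R) (C : R) (PC : poisson_bounded X C).
Context (theta : R -> R) (ctheta : cutoff theta) (ga : R) (ga0 : 0 < ga).
Implicit Types (f g : R -> R[i]) (u q : R -> R) (s : R) (m : nat).
Local Notation rcar := (rcar X).
Local Notation rn := (rn X).
Local Notation car := (bl_car X).
Local Notation N := (bl_norm X).
Local Notation nice := (nice X).
Local Notation vp := (vp theta).

Let C0 : 0 < C. Proof. by case: PC. Qed.

(** The smooth function from [k_functional] is replaced by its Jackson approximation; the step ga /
    s and the kernel height 1 / s are proportional, so the powers of [s] cancel. *)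
Lemma real_jackson m : exists2 K, 0 <= K & forall s u, 1 <= s -> nice u -> exists q, [/\ nice q,
  rn (fun x => u x - conv (vp s) q x) <= K * rn (rdef (ga / s) 0 m u) &
  s ^- m * rn (derive1n m (conv (vp s) q)) <= K * rn (rdef (ga / s) 0 m u)].
Proof.
have [K K0 HK] := k_functional PC m; have [M M0 hM] := vp_le ctheta.
set P := Int setT (pk (1 : R)); have P0 : 0 <= P by apply: Int_ge0 => t _; exact/ltW/pk_gt0.
pose c1 := (M * P * C) ^+ m / ga ^+ m; pose c2 := (1 + (1 + M * C) ^+ m) / ga ^+ m.
have c10 : 0 <= c1 by rewrite divr_ge0 ?exprn_ge0 ?(ltW ga0)// !mulr_ge0// ltW.
have c20 : 0 <= c2.
  by rewrite divr_ge0 ?exprn_ge0 ?(ltW ga0)// addr_ge0// exprn_ge0// addr_ge0// mulr_ge0// ltW.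
exists ((1 + c1 + c2) * K); first by rewrite mulr_ge0// !addr_ge0.
move=> s u s1 nu; have s0 : 0 < s := lt_le_trans ltr01 s1; have si : 0 < s^-1 by rewrite invr_gt0.
have h0 : 0 < ga / s by rewrite divr_gt0.
have [F [nF F1 F2]] := HK (ga / s) u h0 nu.
have [q [nq q1 q2]] := jackson PC si M0 (vp_cont ctheta s0) (fun t => hM s t s0) (Int_vp ctheta s0) m nF.
set D := rn (rdef (ga / s) 0 m u) in F1 F2 *.
have nc := nice_conv PC si M0 (vp_cont ctheta s0) (fun t => hM s t s0) nq.
have gn : ga ^+ m != 0 by rewrite expf_neq0// gt_eqF.
have sn : s ^+ m != 0 by rewrite expf_neq0// gt_eqF.
have F2' : s ^- m * rn (derive1n m F) <= K * D / ga ^+ m.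
  rewrite ler_pdivlMr ?exprn_gt0//; apply: le_trans F2.
  by rewrite le_eqVlt; apply/orP; left; apply/eqP; rewrite expr_div_n; field; rewrite ?sn.
have D0 : 0 <= K * D by apply: le_trans (rn_ge0 _) F1; exact: nice_rcar (niceB nu nF).
exists q; split => //.
  have X1 := nice_rcar (niceB nu nF); have X2 := nice_rcar (niceB nF nc).
  have -> : (fun x => u x - conv (vp s) q x) = fun x => (u x - F x) + (F x - conv (vp s) q x).
    by apply/funext => x; rewrite addrA subrK.
  apply: (le_trans (rnD X1 X2)).
  have q1' : rn (fun x => F x - conv (vp s) q x) <= c1 * (K * D).
    apply: (le_trans q1); rewrite -/P exprMn exprVn.
    have -> : c1 * (K * D) = (M * P * C) ^+ m * (K * D / ga ^+ m) by rewrite /c1; ring.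
    rewrite -[leLHS]mulrA; apply: ler_wpM2l => //.
    by rewrite exprn_ge0// !mulr_ge0// ltW.
  rewrite -!mulrA !mulrDl mul1r; apply: le_trans (lerD F1 q1') _.
  by rewrite lerDl mulr_ge0.
have d0 : 0 <= 1 + (1 + M * C) ^+ m by rewrite addr_ge0// exprn_ge0// addr_ge0// mulr_ge0// ltW.
have := ler_wpM2l (ltW (exprn_gt0 m si)) q2; rewrite exprVn => q2'.
apply: (le_trans q2'); rewrite mulrCA; apply: (le_trans (ler_wpM2l d0 F2')).
have -> : (1 + (1 + M * C) ^+ m) * (K * D / ga ^+ m) = c2 * (K * D) by rewrite /c2; ring.
have -> : (1 + c1 + c2) * K * D = (K * D + c1 * (K * D)) + c2 * (K * D) by ring.
by rewrite lerDr addr_ge0// mulr_ge0.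
Qed.

Lemma jackson_bandlimited m : exists2 K, 0 <= K & forall s f, 1 <= s -> nice (re f) -> nice (im f) ->
  exists g, [/\ bandlimited X s g, car (cderiv m g),
    N (f \- g)%R <= K * N (defect (dsteklov (ga / s)) m f) &
    s ^- m * N (cderiv m g) <= K * N (defect (dsteklov (ga / s)) m f)].
Proof.
have [K K0 HK] := real_jackson m; exists (2 * K); first by rewrite mulr_ge0.
move=> s f s1 n1 n2; have s0 : 0 < s := lt_le_trans ltr01 s1; have si : 0 < s^-1 by rewrite invr_gt0.
have h0 : 0 < ga / s by rewrite divr_gt0.
have ha : - (ga / s) <= 0 by rewrite oppr_le0 ltW.
have [M M0 hM] := vp_le ctheta.
have [q1 [nq1 a1 b1]] := HK s _ s1 n1; have [q2 [nq2 a2 b2]] := HK s _ s1 n2.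
have c1 := nice_conv PC si M0 (vp_cont ctheta s0) (fun t => hM s t s0) nq1.
have c2 := nice_conv PC si M0 (vp_cont ctheta s0) (fun t => hM s t s0) nq2.
exists (fun x => conv (vp s) q1 x +i* conv (vp s) q2 x).
have [fX _] := car_reim (nice_rcar n1) (nice_rcar n2); rewrite -cpartsE in fX.
have [dX _] := defect_car PC m h0 ha (lexx 0) fX.
have [_ r1] := car_re dX; have [_ r2] := car_im dX.
rewrite -dsteklov_csteklov in r1 r2.
have e1 : re (defect (dsteklov (ga / s)) m f) = rdef (ga / s) 0 m (re f).
  by rewrite dsteklov_csteklov defect_parts.
have e2 : im (defect (dsteklov (ga / s)) m f) = rdef (ga / s) 0 m (im f).
  by rewrite dsteklov_csteklov defect_parts.
rewrite e1 in r1; rewrite e2 in r2.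
set D := N _ in r1 r2 *.
have a1' := le_trans a1 (ler_wpM2l K0 r1); have a2' := le_trans a2 (ler_wpM2l K0 r2).
have b1' := le_trans b1 (ler_wpM2l K0 r1); have b2' := le_trans b2 (ler_wpM2l K0 r2).
have e3 : 2 * K * D = K * D + K * D by ring.
split.
- exact: (bandlimited_conv ctheta PC s0 nq1 nq2).
- by have [] := car_reim (nice_rcar (nice_derive1n m c1)) (nice_rcar (nice_derive1n m c2)).
- rewrite e3; apply: le_trans (lerD a1' a2').
  have [_ le1] := car_reim (nice_rcar (niceB n1 c1)) (nice_rcar (niceB n2 c2)).
  apply: le_trans le1; rewrite le_eqVlt; apply/orP; left; apply/eqP; congr N.
  by apply/funext => x; rewrite /= /re /im; case: (f x).
rewrite e3; apply: le_trans (lerD b1' b2'); rewrite -mulrDr; apply: ler_wpM2l.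
  by rewrite invr_ge0 exprn_ge0// ltW.
by have [] := car_reim (nice_rcar (nice_derive1n m c1)) (nice_rcar (nice_derive1n m c2)).
Qed.

Lemma schwartz_nice : (forall phi, schwartz phi -> car phi) -> forall phi, schwartz phi ->
  nice (re phi) /\ nice (im phi).
Proof.
move=> SX phi sp; have [r1 r2] := rschwartz_parts sp.
have rd u k : rschwartz u -> rschwartz (derive1n k u).
  by elim: k u => [//|k IH] u ru; rewrite derive1Sn; apply: IH; exact: rschwartz_derive1.
have sX k : car (cderiv k phi) by apply: SX; apply: schwartz_parts; exact: rd.
split.
  split; first exact: r1.1.
  move=> k; split; first by have [] := car_re (sX k).
  by have [M hM] := r1.2 0%N k; exists M => x; have := hM x; rewrite mul1r.
split; first exact: r2.1.
move=> k; split; first by have [] := car_im (sX k).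
by have [M hM] := r2.2 0%N k; exists M => x; have := hM x; rewrite mul1r.
Qed.

Lemma bl_enorm_lt f (e : R) : (bl_enorm X f < e%:E)%E -> car f /\ N f < e.
Proof. by rewrite /bl_enorm; case: asboolP => // fX; rewrite lte_fin. Qed.

Lemma bl_enormE f : car f -> bl_enorm X f = (N f)%:E.
Proof. by move=> fX; rewrite /bl_enorm asboolT. Qed.

Lemma sampling_sumB x phi f g m n :
  sampling_sum x phi (f \- g)%R m n = (sampling_sum x phi f m n \- sampling_sum x phi g m n)%R.
Proof.
apply/funext => t; rewrite /sampling_sum /= -sumrB; apply: eq_bigr => i _.
by rewrite mulrBl.
Qed.

(** [G] is specified only through norm limits, so additivity is inherited from the partial sums up
    to a function of norm zero. *)
Lemma sampling_additive x phi (G : (R -> R[i]) -> R -> R[i]) f g :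
  (forall f, sampled_space X x f -> car (G f)) ->
  (forall f, sampled_space X x f -> forall e : R, 0 < e -> exists n0, forall m n, (n0 <= m)%N -> (n0 <= n)%N ->
     (bl_enorm X (G f \- sampling_sum x phi f m n)%R < e%:E)%E) ->
  sampled_space X x f -> sampled_space X x g -> sampled_space X x (f \- g)%R ->
  N (G (f \- g) \- (G f \- G g))%R = 0.
Proof.
move=> GX Gc sf sg sfg; have [X1 _] := carB (GX _ sf) (GX _ sg).
have [X2 _] := carB (GX _ sfg) X1.
apply/eqP; rewrite eq_le bl_norm_ge0// andbT leNgt; apply/negP => a0.
set a := N _ in a0; have e0 : 0 < a / 3 by rewrite divr_gt0.
have [n1 h1] := Gc _ sf _ e0; have [n2 h2] := Gc _ sg _ e0; have [n3 h3] := Gc _ sfg _ e0.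
pose n := maxn n1 (maxn n2 n3).
have l1 : (n1 <= n)%N by rewrite leq_maxl.
have l2 : (n2 <= n)%N by rewrite /n maxnCA leq_maxl.
have l3 : (n3 <= n)%N by rewrite /n maxnA leq_maxr.
have [Y1 y1] := bl_enorm_lt (h1 n n l1 l1); have [Y2 y2] := bl_enorm_lt (h2 n n l2 l2).
have [Y3 y3] := bl_enorm_lt (h3 n n l3 l3).
have [Y4 y4] := carB Y1 Y2; have [Y5 y5] := carB Y3 Y4.
have : a <= N ((G (f \- g) \- sampling_sum x phi (f \- g) n n) \-
   ((G f \- sampling_sum x phi f n n) \- (G g \- sampling_sum x phi g n n)))%R.
  rewrite /a le_eqVlt; apply/orP; left; apply/eqP; congr N; apply/funext => t.
  by rewrite sampling_sumB /=; ring.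
lra.
Qed.

End bandlimited_approximation.

(** * The equivalence *)


(** Elimination for [error_le_moduli]: [L] is the total error, [Nv] and [S] the norm and sampled
    norm of f - g, [W] the scaled derivative of [g], [E] the modulus of the Schwartz function, [e] a
    bound for its distance from [f], [D1] and [D2] the two moduli of [f]. *)
Lemma chain_le {R : realType} (a b Kj Ks Kd c0 L Nv W S E D1 D2 e : R) :
  0 <= a -> 0 <= b -> 0 <= Kj -> 0 <= Ks -> 0 <= Kd ->
  0 <= D1 -> 0 <= D2 ->
  L <= Nv + a * W + b * S -> S <= D2 + Ks * W + Kd * Nv -> Nv <= e + Kj * E ->
  W <= Kj * E -> E <= D1 + c0 * e ->
  L <= ((1 + b * Kd) * Kj + (a + b * Ks) * Kj + b) * (D1 + D2) +
       (((1 + b * Kd) * Kj + (a + b * Ks) * Kj) * c0 + (1 + b * Kd)) * e.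
Proof.
move=> a0 b0 j0 s0 d0 D10 D20 hL hS hN hW hE.
have bd : 0 <= 1 + b * Kd by rewrite addr_ge0// mulr_ge0.
have abs : 0 <= a + b * Ks by rewrite addr_ge0// mulr_ge0.
set P := (1 + b * Kd) * Kj + (a + b * Ks) * Kj.
have P0 : 0 <= P by rewrite addr_ge0// mulr_ge0.
have h1 : L <= (1 + b * Kd) * Nv + (a + b * Ks) * W + b * D2.
  have := ler_wpM2l b0 hS; rewrite !mulrDr !mulrDl !mul1r !mulrA; lra.
have h2 := ler_wpM2l bd hN; have h3 := ler_wpM2l abs hW.
have h4 : L <= P * E + (1 + b * Kd) * e + b * D2.
  apply: (le_trans h1); apply: (le_trans (lerD (lerD h2 h3) (lexx _))).
  by rewrite le_eqVlt; apply/orP; left; apply/eqP; rewrite /P; ring.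
have h5 := ler_wpM2l P0 hE; apply: (le_trans h4).
apply: (le_trans (lerD (lerD h5 (lexx _)) (lexx _))).
have -> : (P + b) * (D1 + D2) + (P * c0 + (1 + b * Kd)) * e =
  P * (D1 + c0 * e) + (1 + b * Kd) * e + b * D2 + (P * D2 + b * D1) by ring.
by rewrite lerDl addr_ge0// mulr_ge0.
Qed.

Section equivalence.
Import ComplexField.Normc.
Local Open Scope complex_scope.
Context {R : realType} (X : banach_lattice R) (C : R) (PC : poisson_bounded X C).
Context (theta : R -> R) (ctheta : cutoff theta).
Variables (ga ga' : R) (x : R -> int -> R) (G : R -> (R -> R[i]) -> R -> R[i]).
Variables (r n : nat) (K1 K3 K4 : R).
Implicit Types (f g : R -> R[i]) (t e : R).
Local Notation car := (bl_car X).
Local Notation N := (bl_norm X).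
Local Notation nice := (nice X).
Hypotheses (ga0 : 0 < ga) (ga0' : 0 < ga') (rn : (0 < n <= 2 * r)%N).
Hypotheses (K10 : 0 < K1) (K30 : 0 < K3) (K40 : 0 < K4).
Hypothesis hx : forall t, 1 <= t -> nodes ga ga' t (x t).
Hypothesis hG : forall t f, 1 <= t -> car f -> sfin (x t) X f ->
  bandlimited X t (G t f) /\ N (G t f) <= K1 * sn (x t) X f.
Hypothesis hsub : forall t f g, 1 <= t -> car f -> sfin (x t) X f -> car g -> sfin (x t) X g ->
  N (G t (f \- g) \- (G t f \- G t g))%R = 0.
Hypothesis hK : forall t g, 1 <= t -> bandlimited X t g -> car (G t g) ->
  [/\ car (cderiv n g), K4 * (t ^- n * N (cderiv n g)) <= N (g \- G t g)%R &
    N (g \- G t g)%R <= K3 * (t ^- n * N (cderiv n g))].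
Hypothesis hdense : forall f e, car f -> 0 < e ->
  exists phi, [/\ nice (re phi), nice (im phi), car phi & N (f \- phi)%R < e].

Let C0 : 0 < C. Proof. by case: PC. Qed.
Let c0 : R := 2 * (1 + 2 * C) ^+ n.
Let c00 : 0 <= c0. Proof. by rewrite mulr_ge0// exprn_ge0// addr_ge0// mulr_ge0// ltW. Qed.

Let dst t := defect (dsteklov (ga / t)) n.
Let st t := defect (steklov (ga / t)) r.

Let h0 t : 1 <= t -> 0 < ga / t.
Proof. by move=> t1; rewrite divr_gt0// (lt_le_trans ltr01 t1). Qed.

Let dst_car t f : 1 <= t -> car f -> car (dst t f) /\ N (dst t f) <= c0 * N f.
Proof.
move=> t1 fX; rewrite /dst dsteklov_csteklov; have h := h0 t1.
by apply: (defect_car PC n h) => //; rewrite oppr_le0 ltW.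
Qed.

Let dstB t f g : 1 <= t -> car f -> car g -> dst t (f \- g)%R = (dst t f \- dst t g)%R.
Proof.
move=> t1 fX gX; rewrite /dst dsteklov_csteklov; have h := h0 t1.
by apply: (defectB PC n h) => //; rewrite oppr_le0 ltW.
Qed.

Let stB t f g : 1 <= t -> car f -> car g -> st t (f \- g)%R = (st t f \- st t g)%R.
Proof.
move=> t1 fX gX; rewrite /st steklov_csteklov; have h := h0 t1.
by apply: (defectB PC r h) => //; lra.
Qed.

Let sn_le_sub t f g : 1 <= t -> sfin (x t) X (f \- g)%R -> sfin (x t) X g ->
  sfin (x t) X f /\ sn (x t) X f <= sn (x t) X (f \- g)%R + sn (x t) X g.
Proof.
move=> t1 fX gX; apply: (sample_dom2 (h0 t1) (hx t1) fX gX) => k /=.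
by rewrite -[X in normc X <= _](subrK (g (x t k))); exact: le_normcD.
Qed.

Let G_car t f : 1 <= t -> car f -> sfin (x t) X f -> car (G t f).
Proof. by move=> t1 fX fS; have [[]] := hG t1 fX fS. Qed.

Let bl_sfin t g : 1 <= t -> bandlimited X t g -> sfin (x t) X g.
Proof.
move=> t1 bg; have [K _ HK] := reproduced_sample PC ga0 ga0' ctheta.
by have [] := HK t (x t) g t1 (hx t1) (bandlimited_reproduced PC ctheta t1 bg).
Qed.

Let G_sub t f g : 1 <= t -> car f -> sfin (x t) X f -> car g -> sfin (x t) X g ->
  N (G t f \- G t g)%R <= K1 * sn (x t) X (f \- g)%R.
Proof.
move=> t1 fX fS gX gS; have [dS _] := sfinB ga0 t1 (hx t1) fS gS; have [dX _] := carB fX gX.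
have [_ le1] := hG t1 dX dS; apply: le_trans le1.
have GX := G_car t1 dX dS; have [X1 _] := carB (G_car t1 fX fS) (G_car t1 gX gS).
by have := norm_le_sub X1 GX; rewrite (normCB X1 GX) (hsub t1 fX fS gX gS) addr0.
Qed.

Lemma moduli_le_error : exists2 K, 0 <= K & forall t f, 1 <= t -> car f -> sfin (x t) X f ->
  N (dst t f) + sn (x t) X (st t f) <=
    K * (N (f \- G t f)%R + sn (x t) X (f \- G t f)%R).
Proof.
have [Kd Kd0 HKd] := defect_sample PC ga0 ga0' r.
have [Ks Ks0 HKs] := defect_sample_smooth PC ga0 ga0' rn.
pose c1 := 2 * (2 * ga * C) ^+ n.
have c10 : 0 <= c1 by rewrite mulr_ge0// exprn_ge0// !mulr_ge0// ltW.
pose k := K1 / K4; have k0 : 0 <= k by rewrite divr_ge0// ltW.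
exists (c0 + Kd + 1 + (c1 + Ks) * k).
  by rewrite !addr_ge0// mulr_ge0// addr_ge0.
move=> t f t1 fX fS; have t0 : 0 < t := lt_le_trans ltr01 t1.
have [bg Gle] := hG t1 fX fS; set g := G t f in bg Gle *.
have gX : car g by case: bg. have gS := bl_sfin t1 bg.
have GgX := G_car t1 gX gS.
have [dX d4 d3] := hK t1 bg GgX; set W := t ^- n * N (cderiv n g) in d3 d4.
have [sg1 sg2] := bandlimited_smooth ctheta PC bg t0.
have [vX _] := carB fX gX; have [vS _] := sfinB ga0 t1 (hx t1) fS gS.
set L1 := N (f \- g)%R; set L2 := sn (x t) X (f \- g)%R.
have WL : W <= k * L2.
  rewrite /k mulrAC ler_pdivlMr// mulrC; apply: (le_trans d4).
  exact: (G_sub t1 fX fS gX gS).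
have D1 : N (dst t f) <= c0 * L1 + c1 * W.
  have [X1 _] := dst_car t1 fX; have [X2 _] := dst_car t1 gX; have [_ l1] := dst_car t1 vX.
  have l2 : N (dst t g) <= c1 * W.
    rewrite /dst dsteklov_csteklov; apply: (le_trans (defect_smooth PC (h0 t1) dX sg1 sg2)).
    rewrite le_eqVlt; apply/orP; left; apply/eqP; rewrite /c1 /W.
    by rewrite (_ : 2 * (ga / t) * C = 2 * ga * C / t) ?expr_div_n; ring.
  rewrite dstB// in l1.
  by apply: (le_trans (norm_le_sub X1 X2)); rewrite addrC; exact: lerD.
have D2 : sn (x t) X (st t f) <= L2 + Kd * L1 + Ks * W.
  have [vs1 vs2 _] := HKd t (x t) _ t1 (hx t1) vX vS.
  have [gs1 gs2] := HKs t (x t) _ t1 (hx t1) sg1 sg2 dX.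
  rewrite -/(st t _) stB// in vs1 vs2.
  have [_ le2] := sn_le_sub t1 vs1 gs1.
  by apply: (le_trans le2); exact: lerD.
have L10 : 0 <= L1 by exact: bl_norm_ge0.
have L20 : 0 <= L2 by exact: rn_ge0 vS.
have cs : 0 <= c1 + Ks by rewrite addr_ge0.
have := ler_wpM2l cs WL.
have p1 : 0 <= c0 * L2 := mulr_ge0 c00 L20.
have p2 : 0 <= Kd * L2 := mulr_ge0 Kd0 L20.
have p3 : 0 <= (c1 + Ks) * (k * L1) := mulr_ge0 cs (mulr_ge0 k0 L10).
have -> : (c0 + Kd + 1 + (c1 + Ks) * k) * (L1 + L2) = c0 * L1 + Kd * L1 + L1 + (c1 + Ks) * (k * L1) +
  c0 * L2 + Kd * L2 + L2 + (c1 + Ks) * (k * L2) by ring.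
rewrite [(c1 + Ks) * W]mulrDl; lra.
Qed.

Lemma error_le_moduli : exists2 K, 0 <= K & forall t f, 1 <= t -> car f -> sfin (x t) X f ->
  N (f \- G t f)%R + sn (x t) X (f \- G t f)%R <=
    K * (N (dst t f) + sn (x t) X (st t f)).
Proof.
have [Kd Kd0 HKd] := defect_sample PC ga0 ga0' r.
have [Ks Ks0 HKs] := defect_sample_smooth PC ga0 ga0' rn.
have [Kj Kj0 HKj] := jackson_bandlimited PC ctheta ga0 n.
have [Kr Kr0 HKr] := reproduced_sample PC ga0 ga0' ctheta.
pose a := K3 + Kr * K3; pose b := 1 + K1 + Kr * K1.
have a0 : 0 <= a by rewrite addr_ge0 ?mulr_ge0// ltW.
have b0 : 0 <= b by rewrite !addr_ge0 ?mulr_ge0// ltW.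
pose Q := ((1 + b * Kd) * Kj + (a + b * Ks) * Kj) * c0 + (1 + b * Kd).
have bk0 : 0 <= 1 + b * Kd by rewrite addr_ge0// mulr_ge0.
have ak0 : 0 <= a + b * Ks by rewrite addr_ge0// mulr_ge0.
have Q0 : 0 <= Q by rewrite addr_ge0// mulr_ge0// addr_ge0// mulr_ge0.
exists ((1 + b * Kd) * Kj + (a + b * Ks) * Kj + b).
  exact: addr_ge0 (addr_ge0 (mulr_ge0 bk0 Kj0) (mulr_ge0 ak0 Kj0)) b0.
move=> t f t1 fX fS; have t0 : 0 < t := lt_le_trans ltr01 t1.
have [dfX _] := dst_car t1 fX; have [sfS _ _] := HKd t (x t) f t1 (hx t1) fX fS.
have D10 : 0 <= N (dst t f) by exact: bl_norm_ge0.
have D20 : 0 <= sn (x t) X (st t f) by exact: rn_ge0 sfS.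
have GfX := G_car t1 fX fS.
(* The distance from [f] to its Schwartz approximation enters the final bound with the factor [Q];
   [e] is chosen so that Q e <= e'. *)
apply/ler_addgt0Pr => e' e'0; pose e := e' / (Q + 1).
have Q1 : 0 < Q + 1 by rewrite ltr_wpDl.
have e0 : 0 < e by rewrite divr_gt0.
have Qe : Q * e <= e'.
  by rewrite /e mulrCA ler_piMr ?(ltW e'0)// ler_pdivrMr// mul1r lerDl.
apply: (@le_trans _ _ (((1 + b * Kd) * Kj + (a + b * Ks) * Kj + b) *
  (N (dst t f) + sn (x t) X (st t f)) + Q * e)); last by rewrite lerD2l.
rewrite /Q.
have [phi [n1 n2 pX pe]] := hdense fX e0.
have [g [bg dX gN gW]] := HKj t phi t1 n1 n2; rewrite -/(dst t phi) in gN gW.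
set W := t ^- n * N (cderiv n g) in gW.
have gX : car g by case: bg. have gS := bl_sfin t1 bg.
have GgX := G_car t1 gX gS.
have [_ _ d3] := hK t1 bg GgX; rewrite -/W in d3.
have [sg1 sg2] := bandlimited_smooth ctheta PC bg t0.
have [vX _] := carB fX gX; have [vS _] := sfinB ga0 t1 (hx t1) fS gS.
have hE : N (dst t phi) <= N (dst t f) + c0 * e.
  have [X1 _] := dst_car t1 pX; apply: (le_trans (norm_le_sub X1 dfX)); rewrite lerD2l.
  have [Y _] := carB pX fX; have [_ l1] := dst_car t1 Y; rewrite dstB// in l1.
  by apply: (le_trans l1); apply: ler_wpM2l => //; rewrite normCB// ltW.
have hN : N (f \- g)%R <= e + Kj * N (dst t phi).
  by apply: (le_trans (norm_triangle fX pX gX)); apply: lerD => //; exact: ltW.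
(* At the nodes [phi] gives no information about [f]; instead [f] enters through its own sampled
   modulus and [g] through its derivative. *)
have hS : sn (x t) X (f \- g)%R <= sn (x t) X (st t f) + Ks * W + Kd * N (f \- g)%R.
  have [vs1 _ vs2] := HKd t (x t) _ t1 (hx t1) vX vS; apply: (le_trans vs2); rewrite lerD2r.
  have [gs1 gs2] := HKs t (x t) _ t1 (hx t1) sg1 sg2 dX.
  rewrite -/(st t _) stB//; have [_ l2] := sfinB ga0 t1 (hx t1) sfS gs1.
  by apply: (le_trans l2); rewrite lerD2l.
apply: (chain_le a0 b0 Kj0 Ks0 Kd0 D10 D20 _ hS hN gW hE).
have bGg := (hG t1 gX gS).1; have bGf := (hG t1 fX fS).1.
have rg := bandlimited_reproduced PC ctheta t1 bg.
have rGg := bandlimited_reproduced PC ctheta t1 bGg; have rGf := bandlimited_reproduced PC ctheta t1 bGf.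
have [S1 s1] := HKr t (x t) _ t1 (hx t1) (reproducedB PC ctheta t1 rg rGg).
have [S2 s2] := HKr t (x t) _ t1 (hx t1) (reproducedB PC ctheta t1 rGg rGf).
have m2 : N (G t g \- G t f)%R <= K1 * sn (x t) X (f \- g)%R.
  have [_ <-] := snC ga0 t1 (hx t1) vS; exact: (G_sub t1 gX gS fX fS).
have L1 : N (f \- G t f)%R <= N (f \- g)%R + (K3 * W + K1 * sn (x t) X (f \- g)%R).
  apply: (le_trans (norm_triangle fX gX GfX)); rewrite lerD2l.
  by apply: (le_trans (norm_triangle gX GgX GfX)); exact: lerD.
have L2 : sn (x t) X (f \- G t f)%R <= sn (x t) X (f \- g)%R + (Kr * (K3 * W) + Kr * (K1 * sn (x t) X (f \- g)%R)).
  have [S3 s3] := sn_triangle ga0 t1 (hx t1) S1 S2.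
  have [_ s4] := sn_triangle ga0 t1 (hx t1) vS S3.
  apply: (le_trans s4); rewrite lerD2l; apply: (le_trans s3); apply: lerD.
    by apply: (le_trans s1); exact: ler_wpM2l.
  by apply: (le_trans s2); exact: ler_wpM2l.
apply: (le_trans (lerD L1 L2)); rewrite le_eqVlt; apply/orP; left; apply/eqP.
by rewrite /a /b; ring.
Qed.

End equivalence.

Theorem theorem4p3 (R : realType) (X : banach_lattice R)
    (Phi : R -> set (R -> R[i])) (B : R)
    (x : R -> int -> R) (phi : R -> int -> R -> R[i]) (gamma gamma' : R)
    (G : R -> (R -> R[i]) -> (R -> R[i]))
    (r s : nat) (K1 K3 K4 : R) :
  order_continuous_norm X -> schwartz_dense X -> assumptionA X ->
  0 < B -> bernstein_spaces X Phi B ->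
  0 < gamma -> 0 < gamma' -> sampling_operators X Phi x phi gamma gamma' G ->
  (0 < r)%N -> (0 < s)%N -> (s <= 2 * r)%N ->
  0 < K1 -> 0 < K3 -> 0 < K4 ->
  (forall sigma f, 1 <= sigma -> sampled_space X (x sigma) f ->
     bandlimited X sigma (G sigma f)) ->
  (forall sigma f, 1 <= sigma -> sampled_space X (x sigma) f ->
     (bl_enorm X (G sigma f) <= K1%:E * sample_enorm X (x sigma) f)%E) ->
  (forall sigma g, 1 <= sigma -> bandlimited X sigma g ->
     ((K4 * sigma ^- s)%:E * bl_enorm X (cderiv s g)
        <= bl_enorm X (g \- G sigma g)%R)%E /\
     (bl_enorm X (g \- G sigma g)%R
        <= (K3 * sigma ^- s)%:E * bl_enorm X (cderiv s g))%E) ->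
  exists c C : R, [/\ 0 < c, 0 < C &
    forall sigma f, 1 <= sigma -> sampled_space X (x sigma) f ->
      let lhs := (bl_enorm X (f \- G sigma f)%R
                  + sample_enorm X (x sigma) (f \- G sigma f)%R)%E in
      let rhs := (bl_enorm X (defect (dsteklov (gamma / sigma)) s f)
                  + sample_enorm X (x sigma)
                      (defect (steklov (gamma / sigma)) r f))%E in
      (c%:E * rhs <= lhs)%E /\ (lhs <= C%:E * rhs)%E].
Proof.
move=> _ [SX SD] XA _ _ ga0 ga0' Gop r0 n0 nr K10 K30 K40 Gbl GK1 GK34.
have [C PC] := ex_poisson_bounded XA.
have [theta ctheta] := @ex_cutoff R.
have xn sigma : 1 <= sigma -> nodes gamma gamma' sigma (x sigma).
  by move=> s1 k; have [_ _ + _] := Gop sigma s1.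
have sampledP sigma f : sampled_space X (x sigma) f <-> bl_car X f /\ sfin (x sigma) X f.
  split=> [[fX /sample_enorm_fin fS]|[fX fS]]; first by [].
  by split=> //; rewrite sample_enormE// ltry.
have hG sigma f : 1 <= sigma -> bl_car X f -> sfin (x sigma) X f ->
    bandlimited X sigma (G sigma f) /\ bl_norm X (G sigma f) <= K1 * sn (x sigma) X f.
  move=> s1 fX fS; have sf : sampled_space X (x sigma) f by apply/sampledP.
  have bG := Gbl sigma f s1 sf; split=> //.
  have := GK1 sigma f s1 sf; rewrite sample_enormE// bl_enormE; last by case: bG.
  by rewrite -EFinM lee_fin.
have hsub sigma f g : 1 <= sigma -> bl_car X f -> sfin (x sigma) X f -> bl_car X g ->
    sfin (x sigma) X g -> bl_norm X (G sigma (f \- g) \- (G sigma f \- G sigma g))%R = 0.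
  move=> s1 fX fS gX gS; have [_ _ _ Gc] := Gop sigma s1.
  have [dX _] := carB fX gX; have [dS _] := sfinB ga0 s1 (xn _ s1) fS gS.
  apply: (@sampling_additive _ X (x sigma) (phi sigma) (G sigma)) => //; try by apply/sampledP.
  by move=> h /(Gbl sigma h s1)[].
have hK sigma g : 1 <= sigma -> bandlimited X sigma g -> bl_car X (G sigma g) ->
    [/\ bl_car X (cderiv s g),
      K4 * (sigma ^- s * bl_norm X (cderiv s g)) <= bl_norm X (g \- G sigma g)%R &
      bl_norm X (g \- G sigma g)%R <= K3 * (sigma ^- s * bl_norm X (cderiv s g))].
  move=> s1 bg GgX; have gX : bl_car X g by case: bg.
  have [dX _] := carB gX GgX; have [] := GK34 sigma g s1 bg; rewrite (bl_enormE dX).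
  have k4 : 0 < K4 * sigma ^- s by rewrite mulr_gt0// invr_gt0 exprn_gt0// (lt_le_trans ltr01 s1).
  have [gsX|gsX] := pselect (bl_car X (cderiv s g)).
    by rewrite (bl_enormE gsX) -!EFinM !lee_fin -!mulrA.
  (* Were the derivative outside X, its extended norm would be infinite and the lower estimate would
     contradict the finite norm of g - G g. *)
  by rewrite /bl_enorm asboolF// gt0_muley ?lte_fin.
have hdense f e : bl_car X f -> 0 < e -> exists psi,
    [/\ nice X (re psi), nice X (im psi), bl_car X psi & bl_norm X (f \- psi)%R < e].
  move=> fX e0; have [psi sp pe] := SD f e fX e0; exists psi.
  by have [n1 n2] := schwartz_nice SX sp; split=> //; exact: SX.
have rn : (0 < s <= 2 * r)%N by rewrite n0 nr.
have [Ka Ka0 HKa] := moduli_le_error PC ctheta ga0 ga0' rn K10 K40 xn hG hsub hK.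
have [Kb Kb0 HKb] := error_le_moduli PC ctheta ga0 ga0' rn K10 K30 xn hG hsub hK hdense.
exists (Ka + 1)^-1, (Kb + 1); split; [by rewrite invr_gt0 ltr_wpDl|by rewrite ltr_wpDl|].
move=> sigma f s1 /sampledP[fX fS] lhs rhs; have s0 : 0 < sigma := lt_le_trans ltr01 s1.
have [bG _] := hG sigma f s1 fX fS; have GX : bl_car X (G sigma f) by case: bG.
have [Kr _ HKr] := reproduced_sample PC ga0 ga0' ctheta.
have [GS _] := HKr sigma _ _ s1 (xn _ s1) (bandlimited_reproduced PC ctheta s1 bG).
have [eX _] := carB fX GX; have [eS _] := sfinB ga0 s1 (xn _ s1) fS GS.
have h0 : 0 < gamma / sigma by rewrite divr_gt0.
have dX : bl_car X (defect (dsteklov (gamma / sigma)) s f).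
  rewrite dsteklov_csteklov; have [] // := defect_car PC s h0 _ (lexx 0) fX.
  by rewrite oppr_le0 ltW.
have [Kd _ HKd] := defect_sample PC ga0 ga0' r.
have [dS _ _] := HKd sigma _ f s1 (xn _ s1) fX fS.
rewrite /lhs /rhs !bl_enormE// !sample_enormE// -!EFinD -!EFinM !lee_fin.
have := HKa sigma f s1 fX fS; have := HKb sigma f s1 fX fS.
have : 0 <= bl_norm X (f \- G sigma f)%R + sn (x sigma) X (f \- G sigma f)%R.
  by rewrite addr_ge0 ?bl_norm_ge0//; exact: rn_ge0 eS.
have : 0 <= bl_norm X (defect (dsteklov (gamma / sigma)) s f) +
    sn (x sigma) X (defect (steklov (gamma / sigma)) r f).
  by rewrite addr_ge0 ?bl_norm_ge0//; exact: rn_ge0 dS.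
move: (_ + sn _ _ _) (_ + sn _ _ _) => p q p0 q0 qp pq.
have Ka1 : 0 < Ka + 1 by rewrite ltr_wpDl.
split; first by rewrite ler_pdivrMl// mulrDl mul1r (le_trans pq)// lerDl.
by rewrite mulrDl mul1r (le_trans qp)// lerDl.
Qed.
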